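(* Let $d\ge1$, $\sigma\in\mathbb N$ with $\sigma\ge d+1$, and let $g=\begin{pmatrix} a&\mathbf b^t\\ \mathbf c& D\end{pmatrix}\in \mathrm{SU}(1,d)$ with $a,b_i,c_i\neq0$ for $i=1,\dots,d$. Let $p_i=b_i/a$, $\tilde p_i=c_i/a$, $U_{i,j}=\frac{aD_{j,i}}{b_ic_j}$ for $1\le i,j\le d$, and $|p_0|^2=|a|^{-2}$. Then for all $\mathbf m,\mathbf m',\mathbf n,\mathbf n'\in\mathbb N_0^d$: (i) Orthogonality relations: $$\sum_{\mathbf n\in\mathbb N_0^d}\frac{(\sigma)_{|\mathbf n|}}{\mathbf n!}\mathbf p^{\mathbf n}\overline{\mathbf p}^{\mathbf n}M_{\mathbf m}(\mathbf n;U,\sigma)\overline{M_{\mathbf m'}(\mathbf n;U,\sigma)}=\delta_{\mathbf m,\mathbf m'}\frac{\mathbf m!\,\tilde{\mathbf p}^{-\mathbf m}\,\overline{\tilde{\mathbf p}}^{-\mathbf m}}{(\sigma)_{|\mathbf m|}|p_0|^{2\sigma}},$$ $$\sum_{\mathbf m\in\mathbb N_0^d}\frac{(\sigma)_{|\mathbf m|}}{\mathbf m!}\tilde{\mathbf p}^{\mathbf m}\overline{\tilde{\mathbf p}}^{\mathbf m}M_{\mathbf m}(\mathbf n;U,\sigma)\overline{M_{\mathbf m}(\mathbf n';U,\sigma)}=\delta_{\mathbf n,\mathbf n'}\frac{\mathbf n!\,\mathbf p^{-\mathbf n}\,\overline{\mathbf p}^{-\mathbf n}}{(\sigma)_{|\mathbf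 n|}|p_0|^{2\sigma}}.$$ (ii) Integral representation: $$(-1)^{|\mathbf m|}\tilde{\mathbf p}^{\mathbf m}M_{\mathbf m}(\mathbf n;U,\sigma)=\frac{(\sigma-d)_d}{d!}\int_{\mathbb B_d}\Big(1+\sum_{i=1}^d\tilde p_iz_i\Big)^{-\sigma-|\mathbf n|}\prod_{i=1}^d\Big(1+\sum_{j=1}^dU_{i,j}\tilde p_jz_j\Big)^{n_i}\,\overline{\mathbf z}^{\mathbf m}(1-\|\mathbf z\|^2)^{\sigma-d-1}\,dv,$$ where $\mathbb B_d=\{\mathbf z\in\mathbb C^d:\|\mathbf z\|<1\}$ and $dv$ is Lebesgue measure normalized so that $v(\mathbb B_d)=1$. (iii) Duality: $M_{\mathbf m}(\mathbf n;U,\sigma)=M_{\mathbf n}(\mathbf m;U^t,\sigma)$. (iv) Sum identity: for $h=\begin{pmatrix} a(h)&\mathbf b(h)^t\\ \mathbf c(h)& D(h)\end{pmatrix}\in\mathrm{SU}(1,d)$ with $a(h)$ and all entries $b_i(h),c_i(h)$ of $\mathbf b(h),\mathbf c(h)$ nonzero, write $\mathbf p(h)=(p_1(h),\dots,p_d(h))$ with $p_i(h)=b_i(h)/a(h)$, $\tilde{\mathbf p}(h)=(\tilde p_1(h),\dots,\tilde p_d(h))$ with $\tilde p_i(h)=c_i(h)/a(h)$, and $U(h)=(U_{i,j}(h))$ with $U_{i,j}(h)=\frac{a(h)D_{j,i}(h)}{b_i(h)c_j(h)}$ for $1\le i,j\le d$. If $g_1,g_2\in\mathrm{SU}(1,d)$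 are such that each of $g_1$, $g_2$, $g_1g_2$ has nonzero $a$ and all entries of $\mathbf b$ and $\mathbf c$ nonzero, then $$\left(\frac{a(g_1)a(g_2)}{a(g_1g_2)}\right)^{\sigma}\tilde{\mathbf p}(g_1g_2)^{\mathbf m}\tilde{\mathbf p}(g_1)^{-\mathbf m}\mathbf p(g_1g_2)^{\mathbf n}\mathbf p(g_2)^{-\mathbf n}M_{\mathbf m}(\mathbf n;U(g_1g_2),\sigma)$$ $$=\sum_{\mathbf k\in\mathbb N_0^d}(-1)^{|\mathbf k|}\mathbf p(g_1)^{\mathbf k}\tilde{\mathbf p}(g_2)^{\mathbf k}\frac{(\sigma)_{|\mathbf k|}}{\mathbf k!}M_{\mathbf m}(\mathbf k;U(g_1),\sigma)M_{\mathbf k}(\mathbf n;U(g_2),\sigma).$$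
   Context: Notation: $\mathbb N_0=\{0,1,2,\dots\}$. For $\mathbf x\in\mathbb C^d$: $|\mathbf x|=x_1+\cdots+x_d$ (plain sum), $\|\mathbf x\|=\sqrt{|x_1|^2+\cdots+|x_d|^2}$, $\overline{\mathbf x}$ is the entrywise conjugate. For $\mathbf n\in\mathbb N_0^d$: $\mathbf n!=n_1!\cdots n_d!$, $\mathbf x^{\pm\mathbf n}=x_1^{\pm n_1}\cdots x_d^{\pm n_d}$. $(\beta)_n=\beta(\beta+1)\cdots(\beta+n-1)$. Group: $J=\mathrm{diag}(1,-1,\ldots,-1)$ of size $d+1$; $\mathrm{SU}(1,d)=\{g\in \mathrm{SL}(d+1,\mathbb C): g^\dagger Jg=J\}$. Elements are written in block form $g=\begin{pmatrix} a&\mathbf b^t\\ \mathbf c& D\end{pmatrix}$ with $a\in\mathbb C$, $\mathbf b,\mathbf c\in\mathbb C^d$, $D$ a complex $d\times d$ matrix. Multivariate Meixner polynomials: for $\beta\in\mathbb C\setminus(-\mathbb N_0)$ and a complex $d\times d$ matrix $U=(U_{i,j})$, $M_{\mathbf n}(\mathbf x;U,\beta)$ ($\mathbf n\in\mathbb N_0^d$, $\mathbf x\in\mathbb C^d$) is defined by $$\Big(1-\sum_{j=1}^dt_j\Big)^{-\beta-|\mathbf x|}\prod_{i=1}^d\Big(1-\sum_{j=1}^dU_{i,j}t_j\Big)^{x_i}=\sum_{\mathbf n\in\mathbb N_0^d}\frac{(\beta)_{|\mathbf n|}}{\mathbf n!}M_{\mathbf n}(\mathbf x;U,\beta)\,\mathbf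 t^{\mathbf n}$$ for $\mathbf t\in\mathbb C^d$ sufficiently close to $0$ (principal branches of powers). *)

(* Defs.v *)
From HB Require Import structures.
From mathcomp Require Import all_boot all_order all_algebra.
From mathcomp Require Import finmap sesquilinear spectral complex.
From mathcomp Require Import all_classical all_reals all_analysis.
From mathcomp Require Import summability.

Set Implicit Arguments.
Unset Strict Implicit.
Unset Printing Implicit Defensive.

Import Order.TTheory GRing.Theory Num.Theory.
Import numFieldNormedType.Exports.

Local Open Scope classical_set_scope.
Local Open Scope ring_scope.
Local Open Scope sesquilinear_scope.

Definition mindex (d : nat) := {ffun 'I_d -> nat}.

(* Unconditional (over R[i]: absolute) convergence, i.e. convergence of the net
   of partial sums indexed by the directed set of finite sets of indices. *)
Definition has_sum (I : choiceType) (K : numFieldType) (f : I -> K) (s : K) :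
  Prop := partial_sum f @ totally --> s.

Section Powers.
Context {R : realType}.
Local Notation C := (R[i]).

(* Principal argument, with values in ]-pi, pi] for z != 0. *)
Definition carg (z : C) : R :=
  let r := complex.Re `|z| in
  if 0 <= complex.Im z then acos (complex.Re z / r)
  else - acos (complex.Re z / r).

Definition cln (z : C) : C := Complex (ln (complex.Re `|z|)) (carg z).

Definition cexp (z : C) : C :=
  Complex (expR (complex.Re z) * cos (complex.Im z))
          (expR (complex.Re z) * sin (complex.Im z)).

(* Principal branch of z ^ w, meaningful for z != 0. *)
Definition cpow (z w : C) : C := cexp (w * cln z).

Definition poch (b : C) (n : nat) : C := \prod_(k < n) (b + k%:R).

End Powers.

Section Vectors.
Context {R : realType} {d : nat}.
Local Notation C := (R[i]).

Definition mabs (n : mindex d) : nat := (\sum_i n i)%N.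

Definition mfact (n : mindex d) : nat := (\prod_i (n i)`!)%N.

Definition vsum (x : 'rV[C]_d) : C := \sum_i x 0 i.

(* The library norm on row vectors is the sup norm. *)
Definition enorm (x : 'rV[C]_d) : C := sqrtC (\sum_i `|x 0 i| ^+ 2).

Definition vconj (x : 'rV[C]_d) : 'rV[C]_d := map_mx Num.conj x.

Definition mpow (x : 'rV[C]_d) (n : mindex d) : C := \prod_i x 0 i ^+ n i.

Definition mpowN (x : 'rV[C]_d) (n : mindex d) : C := \prod_i x 0 i ^- n i.

Definition mvec (n : mindex d) : 'rV[C]_d := \row_i (n i)%:R.

End Vectors.

Section Meixner.
Context {R : realType} {d : nat}.
Local Notation C := (R[i]).
Implicit Types (U : 'M[C]_d) (beta : C) (x t : 'rV[C]_d).

Definition meixner_genfun U beta x t : C :=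
  cpow (1 - \sum_j t 0 j) (- beta - vsum x)
  * \prod_i cpow (1 - \sum_j U i j * t 0 j) (x 0 i).

Definition meixner_expansion U beta x (M : mindex d -> C) : Prop :=
  exists2 r : C, 0 < r & forall t, enorm t < r ->
    has_sum (fun n => poch beta (mabs n) / (mfact n)%:R * M n * mpow t n)
            (meixner_genfun U beta x t).

(* The family of values M_n(x; U, beta) is determined by its generating
   function as soon as beta is not in {0, -1, -2, ...}; otherwise the value
   is unspecified. *)
Definition meixner U beta (n : mindex d) x : C :=
  xget (fun=> 0) (meixner_expansion U beta x) n.

End Meixner.

Section SU1d.
Context {R : realType} {d : nat}.
Local Notation C := (R[i]).
Implicit Types g : 'M[C]_(1 + d).

Definition mxJ : 'M[C]_(1 + d) := block_mx 1%:M 0 0 (- 1%:M).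

Definition SU1 g : Prop := \det g = 1 /\ g ^t* *m mxJ *m g = mxJ.

(* g = [a, b^t; c, D], with b and c both stored as row vectors. *)
Definition ablk g : C := ulsubmx g 0 0.
Definition bblk g : 'rV[C]_d := ursubmx g.
Definition cblk g : 'rV[C]_d := (dlsubmx g)^T.
Definition Dblk g : 'M[C]_d := drsubmx g.

Definition nondeg g : Prop :=
  ablk g != 0 /\ forall i, bblk g 0 i != 0 /\ cblk g 0 i != 0.

Definition pvec g : 'rV[C]_d := \row_i (bblk g 0 i / ablk g).
Definition ptvec g : 'rV[C]_d := \row_i (cblk g 0 i / ablk g).
Definition Umx g : 'M[C]_d :=
  \matrix_(i, j) (ablk g * Dblk g j i / (bblk g 0 i * cblk g 0 j)).

End SU1d.

Section LebesgueRn.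
Context {R : realType}.
Local Notation Rm := (measurableTypeR R).

Section step.
Variables (n : nat) (mu : {sigma_finite_measure set (n.-tuple Rm) -> \bar R}).

Definition tcons (p : Rm * n.-tuple Rm) : n.+1.-tuple Rm :=
  [the n.+1.-tuple Rm of p.1 :: p.2].

Let measurable_tcons : measurable_fun [set: Rm * n.-tuple Rm] tcons.
Proof. by apply: measurable_cons. Qed.

Definition lebesgue_step : set (n.+1.-tuple Rm) -> \bar R :=
  pushforward (@lebesgue_measure R \x mu)%E tcons.

Let lebesgue_step0 : lebesgue_step set0 = 0%E.
Proof. by rewrite /lebesgue_step measure0. Qed.

Let lebesgue_step_ge0 A : (0 <= lebesgue_step A)%E.
Proof. exact: measure_ge0. Qed.

Let lebesgue_step_sigma_additive : semi_sigma_additive lebesgue_step.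
Proof.
rewrite /lebesgue_step.
exact: (@measure_semi_sigma_additive _ _ _
  (measure_function_pushforward__canonical__measure_function_Measure
     (lebesgue_measure \x mu)%E measurable_tcons)).
Qed.

HB.instance Definition _ := isMeasure.Build _ _ _ lebesgue_step
  lebesgue_step0 lebesgue_step_ge0 lebesgue_step_sigma_additive.

Let lebesgue_step_sigma_finite : sigma_finite setT lebesgue_step.
Proof.
have /sigma_finiteP[F [TF ndF Foo]] := sigma_finiteT (@lebesgue_measure R).
have /sigma_finiteP[G [TG ndG Goo]] := sigma_finiteT mu.
have mhead : measurable_fun setT (fun t : n.+1.-tuple Rm => thead t).
  exact: measurable_tnth.
have mtail : measurable_fun setT (fun t : n.+1.-tuple Rm => [tuple of behead t]).
  exact: measurable_behead.
exists (fun k => (fun t : n.+1.-tuple Rm => thead t) @^-1` F k `&`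
                 (fun t : n.+1.-tuple Rm => [tuple of behead t]) @^-1` G k).
  apply/esym/seteqP; split=> // t _.
  have [i _ Fi] : (\bigcup_i F i) (thead t) by rewrite -TF.
  have [j _ Gj] : (\bigcup_i G i) [tuple of behead t] by rewrite -TG.
  exists (maxn i j) => //; split => /=.
    by move: Fi; exact/subsetPset/ndF/leq_maxl.
  by move: Gj; exact/subsetPset/ndG/leq_maxr.
move=> k; have [mF Fk] := Foo k; have [mG Gk] := Goo k; split.
  apply: measurableI.
    by rewrite -[X in measurable X]setTI; exact: mhead.
  by rewrite -[X in measurable X]setTI; exact: mtail.
rewrite /lebesgue_step /pushforward.
rewrite (_ : _ @^-1` _ = F k `*` G k); last first.
  have E (x : Rm) (y : n.-tuple Rm) :
      thead (tcons (x, y)) = x /\ [tuple of behead (tcons (x, y))] = y.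
    by split; [rewrite /thead (tnth_nth x) | apply/val_inj].
  by rewrite predeqE => -[x y] /=; have [-> ->] := E x y.
by rewrite product_measure1E// lte_mul_pinfty// ge0_fin_numE.
Qed.

HB.instance Definition _ := Measure_isSigmaFinite.Build _ _ _
  lebesgue_step lebesgue_step_sigma_finite.

End step.

(* Lebesgue measure on R^n, realized as n.-tuple; R^0 carries a point mass. *)
Fixpoint lebesgueRn n : {sigma_finite_measure set (n.-tuple Rm) -> \bar R} :=
  if n is k.+1 then lebesgue_step (lebesgueRn k)
  else dirac ([tuple] : 0.-tuple Rm).

End LebesgueRn.

Section BallIntegral.
Context {R : realType} {d : nat}.
Local Notation C := (R[i]).
Local Notation Rm := (measurableTypeR R).

(* C^d is identified with R^(d + d), real parts first. *)
Definition cvec (w : (d + d).-tuple Rm) : 'rV[C]_d :=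
  \row_j Complex (tnth w (lshift d j) : R) (tnth w (rshift d j) : R).

Definition cball : set ((d + d).-tuple Rm) := [set w | enorm (cvec w) < 1].

Definition ball_mean (u : (d + d).-tuple Rm -> R) : R :=
  (\int[lebesgueRn (d + d)]_(w in cball) u w)
  / fine (lebesgueRn (d + d) cball).

(* f is integrable on the unit ball, and s is its integral against Lebesgue
   measure normalized to give the ball mass 1. *)
Definition has_ball_integral (f : 'rV[C]_d -> C) (s : C) : Prop :=
  let fRe w := complex.Re (f (cvec w)) in
  let fIm w := complex.Im (f (cvec w)) in
  [/\ (lebesgueRn (d + d)).-integrable cball (EFin \o fRe),
      (lebesgueRn (d + d)).-integrable cball (EFin \o fIm)
    & s = Complex (ball_mean fRe) (ball_mean fIm)].

End BallIntegral.

(* Main.v *)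
Require Import Defs.
From mathcomp Require Import all_boot all_order all_algebra.
From mathcomp Require Import finmap complex.
From mathcomp Require Import all_classical all_reals all_analysis.
From mathcomp Require Import summability measurable_realfun ring zify.

Set Implicit Arguments.
Unset Strict Implicit.
Unset Printing Implicit Defensive.

Import Order.TTheory GRing.Theory Num.Theory.
Import numFieldNormedType.Exports.
Local Open Scope ring_scope.

(** The Meixner polynomials are matrix coefficients of the discrete series
    representation of SU(1,d) of weight sigma.  A matrix g acts on row vectors
    w = (w_0, w') on the right, hence on functions that are homogeneous of
    degree - sigma in w.  The functions F_n(w) = w_0^(- sigma - |n|) w'^n restrict
    to the monomials z^n on the affine chart w = (1, z), and the coefficients
    T_mn(g) of z^m in F_n((1, z) g) ([matcoef]) are, up to explicit monomials in
    p and p~, the numbers (sigma)_|m| / m! M_m(n; U): indeed the generating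
    function of the M_m(n; U) is F_n((1, t) g_U) for an explicit matrix g_U
    ([meixnerE]), and g is g_U up to diagonal factors ([matcoef_meixner]).

    Since (w g_1) g_2 = w (g_1 g_2), the matrices T multiply:
    T(g_1 g_2) = T(g_1) T(g_2) ([matcoef_mul]); this is the sum identity.  The
    kernel (w_0 v_0 - w'.v')^(- sigma) equals the sum of
    (sigma)_|n| / n! F_n(w) F_n(v), and moving g from w to v in it shows that
    n! / (sigma)_|n| T_nm(J g^t J) = m! / (sigma)_|m| T_mn(g) ([matcoef_dual]).
    Applied to g_U this is the duality.  Applied to the conjugate of g in SU(1,d),
    for which the matrix on the left becomes the inverse of g, it makes
    T(g) T(g^-1) = 1 and T(g^-1) T(g) = 1 the two orthogonality relations.

    All series converge absolutely.  To control them, a power series is always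
    considered together with a bound on the sum of its absolute values, obtained
    by replacing the data by their absolute values ([asum_matcoef]).  For
    pseudo-unitary matrices |a|^2 - |b|^2 = |a|^2 - |c|^2 = 1, which places the
    majorants in their domain of convergence.  Rearrangements are justified by
    Fubini's theorem for sums and by uniqueness of coefficients
    ([exchange_coef]).

    For the integral representation one expands F_n((1, z) g) in powers of z,
    uniformly on the ball, and integrates term by term.  It remains to know that
    the monomials are orthogonal on the ball for the weight
    (1 - |z|^2)^(sigma - d - 1), with squared norms m! / (sigma)_|m| after
    normalization ([moment_offdiag], [moment_nb]).  This needs neither polar
    coordinates nor gamma functions: the integral over the ball of a derivative
    of z^k zbar^m (1 - |z|^2)^(s + 1) along a real coordinate is 0, by Fubini's
    theorem and the fundamental theorem of calculus ([integral_dmono_part]), and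
    the resulting integration by parts formula for d/dzbar_j ([moment_step])
    determines all moments in terms of the volume. *)

(** * Unconditional sums *)

Section HasSum.
Variables (I : choiceType) (K : numFieldType).
Implicit Types (f g : I -> K) (s : K) (A : {fset I}).

Lemma partial_sumE f A : partial_sum f A = \sum_(i <- A) f i.
Proof. by rewrite /partial_sum big_seq_fsetE. Qed.

(** The net definition of [has_sum], put in the form in which all estimates
    below are made. *)
Lemma has_sumP f s : has_sum f s <->
  forall e, 0 < e -> exists A0 : {fset I}, forall A, (A0 `<=` A)%fset -> `|s - \sum_(i <- A) f i| < e.
Proof.
have FT := @totally_filter I.
split=> [fs e e0|h].
  move/cvgrPdist_lt : fs => /(_ e e0) [A0 _ sub].
  by exists A0 => A A0A; have := sub A A0A; rewrite /= partial_sumE.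
apply/cvgrPdist_lt => e /h [A0 hA]; exists A0 => // A /= A0A.
by rewrite partial_sumE; exact: hA.
Qed.

Lemma has_sum_unique f s s' : has_sum f s -> has_sum f s' -> s = s'.
Proof.
move=> /has_sumP h /has_sumP h'; apply/eqP; rewrite -subr_eq0 -normr_le0.
apply/ler_addgt0Pr => e e0; rewrite add0r.
have e2 : 0 < e / 2 by rewrite divr_gt0.
have [A hA] := h _ e2; have [A' hA'] := h' _ e2.
have := hA _ (fsubsetUl A A'); have := hA' _ (fsubsetUr A A').
set S := \sum_(i <- _) _ => l1 l2.
rewrite (_ : s - s' = (s - S) - (s' - S)); last by rewrite opprB addrA subrK.
by rewrite (le_trans (ler_normB _ _)) // [e in leRHS]splitr ltW // ltrD.
Qed.

Lemma eq_has_sum f g s : f =1 g -> has_sum f s -> has_sum g s.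
Proof. by move=> /funext ->. Qed.

Lemma has_sum_fin f A : (forall i, i \notin A -> f i = 0) ->
  has_sum f (\sum_(i <- A) f i).
Proof.
move=> f0; apply/has_sumP => e e0; exists A => B AB.
by rewrite (big_fset_incl _ AB) ?subrr ?normr0 // => i _; exact: f0.
Qed.

Lemma has_sum0 : has_sum (fun _ : I => 0 : K) 0.
Proof.
by have := @has_sum_fin (fun=> 0) fset0 (fun _ _ => erefl); rewrite big_seq_fset0.
Qed.

Lemma has_sumD f g s t : has_sum f s -> has_sum g t ->
  has_sum (fun i => f i + g i) (s + t).
Proof.
move=> /has_sumP h /has_sumP h'; apply/has_sumP => e e0.
have e2 : 0 < e / 2 by rewrite divr_gt0.
have [A hA] := h _ e2; have [A' hA'] := h' _ e2.
exists (A `|` A')%fset => B; rewrite fsubUset => /andP[/hA l1 /hA' l2].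
rewrite big_split /= opprD addrACA (le_lt_trans (ler_normD _ _)) //.
by rewrite [e]splitr ltrD.
Qed.

Lemma has_sumZ a f s : has_sum f s -> has_sum (fun i => a * f i) (a * s).
Proof.
move=> /has_sumP h; apply/has_sumP => e e0.
have a0 : 0 < `|a| + 1 by rewrite ltr_wpDl.
have [A hA] := h _ (divr_gt0 e0 a0).
exists A => B /hA; rewrite ltr_pdivlMr // => hB.
rewrite -mulr_sumr -mulrBr normrM (le_lt_trans _ hB) // mulrC.
by rewrite ler_wpM2l // lerDl.
Qed.

Lemma has_sum_sum (J : Type) (r : seq J) (F : J -> I -> K) (S : J -> K) :
  (forall j, has_sum (F j) (S j)) ->
  has_sum (fun i => \sum_(j <- r) F j i) (\sum_(j <- r) S j).
Proof.
move=> h; elim: r => [|j r IH].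
  by rewrite big_nil; apply: eq_has_sum has_sum0 => i; rewrite big_nil.
rewrite big_cons; apply: eq_has_sum (has_sumD (h j) IH) => i.
by rewrite big_cons.
Qed.

Lemma ler_fsum_subset f A B : (A `<=` B)%fset -> (forall i, 0 <= f i) ->
  \sum_(i <- A) f i <= \sum_(i <- B) f i.
Proof.
move=> AB f0; rewrite [leRHS](big_fsetID _ (mem A)) /=.
rewrite [X in _ <= X + _](_ : _ = \sum_(i <- A) f i) ?lerDl ?sumr_ge0 //.
by apply: eq_fbigl => i; rewrite !inE /= andbC; case: (boolP (i \in A)) => // /(fsubsetP AB) ->.
Qed.

Definition bsum f (B : K) := forall A, \sum_(i <- A) `|f i| <= B.

(** The bound on the norms is carried along with the sum because the
    rearrangements below need it: the bounds of the rows of a double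
    series are the terms of the series that has to converge. *)
Definition asum f B s := bsum f B /\ has_sum f s.

Lemma bsum_ge0 f B : bsum f B -> 0 <= B.
Proof. by move=> /(_ fset0); rewrite big_seq_fset0. Qed.

Lemma bsum_le f g B : (forall i, `|f i| <= `|g i|) -> bsum g B -> bsum f B.
Proof. by move=> fg h A; apply: le_trans (h A); apply: ler_sum. Qed.

Lemma bsumW f B B' : B <= B' -> bsum f B -> bsum f B'.
Proof. by move=> BB h A; exact: le_trans (h A) BB. Qed.

Lemma bsumD f g B B' : bsum f B -> bsum g B' -> bsum (fun i => f i + g i) (B + B').
Proof.
move=> h h' A; apply: le_trans (lerD (h A) (h' A)).
by rewrite -big_split ler_sum // => i _; exact: ler_normD.
Qed.

Lemma bsumZ a f B : bsum f B -> bsum (fun i => a * f i) (`|a| * B).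
Proof.
move=> h A; under eq_bigr do rewrite normrM.
by rewrite -mulr_sumr ler_wpM2l.
Qed.

Lemma bsum_sum (J : Type) (r : seq J) (F : J -> I -> K) (B : J -> K) :
  (forall j, bsum (F j) (B j)) ->
  bsum (fun i => \sum_(j <- r) F j i) (\sum_(j <- r) B j).
Proof.
move=> h A; apply: (@le_trans _ _ (\sum_(i <- A) \sum_(j <- r) `|F j i|)).
  by apply: ler_sum => i _; exact: ler_norm_sum.
by rewrite exchange_big ler_sum // => j _; exact: h.
Qed.

Lemma bsum_fin f A : (forall i, i \notin A -> f i = 0) ->
  bsum f (\sum_(i <- A) `|f i|).
Proof.
move=> f0 E; rewrite (big_fset_incl _ (fsubsetUr E A)) => [|i _ /f0 ->]; last first.
  exact: normr0.
by apply: ler_fsum_subset => //; exact: fsubsetUl.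
Qed.

Lemma bsum_has_sum_le f B s : bsum f B -> has_sum f s -> `|s| <= B.
Proof.
move=> fB /has_sumP h; apply/ler_addgt0Pr => e e0.
have [A hA] := h _ e0; have {}hA := hA _ (fsubset_refl A).
rewrite -(subrK (\sum_(i <- A) f i) s) addrC [in leRHS]addrC.
rewrite addrC (le_trans (ler_normD _ _)) // lerD ?(ltW hA) //.
exact: le_trans (ler_norm_sum _ _ _) (fB A).
Qed.

Lemma asumZ a f B s : asum f B s -> asum (fun i => a * f i) (`|a| * B) (a * s).
Proof. by case=> ? ?; split; [exact: bsumZ|exact: has_sumZ]. Qed.

End HasSum.

Arguments has_sumZ {I K} a {f s}.
Arguments bsumZ {I K} a {f B}.
Arguments asumZ {I K} a {f B s}.
Arguments has_sum_sum {I K J} r {F S}.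
Arguments bsum_sum {I K J} r {F B}.

Section Reindex.
Variables (I J : choiceType) (K : numFieldType) (phi : I -> J) (psi : J -> I).
Hypothesis phiK : cancel phi psi.

Let pre (A : {fset J}) : {fset I} := [fset psi j | j in A & phi (psi j) == j]%fset.

Let sum_pre (V : nmodType) (F : J -> V) (A : {fset J}) :
  (forall j, phi (psi j) != j -> F j = 0) ->
  \sum_(j <- A) F j = \sum_(i <- pre A) F (phi i).
Proof.
move=> F0; rewrite big_imfset /=; last first.
  move=> x y /andP[_ /eqP xE] /andP[_ /eqP yE] e.
  by rewrite -xE -yE e.
rewrite (bigID (fun j => phi (psi j) == j)) /= [X in _ + X]big1 ?addr0; last first.
  by move=> j; exact: F0.
by rewrite big_filter; apply: eq_bigr => j /eqP ->.
Qed.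

(** As [psi] is a left inverse of [phi], the condition [phi (psi j) != j] says
    that [j] is outside of the range of [phi]. *)
Lemma has_sum_reindex (f : J -> K) s :
  (forall j, phi (psi j) != j -> f j = 0) ->
  has_sum (fun i => f (phi i)) s -> has_sum f s.
Proof.
move=> f0 /has_sumP h; apply/has_sumP => e e0; have [A hA] := h _ e0.
exists (phi @` A)%fset => B AB; rewrite sum_pre //; apply: hA.
apply/fsubsetP => i iA; apply/imfsetP; exists (phi i); rewrite /= ?phiK //.
rewrite !inE phiK eqxx andbT; apply: (fsubsetP AB); exact: in_imfset.
Qed.

Lemma bsum_reindex (f : J -> K) B :
  (forall j, phi (psi j) != j -> f j = 0) ->
  bsum (fun i => f (phi i)) B -> bsum f B.
Proof.
by move=> f0 h A; rewrite sum_pre // => j /f0 ->; rewrite normr0.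
Qed.

Lemma bsum_comp (f : J -> K) B : bsum f B -> bsum (fun i => f (phi i)) B.
Proof.
move=> h A; apply: le_trans (h (phi @` A)%fset).
by rewrite big_imfset //= => x y _ _ /(can_inj phiK).
Qed.

End Reindex.

Section Existence.
Variables (I : choiceType) (R : realType).
Local Notation C := (R[i]).

(** The sum is the supremum of the finite partial sums. *)
Lemma bsum_has_sum_ge0 (h : I -> R) B : (forall i, 0 <= h i) -> bsum h B ->
  exists s, has_sum h s.
Proof.
move=> h0 hB; pose E := [set x : R | exists A : {fset I}, x = \sum_(i <- A) h i]%classic.
have supE : has_sup E.
  split; first by exists (\sum_(i <- fset0 : {fset I}) h i), fset0.
  exists B => _ [A ->]; apply: le_trans (hB A).
  by apply: ler_sum => i _; rewrite ger0_norm.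
exists (sup E); apply/has_sumP => e e0.
have [_ [A0 ->] lA0] := sup_adherent e0 supE.
exists A0 => A A0A; have le1 := ler_fsum_subset A0A h0.
have le2 : \sum_(i <- A) h i <= sup E by apply: sup_upper_bound => //; exists A.
by rewrite ger0_norm ?subr_ge0 // ltrBlDr addrC -ltrBlDr (lt_le_trans lA0).
Qed.

Lemma bsum_has_sum_real (h : I -> R) B : bsum h B -> exists s, has_sum h s.
Proof.
move=> hB.
have [s1 h1] : exists s, has_sum (fun i => `|h i| + h i) s.
  apply: (@bsum_has_sum_ge0 _ (B + B)) => [i|].
    by rewrite -lerBlDr sub0r -normrN ler_norm.
  by apply: bsumD => // A; under eq_bigr do rewrite normr_id.
have [s2 h2] : exists s, has_sum (fun i => `|h i|) s.
  by apply: (@bsum_has_sum_ge0 _ B) => // A; under eq_bigr do rewrite normr_id.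
have h3 := has_sumD h1 (has_sumZ (-1 : R) h2).
exists (s1 + (-1) * s2); apply: (eq_has_sum _ h3) => i /=.
by rewrite mulN1r addrAC subrr add0r.
Qed.

Lemma normc_real (x : R) : `|x%:C%C| = `|x|%:C%C :> C.
Proof. by rewrite normc_def /= expr0n /= addr0 sqrtr_sqr. Qed.

Lemma gt0_complexE (e : C) : 0 < e -> e = (complex.Re e)%:C%C.
Proof. by move=> /gtr0_real/RRe_real ->. Qed.

Lemma has_sum_complex (h : I -> R) s : has_sum h s ->
  has_sum (fun i => (h i)%:C%C : C) (s%:C)%C.
Proof.
move=> /has_sumP hs; apply/has_sumP => e e0.
have := e0; rewrite {1}(gt0_complexE e0) ltcR => /hs [A hA].
exists A => B /hA hB; rewrite -[X in _ - X]rmorph_sum /= -rmorphB normc_real.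
by rewrite (gt0_complexE e0) ltcR.
Qed.

Lemma Re_norm_le (z : C) : (`|complex.Re z|%:C)%C <= `|z|.
Proof. exact: normc_ge_Re. Qed.

Lemma Im_norm_le (z : C) : (`|complex.Im z|%:C)%C <= `|z|.
Proof.
have := normc_ge_Re (z * 'i%C); rewrite ReiNIm normrN normrM.
by rewrite (_ : `|'i%C| = 1 :> C) ?mulr1 // normc_def /= expr0n add0r expr1n sqrtr1.
Qed.

Lemma bsum_has_sum (f : I -> C) B : bsum f B -> exists s, has_sum f s.
Proof.
move=> fB.
have B0 := bsum_ge0 fB.
have rB : (complex.Re B)%:C%C = B by apply: RRe_real; exact: ger0_real.
have [s h] : exists s, has_sum (fun i => complex.Re (f i)) s.
  apply: (@bsum_has_sum_real _ (complex.Re B)) => A.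
  rewrite -lecR rB rmorph_sum /= (le_trans _ (fB A)) //.
  by apply: ler_sum => i _; exact: Re_norm_le.
have [t h'] : exists s, has_sum (fun i => complex.Im (f i)) s.
  apply: (@bsum_has_sum_real _ (complex.Re B)) => A.
  rewrite -lecR rB rmorph_sum /= (le_trans _ (fB A)) //.
  by apply: ler_sum => i _; exact: Im_norm_le.
have h3 := has_sumD (has_sum_complex h) (has_sumZ ('i%C : C) (has_sum_complex h')).
exists (s%:C + 'i%C * t%:C)%C; apply: (eq_has_sum _ h3) => i /=.
by rewrite [RHS]complexE.
Qed.

Lemma has_sum_conj (f : I -> C) s : has_sum f s ->
  has_sum (fun i => (f i)^*) s^*.
Proof.
move=> /has_sumP hs; apply/has_sumP => e /hs [A hA].
exists A => B /hA; suff -> : \sum_(i <- B) (f i)^* = (\sum_(i <- B) f i)^*.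
  by rewrite -rmorphB norm_conjC.
by rewrite rmorph_sum.
Qed.

Lemma norm_le_ReIm (z : C) : `|z| <= (`|complex.Re z| + `|complex.Im z|)%:C%C.
Proof.
rewrite {1}(complexE z) (le_trans (ler_normD _ _)) // normrM.
rewrite (_ : `|'i%C| = 1 :> C); last by rewrite normc_def /= expr0n add0r expr1n sqrtr1.
by rewrite mul1r !normc_real rmorphD.
Qed.

(** Unconditional convergence is absolute for complex families.  The Cauchy
    criterion bounds the sum over any finite set that avoids some fixed
    finite set; applying it to the indices where the real part (then the
    imaginary part) has a constant sign bounds the sum of the absolute
    values. *)
Lemma has_sum_bsum (f : I -> C) s : has_sum f s -> exists B, bsum f B.
Proof.
move=> /has_sumP /(_ 1 ltr01) [A0 hA0].
have tail (A : {fset I}) : (forall i, i \in A -> i \notin A0) ->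
    `|\sum_(i <- A) f i| <= 2.
  move=> AA0; have l1 := hA0 _ (fsubset_refl A0).
  have := hA0 _ (fsubsetUl A0 A).
  rewrite (_ : \sum_(i <- (A0 `|` A)%fset) f i
             = \sum_(i <- A0) f i + \sum_(i <- A) f i); last first.
    rewrite (big_fsetID _ (mem A0)) /=; congr (_ + _); apply: eq_fbigl => i.
      by rewrite !inE /=; case: (i \in A0); rewrite ?andbF.
    rewrite !inE /=; case: (boolP (i \in A)) => [/AA0 ->|_]; first by rewrite orbT.
    by rewrite orbF andbN.
  move=> l2; rewrite -(opprK (\sum_(i <- A) f i)) normrN.
  set S := \sum_(i <- A0) _ in l1 l2; set T := \sum_(i <- A) _ in l2 *.
  rewrite (_ : - T = (s - (S + T)) - (s - S)); last by ring.
  by rewrite (le_trans (ler_normB _ _)) // -[2]/(1 + 1) lerD // ltW.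
have comp (u : C -> R) : (forall z, `|u z|%:C%C <= `|z|) ->
    (forall x y, u (x + y) = u x + u y) -> u 0 = 0 ->
    forall A : {fset I}, (forall i, i \in A -> i \notin A0) ->
    \sum_(i <- A) `|u (f i)|%:C%C <= (2 + 2 :> C).
  move=> ule uD u0 A AA0.
  have umorph (E : {fset I}) : u (\sum_(i <- E) f i) = \sum_(i <- E) u (f i).
    exact: (big_morph u uD u0).
  rewrite (big_fsetID _ (fun i => 0 <= u (f i))) /= lerD //.
    set E := [fset _ in _ | _]%fset.
    have -> : \sum_(i <- E) `|u (f i)|%:C%C = `|u (\sum_(i <- E) f i)|%:C%C :> C.
      rewrite umorph ger0_norm; last first.
        by rewrite big_seq sumr_ge0 // => i; rewrite !inE /= => /andP[].
      rewrite rmorph_sum /= [LHS]big_seq [RHS]big_seq; apply: eq_bigr => i.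
      by rewrite !inE /= => /andP[_ /ger0_norm ->].
    rewrite (le_trans (ule _)) // tail // => i.
    by rewrite !inE /= => /andP[/AA0].
  set E := [fset _ in _ | _]%fset.
  have -> : \sum_(i <- E) `|u (f i)|%:C%C = `|u (\sum_(i <- E) f i)|%:C%C :> C.
    rewrite umorph -normrN ger0_norm; last first.
      rewrite -sumrN big_seq sumr_ge0 // => i; rewrite !inE /= -ltNge.
      by move=> /andP[_ /ltW]; rewrite oppr_ge0.
    rewrite -sumrN rmorph_sum /= [LHS]big_seq [RHS]big_seq; apply: eq_bigr => i.
    by rewrite !inE /= -ltNge => /andP[_ /ltr0_norm ->].
  rewrite (le_trans (ule _)) // tail // => i.
  by rewrite !inE /= => /andP[/AA0].
exists (\sum_(i <- A0) `|f i| + (2 + 2 + (2 + 2))) => A.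
rewrite (big_fsetID _ (mem A0)) /= lerD //.
  by apply: ler_fsum_subset => //; apply/fsubsetP => i; rewrite !inE => /andP[].
set E := [fset _ in _ | _]%fset.
have EA0 i : i \in E -> i \notin A0 by rewrite !inE => /andP[].
rewrite (le_trans (ler_sum _ (fun i _ => norm_le_ReIm (f i)))) //.
under eq_bigr do rewrite rmorphD.
rewrite big_split lerD //.
  by apply: comp EA0; [exact: Re_norm_le|exact: raddfD|exact: raddf0].
by apply: comp EA0; [exact: Im_norm_le|exact: raddfD|exact: raddf0].
Qed.

End Existence.

Section Fubini.
Variables (I J : choiceType).

Lemma sum_fsetM (V : nmodType) (X : I * J -> V) (A : {fset I}) (E : {fset J}) :
  \sum_(p <- (A `*` E)%fset) X p = \sum_(i <- A) \sum_(j <- E) X (i, j).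
Proof.
rewrite (@big_imfset2 _ _ _ I (fun=> J) (I * J)%type _ _ _ (fun i j => (i, j))) //=.
by move=> [i j] [i' j'] _ _ /= [-> ->].
Qed.

(** A finite rectangle that contains a good finite set of pairs, and whose
    rows are long enough, gives both the total sum and the sum of the row
    sums up to a small error. *)
Lemma has_sum_sigma (K : numFieldType) (X : I * J -> K) S r :
  has_sum X S -> (forall i, has_sum (fun j => X (i, j)) (r i)) -> has_sum r S.
Proof.
move=> /has_sumP hX hr; apply/has_sumP => e e0.
have e2 : 0 < e / 2 by rewrite divr_gt0.
have [A0 hA0] := hX _ e2; exists [fset p.1 | p in A0]%fset => I1 I1sub.
(* The successor keeps the tolerance per row well defined when [I1] is empty. *)
pose n : K := (size I1).+1%:R.
have n0 : 0 < n by rewrite ltr0n.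
have /choice [E0 hE0] : forall i, exists E0 : {fset J}, forall E, (E0 `<=` E)%fset ->
    `|r i - \sum_(j <- E) X (i, j)| < e / 2 / n.
  by move=> i; have /has_sumP/(_ _ (divr_gt0 e2 n0)) := hr i.
pose E := ([fset p.2 | p in A0] `|` \bigcup_(i <- I1) E0 i)%fset.
have sub : (A0 `<=` I1 `*` E)%fset.
  apply/fsubsetP => -[i j] p0; rewrite in_fsetM; apply/andP; split.
    by apply: (fsubsetP I1sub); apply/imfsetP; exists (i, j).
  by rewrite !inE; apply/orP; left; apply/imfsetP; exists (i, j).
have := hA0 _ sub; rewrite sum_fsetM => l1.
have l2 : `|\sum_(i <- I1) (\sum_(j <- E) X (i, j) - r i)| <= e / 2.
  rewrite (le_trans (ler_norm_sum _ _ _)) //.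
  apply: (@le_trans _ _ (\sum_(i <- I1) e / 2 / n)).
    rewrite [leLHS]big_seq [leRHS]big_seq; apply: ler_sum => i iI.
    rewrite distrC ltW // hE0 // /E (fsubset_trans _ (fsubsetUr _ _)) //.
    exact: bigfcup_sup.
  rewrite big_const_seq count_predT iter_addr addr0 -[leLHS]mulr_natr -[leRHS]mulr1.
  by rewrite -mulrA ler_wpM2l ?(ltW e2) // mulrC ler_pdivrMr // mul1r /n ler_nat.
rewrite sumrB in l2.
rewrite -(subrK (\sum_(i <- I1) \sum_(j <- E) X (i, j)) S) -addrA.
by rewrite (le_lt_trans (ler_normD _ _)) // [e]splitr ltr_leD.
Qed.

Lemma bsum_pair (K : numFieldType) (x : I -> J -> K) (b : I -> K) B :
  (forall i, bsum (x i) (b i)) -> bsum b B -> bsum (fun p : I * J => x p.1 p.2) B.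
Proof.
move=> xb bB A; apply: (@le_trans _ _ (\sum_(p <- ([fset p.1 | p in A] `*` [fset p.2 | p in A])%fset) `|x p.1 p.2|)).
  apply: ler_fsum_subset => //; apply/fsubsetP => -[i j] ijA.
  by rewrite in_fsetM; apply/andP; split; apply/imfsetP; exists (i, j).
rewrite sum_fsetM (le_trans _ (bB [fset p.1 | p in A]%fset)) // ler_sum // => i _.
by rewrite (le_trans (xb i _)) // ger0_norm // (bsum_ge0 (xb i)).
Qed.

End Fubini.

(** Both iterated sums agree with the sum over pairs, which exists by absolute
    summability. *)
Lemma has_sum_fubini (I J : choiceType) (R : realType) (x : I -> J -> R[i]) b B r c s :
  (forall i, bsum (x i) (b i)) -> bsum b B ->
  (forall i, has_sum (x i) (r i)) -> (forall j, has_sum (x^~ j) (c j)) ->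
  has_sum r s -> has_sum c s.
Proof.
move=> xb bB hr hc hs; have hp := bsum_pair xb bB.
have [S hS] := bsum_has_sum hp.
have -> : s = S by apply: (has_sum_unique hs); exact: has_sum_sigma hS hr.
pose sw (p : I * J) := (p.2, p.1); pose ws (p : J * I) := (p.2, p.1).
have h : has_sum (fun p : J * I => x p.2 p.1) S.
  apply: (@has_sum_reindex _ _ _ sw ws) => [[] //|[j i]|]; first by rewrite eqxx.
  exact: hS.
exact: has_sum_sigma h hc.
Qed.

Lemma bsum_swap (I J : choiceType) (K : numFieldType) (x : I -> J -> K) b B (A : {fset J}) :
  (forall i, bsum (x i) (b i)) -> bsum b B ->
  forall E : {fset I}, \sum_(i <- E) \sum_(j <- A) `|x i j| <= B.
Proof.
move=> xb bB E; rewrite (le_trans _ (bB E)) // ler_sum // => i _.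
by rewrite (le_trans (xb i _)) // ger0_norm // (bsum_ge0 (xb i)).
Qed.

(** * Power series in several variables *)

Section PowerSeries.
Context {R : realType} {d : nat}.
Local Notation C := (R[i]).
Implicit Types (a B s : C) (c q : mindex d -> C) (z gam : 'rV[C]_d) (m n : mindex d) (j : 'I_d).

Definition minc m j : mindex d := [ffun i => (m i + (i == j))%N].
Definition mdec m j : mindex d := [ffun i => (m i - (i == j))%N].

Lemma mincK j : cancel (minc^~ j) (mdec^~ j).
Proof. by move=> m; apply/ffunP => i; rewrite !ffunE addnK. Qed.

Lemma mdecK m j : (0 < m j)%N -> minc (mdec m j) j = m.
Proof.
move=> mj; apply/ffunP => i; rewrite !ffunE; case: eqP => [->|_]; last by rewrite subn0 addn0.
by rewrite subnK.
Qed.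

Lemma mabs0_eq m : mabs m = 0%N -> m = [ffun=> 0%N].
Proof.
move=> /eqP; rewrite /mabs sum_nat_eq0 => /forallP m0; apply/ffunP => i.
by rewrite ffunE; exact/eqP/m0.
Qed.

Lemma minc_gt0 m j : (0 < minc m j j)%N.
Proof. by rewrite ffunE eqxx addn1. Qed.

Lemma mabs_minc m j : mabs (minc m j) = (mabs m).+1.
Proof.
rewrite /mabs; under eq_bigr do rewrite ffunE; rewrite big_split /=.
rewrite [X in (_ + X)%N](bigD1 j) //= eqxx [X in (_ + (_ + X))%N]big1; last by move=> i /negPf ->.
by rewrite addn0 addn1.
Qed.

Lemma mpow_minc z m j : mpow z (minc m j) = z 0 j * mpow z m.
Proof.
rewrite /mpow (bigD1 j) //= [in RHS](bigD1 j) //= ffunE eqxx addn1 exprS mulrA.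
by congr (_ * _); apply: eq_bigr => i /negPf ij; rewrite ffunE ij addn0.
Qed.

Definition cshift j c m : C := if (0 < m j)%N then c (mdec m j) else 0.

Definition pterm c z m : C := c m * mpow z m.

(** Coefficients of the product of a power series with the affine form [lform
    a gam]. *)
Definition lin_coef (a : C) gam c m : C := a * c m + \sum_j gam 0 j * cshift j c m.

Definition lform (a : C) gam z : C := a + \sum_j gam 0 j * z 0 j.

Definition lmaj gam z : C := \sum_j `|gam 0 j| * `|z 0 j|.

Lemma lmaj_ge0 gam z : 0 <= lmaj gam z.
Proof. by apply: sumr_ge0 => j _; rewrite mulr_ge0. Qed.

Lemma cshift_minc j c m : cshift j c (minc m j) = c m.
Proof. by rewrite /cshift minc_gt0 mincK. Qed.

Let minc_mdec_neq j m : minc (mdec m j) j != m -> (0 < m j)%N = false.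
Proof. by apply: contraNF => /mdecK ->. Qed.

Lemma bsum_shift c z j B : bsum (pterm c z) B ->
  bsum (pterm (cshift j c) z) (`|z 0 j| * B).
Proof.
move=> h; apply: (bsum_reindex (phi := minc^~ j) (psi := mdec^~ j)) => [m /minc_mdec_neq mj|].
  by rewrite /pterm /cshift mj mul0r.
move=> A; rewrite (le_trans _ (bsumZ (z 0 j) h A)) //; apply: ler_sum => m _.
by rewrite /pterm cshift_minc mpow_minc mulrCA.
Qed.

Lemma has_sum_shift c z j s : has_sum (pterm c z) s ->
  has_sum (pterm (cshift j c) z) (z 0 j * s).
Proof.
move=> h; apply: (has_sum_reindex (mincK j)) => [m /minc_mdec_neq mj|].
  by rewrite /pterm /cshift mj mul0r.
apply: eq_has_sum (has_sumZ (z 0 j) h) => m.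
by rewrite /pterm cshift_minc mpow_minc mulrCA.
Qed.

Lemma pterm_lin a gam c z m : pterm (lin_coef a gam c) z m =
  a * pterm c z m + \sum_j gam 0 j * pterm (cshift j c) z m.
Proof.
rewrite /pterm /lin_coef mulrDl mulrA mulr_suml; congr (_ + _).
by apply: eq_bigr => j _; rewrite mulrA.
Qed.

Lemma bsum_lin a gam c z B : bsum (pterm c z) B ->
  bsum (pterm (lin_coef a gam c) z) ((`|a| + lmaj gam z) * B).
Proof.
move=> h A; under eq_bigr do rewrite pterm_lin.
rewrite mulrDl; apply: bsumD; first exact: bsumZ.
rewrite /lmaj mulr_suml; apply: (@bsum_sum _ _ _ _ (fun j m => gam 0 j * pterm (cshift j c) z m)) => j.
by rewrite -mulrA; apply: bsumZ; exact: bsum_shift.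
Qed.

Lemma has_sum_lin a gam c z s : has_sum (pterm c z) s ->
  has_sum (pterm (lin_coef a gam c) z) (lform a gam z * s).
Proof.
move=> h; rewrite mulrDl mulr_suml.
apply: (@eq_has_sum _ _ (fun m => a * pterm c z m + \sum_j gam 0 j * pterm (cshift j c) z m)).
  by move=> m; rewrite pterm_lin.
apply: has_sumD; first exact: has_sumZ.
by apply: has_sum_sum => j; rewrite -mulrA; apply: has_sumZ; exact: has_sum_shift.
Qed.

Lemma asum_lin a gam c z B s : asum (pterm c z) B s ->
  asum (pterm (lin_coef a gam c) z) ((`|a| + lmaj gam z) * B) (lform a gam z * s).
Proof. by case=> ? ?; split; [exact: bsum_lin|exact: has_sum_lin]. Qed.

Let trunc k c m : C := if (mabs m < k)%N then c m else 0.

Lemma lmaj_lform a gam z : `|a| - lmaj gam z <= `|lform a gam z|.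
Proof.
rewrite /lform lerBlDr -[X in `|X| <= _](addrK (\sum_j gam 0 j * z 0 j)).
rewrite (le_trans (ler_normB _ _)) // lerD2l (le_trans (ler_norm_sum _ _ _)) //.
by apply: ler_sum => j _; rewrite normrM.
Qed.

(** If [q] is a formal quotient of [c] by the affine form, its partial norm
    sums [S] satisfy [`|a| * S <= B + lmaj gam z * S]; the truncations of
    [q] by total degree satisfy it inductively, which dispenses with
    assuming [S] finite. *)
Lemma bsum_div a gam c q z B : lmaj gam z < `|a| -> lin_coef a gam q =1 c ->
  bsum (pterm c z) B -> bsum (pterm q z) (B / (`|a| - lmaj gam z)).
Proof.
move=> La qc cB; set B' := _ / _.
have a0 : 0 < `|a| by apply: le_lt_trans La; exact: lmaj_ge0.
have aL : 0 < `|a| - lmaj gam z by rewrite subr_gt0.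
have B'0 : 0 <= B' by rewrite divr_ge0 ?(ltW aL) // (bsum_ge0 cB).
have BE : B + lmaj gam z * B' = `|a| * B'.
  have -> : B = (`|a| - lmaj gam z) * B' by rewrite mulrC divfK // gt_eqF.
  by rewrite -mulrDl subrK.
(* [B'] solves [B + lmaj gam z * B' = `|a| * B'], so the bound by [B'] is
   preserved by one step of the recursion for [q]. *)
have tq k : bsum (pterm (trunc k q) z) B'.
  elim: k => [|k IH].
    move=> A; rewrite big1 // => m _.
    by rewrite /pterm /trunc ltn0 mul0r normr0.
  move=> A; rewrite -(ler_pM2l a0) -BE mulr_sumr.
  have h := bsumD cB (bsum_sum (index_enum 'I_d) (fun j => bsumZ (- gam 0 j) (bsum_shift j IH))).
  rewrite (_ : lmaj _ _ * _ = \sum_j `|- gam 0 j| * (`|z 0 j| * B')); last first.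
    by rewrite mulr_suml; apply: eq_bigr => j _; rewrite normrN mulrA.
  apply: le_trans (h A); apply: ler_sum => m _.
  rewrite -normrM /pterm {1}/trunc; case: ifP => [mk|_]; last by rewrite mul0r mulr0 normr0.
  rewrite -qc /lin_coef mulrDl -addrA mulrA mulr_suml -big_split /= big1 ?addr0 // => j _.
  rewrite mulNr mulrA -mulrBl (_ : cshift j (trunc k q) m = cshift j q m) ?subrr ?mul0r //.
  rewrite /cshift; case: ifP => // mj; rewrite /trunc.
  by rewrite -ltnS -(mabs_minc _ j) mdecK // mk.
move=> A; apply: le_trans (tq (\max_(m <- A) mabs m).+1 A).
rewrite [leLHS]big_seq [leRHS]big_seq; apply: ler_sum => m mA.
by rewrite /pterm /trunc ifT // ltnS; exact: (@leq_bigmax_seq _ (enum_fset A) xpredT (fun m => mabs m)).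
Qed.

(** Dividing by an affine form needs no geometric series: once the formal
    quotient is known to converge, multiplying it back gives [c], which
    determines its sum. *)
Lemma asum_div a gam c q z B s : lmaj gam z < `|a| -> lin_coef a gam q =1 c ->
  asum (pterm c z) B s ->
  asum (pterm q z) (B / (`|a| - lmaj gam z)) (s / lform a gam z).
Proof.
move=> La qc [cB cs]; have qB := bsum_div La qc cB; split; first exact: qB.
have [t qt] := bsum_has_sum qB.
have l0 : lform a gam z != 0.
  by rewrite -normr_gt0 (lt_le_trans _ (lmaj_lform _ _ _)) // subr_gt0.
have -> : s = lform a gam z * t.
  apply: (has_sum_unique cs). apply: (eq_has_sum _ (has_sum_lin (a := a) (gam := gam) qt)) => m.
  by rewrite /pterm qc.
by rewrite mulrAC (mulfV l0) mul1r.
Qed.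

Let div_step (a : C) gam c q m : C := (c m - \sum_j gam 0 j * cshift j q m) / a.

(** The formal quotient by an affine form, by recursion on the total degree:
    [mabs m] + 1 rounds of the recursion determine the coefficient of
    index [m]. *)
Definition div_coef a gam c m : C :=
  iter (mabs m).+1 (div_step a gam c) (fun=> 0) m.

Lemma lin_div_coef a gam c : a != 0 -> lin_coef a gam (div_coef a gam c) =1 c.
Proof.
move=> a0 m; rewrite /lin_coef {1}/div_coef /= {1}/div_step mulrCA mulfV // mulr1.
rewrite [X in _ - X + _](_ : _ = \sum_j gam 0 j * cshift j (div_coef a gam c) m) ?subrK //.
apply: eq_bigr => j _; congr (_ * _); rewrite /cshift; case: ifP => // mj.
by rewrite /div_coef -(mabs_minc _ j) mdecK.
Qed.

End PowerSeries.

Section Uniqueness.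
Context {R : realType} {d : nat}.
Local Notation C := (R[i]).
Implicit Types (a B s r : C) (c q : mindex d -> C) (z gam : 'rV[C]_d) (m n : mindex d) (j : 'I_d).

Lemma norm_le_scale_eq0 (x K : C) : 0 <= K ->
  (forall lam : C, 0 < lam -> lam <= 1 -> `|x| <= lam * K) -> x = 0.
Proof.
move=> K0 h; apply/eqP; rewrite -normr_le0; apply/ler_addgt0Pr => e e0.
have Ke : 0 < K + e by rewrite ltr_wpDl.
rewrite add0r (le_trans (h (e / (K + e)) _ _)) ?divr_gt0 //.
  by rewrite ler_pdivrMr // mul1r lerDr.
by rewrite mulrAC ler_pdivrMr // ler_wpM2l ?(ltW e0) // lerDl ltW.
Qed.

Lemma mpow_scale (lam : C) z m : mpow (lam *: z) m = lam ^+ mabs m * mpow z m.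
Proof.
rewrite /mpow /mabs -prodrXr -big_split; apply: eq_bigr => i _.
by rewrite mxE exprMn.
Qed.

Lemma normr_mpow z m : `|mpow z m| = \prod_i `|z 0 i| ^+ m i.
Proof. by rewrite normr_prod; apply: eq_bigr => i _; rewrite normrX. Qed.

(** The coordinate hyperplanes are left out so that one may divide by the
    coordinates when the coefficients are shifted. *)
Definition null_series r c := forall z, (forall j, z 0 j != 0 /\ `|z 0 j| <= r) ->
  has_sum (pterm c z) 0.

Lemma null_series_coef0 r c : 0 < r -> null_series r c -> c [ffun=> 0%N] = 0.
Proof.
move=> r0 cN; pose z : 'rV[C]_d := const_mx r.
have zr (lam : C) : 0 < lam -> lam <= 1 -> has_sum (pterm c (lam *: z)) 0.
  move=> l0 l1; apply: cN => j; rewrite !mxE mulf_neq0 ?gt_eqF //; split => //.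
  by rewrite gtr0_norm ?mulr_gt0 // ler_piMl // ltW.
have [B cB] := has_sum_bsum (zr 1 ltr01 (lexx _)); rewrite scale1r in cB.
apply: (norm_le_scale_eq0 (bsum_ge0 cB)) => lam l0 l1.
pose z0 : mindex d := [ffun=> 0%N].
pose c' m := if m == z0 then 0 else c m.
have h1 : has_sum (fun m => - c z0 * (m == z0)%:R) (- c z0).
  have := @has_sum_fin _ _ (fun m => - c z0 * (m == z0)%:R) [fset z0]%fset.
  rewrite big_seq_fset1 eqxx mulr1; apply => m.
  by rewrite inE => /negPf ->; rewrite mulr0.
have h2 : has_sum (pterm c' (lam *: z)) (- c z0).
  rewrite -[- c z0]add0r; apply: (eq_has_sum _ (has_sumD (zr _ l0 l1) h1)) => m.
  rewrite /pterm /c'; case: eqP => [->|_]; last by rewrite mulr0 addr0.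
  rewrite (_ : mpow _ z0 = 1) ?mulr1 ?subrr ?mul0r //.
  by rewrite /mpow big1 // => i _; rewrite ffunE.
rewrite -normrN; apply: bsum_has_sum_le h2.
have := bsumZ lam cB; rewrite gtr0_norm //; apply: bsum_le => m.
rewrite /pterm /c'; case: eqP => [_|/eqP m0]; first by rewrite mul0r normr0.
rewrite mpow_scale mulrCA !normrM ler_wpM2r ?mulr_ge0 // normrX !gtr0_norm //.
rewrite -[leRHS]expr1 ler_wiXn2l ?(ltW l0) // lt0n.
by apply: contra_neq m0 => /mabs0_eq.
Qed.

(** Split the series as [f0 z + z_j * h z], where [f0] does not depend on
    [z_j] and [h] has the shifted coefficients.  Since [h] stays bounded
    when [z_j] shrinks, letting [z_j] tend to 0 gives [f0 = 0], and then
    [h = 0]. *)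
Lemma null_series_shift r c j : 0 < r -> null_series r c ->
  null_series r (fun m => c (minc m j)).
Proof.
move=> r0 cN z zr; set c1 := fun m => _.
pose c0 m := if m j == 0%N then c m else 0.
have [B cB] := has_sum_bsum (cN z zr).
have [zj0 _] := zr j.
have c1B : bsum (pterm c1 z) (`|(z 0 j)^-1| * B).
  apply: (bsum_le _ (bsumZ (z 0 j)^-1 (bsum_comp (mincK j) cB))) => m.
  rewrite /pterm mpow_minc (_ : _^-1 * _ = c (minc m j) * mpow z m).
    by exact: lexx.
  by rewrite (mulrCA (c _)) (mulKf zj0).
have c0B : bsum (pterm c0 z) B.
  apply: (bsum_le _ cB) => m; rewrite /pterm /c0; case: ifP => // _.
  by rewrite mul0r normr0.
have [f0 hf0] := bsum_has_sum c0B.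
pose z' (lam : C) : 'rV[C]_d := \row_i (if i == j then lam * z 0 i else z 0 i).
have cE (lam : C) m : pterm c0 z m + pterm (cshift j c1) (z' lam) m = pterm c (z' lam) m.
  rewrite /pterm /c0 /cshift /c1 lt0n; case: eqP => [mj|/eqP mj] /=.
    rewrite mul0r addr0; congr (_ * _); apply: eq_bigr => i _; rewrite mxE.
    by case: eqP => // ->; rewrite mj !expr0.
  by rewrite mul0r add0r mdecK // lt0n.
(* [z' lam] shrinks the j-th coordinate by [lam] and fixes the others; the
   series with coefficients [c1] keeps the bound that it has at [z]. *)
have key (lam : C) : 0 < lam -> lam <= 1 -> exists2 h : C,
    has_sum (pterm c1 (z' lam)) h & f0 + lam * z 0 j * h = 0 /\ `|h| <= `|(z 0 j)^-1| * B.
  move=> l0 l1; have c1B' : bsum (pterm c1 (z' lam)) (`|(z 0 j)^-1| * B).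
    apply: (bsum_le _ c1B) => m; rewrite /pterm !normrM ler_wpM2l //.
    rewrite !normr_mpow; apply: ler_prod => i _; rewrite exprn_ge0 //= mxE.
    rewrite lerXn2r ?nnegrE //; case: eqP => // _.
    by rewrite normrM gtr0_norm // ler_piMl.
  have [h hh] := bsum_has_sum c1B'; exists h => //; split; last first.
    exact: bsum_has_sum_le hh.
  have hc : has_sum (pterm c (z' lam)) 0.
    apply: cN => i; rewrite mxE; have [zi0 zir] := zr i; case: (i == j); last by split.
    split; first by rewrite mulf_neq0 // lt0r_neq0.
    by rewrite normrM gtr0_norm // (le_trans _ zir) // ler_piMl.
  apply: (has_sum_unique _ hc); apply: (eq_has_sum (cE lam)).
  have := has_sum_shift (j := j) hh; rewrite mxE eqxx; exact: has_sumD hf0.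
have f00 : f0 = 0.
  apply: (@norm_le_scale_eq0 _ (`|z 0 j| * (`|(z 0 j)^-1| * B))) => [|lam l0 l1].
    by rewrite !mulr_ge0 // (bsum_ge0 cB).
  have [h _ [/eqP]] := key _ l0 l1; rewrite addr_eq0 => /eqP -> hB.
  rewrite normrN !normrM gtr0_norm // -mulrA ler_wpM2l ?(ltW l0) //.
  by rewrite ler_wpM2l.
have [h hh [/eqP hE _]] := key 1 ltr01 (lexx _).
move: hE; rewrite f00 add0r mul1r mulf_eq0 (negPf zj0) => /eqP h0.
rewrite h0 in hh; rewrite (_ : z = z' 1) //.
by apply/rowP => i; rewrite mxE mul1r if_same.
Qed.

Lemma null_series_eq0 r c : 0 < r -> null_series r c -> forall m, c m = 0.
Proof.
move=> r0 cN m; move: {2}(mabs m) (erefl (mabs m)) => k.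
elim: k c cN m => [|k IH] c cN m mk.
  by rewrite (mabs0_eq mk); exact: null_series_coef0 cN.
have [j mj] : exists j, (0 < m j)%N.
  apply/existsP; apply: contra_eqT mk => /existsPn m0.
  by rewrite /mabs big1 // => j _; have := m0 j; rewrite lt0n negbK => /eqP.
rewrite -(mdecK mj); apply: (IH (fun m => c (minc m j))).
  exact: null_series_shift.
by apply/eqP; rewrite -eqSS -(mabs_minc _ j) mdecK // mk.
Qed.

(** Iterated shifts bring every coefficient to the constant term, which
    vanishes by [null_series_coef0]. *)
Lemma coef_unique r c q (f : 'rV[C]_d -> C) : 0 < r ->
  (forall z, (forall j, `|z 0 j| <= r) -> has_sum (pterm c z) (f z)) ->
  (forall z, (forall j, `|z 0 j| <= r) -> has_sum (pterm q z) (f z)) ->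
  forall m, c m = q m.
Proof.
move=> r0 hc hq m; apply/eqP; rewrite -subr_eq0; apply/eqP.
apply: (@null_series_eq0 r (fun m => c m - q m)) => // z zr.
have {}zr j : `|z 0 j| <= r by case: (zr j).
have := has_sumD (hc z zr) (has_sumZ (-1) (hq z zr)).
rewrite mulN1r subrr; apply: eq_has_sum => k.
by rewrite /pterm mulN1r mulrBl.
Qed.

End Uniqueness.

(** * Matrix coefficients of the projective action *)

Section MatrixCoef.
Context {R : realType} {d : nat}.
Local Notation C := (R[i]).
Implicit Types (a B s r : C) (c q : mindex d -> C) (z gam : 'rV[C]_d) (m n : mindex d) (i j : 'I_d).
Implicit Types (g : 'M[C]_(1 + d)) (w : 'rV[C]_(1 + d)).

(** The basis [z^n] of the representation space, homogenized to degree [- sg]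
    in the d+1 coordinates of a row vector: acting by [w |-> w *m g] on
    these functions is the action of the group by fractional linear maps
    twisted by a power of the denominator. *)
Definition homF (sg : nat) n w : C :=
  w 0 (lshift d 0) ^- (sg + mabs n) * \prod_i w 0 (rshift 1 i) ^+ n i.

Definition affine z : 'rV[C]_(1 + d) := row_mx (const_mx 1) z.

Definition lowcol g k : 'rV[C]_d := \row_j g (rshift 1 j) k.

Lemma affine0 z : affine z 0 (lshift d 0) = 1.
Proof. by rewrite row_mxEl mxE. Qed.

Lemma affineS z i : affine z 0 (rshift 1 i) = z 0 i.
Proof. by rewrite row_mxEr. Qed.

Lemma affine_mul g z k :
  (affine z *m g) 0 k = lform (g (lshift d 0) k) (lowcol g k) z.
Proof.
rewrite mxE big_split_ord big_ord1 affine0 mul1r; congr (_ + _).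
by apply: eq_bigr => j _; rewrite affineS mxE mulrC.
Qed.

Definition delta_coef n m : C := (m == n)%:R.

Lemma asum_delta n z : asum (pterm (delta_coef n) z) `|mpow z n| (mpow z n).
Proof.
have t0 m : m \notin [fset n]%fset -> pterm (delta_coef n) z m = 0.
  by rewrite inE /pterm /delta_coef => /negPf ->; rewrite mul0r.
have tn : pterm (delta_coef n) z n = mpow z n by rewrite /pterm /delta_coef eqxx mul1r.
split; first by have := bsum_fin t0; rewrite big_seq_fset1 tn.
by have := has_sum_fin t0; rewrite big_seq_fset1 tn.
Qed.

Lemma mpow0 z : mpow z [ffun=> 0%N] = 1.
Proof. by rewrite /mpow big1 // => i _; rewrite ffunE. Qed.

Lemma asum_delta0 z : asum (pterm (delta_coef [ffun=> 0%N]) z) 1 1.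
Proof. by have := asum_delta [ffun=> 0%N] z; rewrite mpow0 normr1. Qed.

Definition num_coef g n (r : seq 'I_d) : mindex d -> C :=
  foldr (fun i => iter (n i) (lin_coef (g (lshift d 0) (rshift 1 i)) (lowcol g (rshift 1 i))))
        (delta_coef [ffun=> 0%N]) r.

(** [matcoef sg g n m] is the coefficient of [z^m] in [homF sg n (affine z *m
    g)], obtained by |n| multiplications and sg + |n| divisions by affine
    forms. *)
Definition matcoef (sg : nat) g n : mindex d -> C :=
  iter (sg + mabs n) (div_coef (g (lshift d 0) (lshift d 0)) (lowcol g (lshift d 0)))
       (num_coef g n (enum 'I_d)).

(** The majorant of [asum_matcoef]: the same fraction with every entry
    replaced by its absolute value, and with a minus sign in front of the
    entries that multiply [z] in the denominator. *)
Definition matmaj (sg : nat) g n z : C :=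
  (`|g (lshift d 0) (lshift d 0)| - lmaj (lowcol g (lshift d 0)) z) ^- (sg + mabs n)
  * \prod_i (`|g (lshift d 0) (rshift 1 i)| + lmaj (lowcol g (rshift 1 i)) z) ^+ n i.

Definition conv_dom g z := lmaj (lowcol g (lshift d 0)) z < `|g (lshift d 0) (lshift d 0)|.

Lemma asum_num g n (r : seq (ordinal d)) z : asum (pterm (num_coef g n r) z)
  (\prod_(i <- r) (`|g (lshift d 0) (rshift 1 i)| + lmaj (lowcol g (rshift 1 i)) z) ^+ n i)
  (\prod_(i <- r) ((affine z *m g) 0 (rshift 1 i)) ^+ n i).
Proof.
elim: r => [|i r IH]; first by rewrite !big_nil; exact: asum_delta0.
rewrite !big_cons /=; elim: (n i) => [|k IHk]; first by rewrite !expr0 !mul1r.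
by rewrite !exprS -!mulrA affine_mul; apply: asum_lin; rewrite -affine_mul.
Qed.

Lemma asum_matcoef sg g n z : conv_dom g z ->
  asum (pterm (matcoef sg g n) z) (matmaj sg g n z) (homF sg n (affine z *m g)).
Proof.
move=> gz; rewrite /matcoef /matmaj /homF.
have := asum_num g n (enum 'I_d) z; rewrite !big_enum /=.
set c := num_coef _ _ _; set B := \prod_i _; set v := \prod_i _ => h.
have g0 : g (lshift d 0) (lshift d 0) != 0.
  by rewrite -normr_gt0 (le_lt_trans _ gz) // lmaj_ge0.
rewrite affine_mul; elim: (sg + mabs n)%N => [|k IH].
  by rewrite !expr0 !invr1 !mul1r.
have := asum_div gz (lin_div_coef _ _ g0) IH.
by rewrite !exprSr !invfM -!mulrA [B * _]mulrC [v * _]mulrC iterS.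
Qed.

Lemma lmaj_le gam z (r : C) : (forall j, `|z 0 j| <= r) ->
  lmaj gam z <= r * \sum_j `|gam 0 j|.
Proof.
move=> zr; rewrite mulr_sumr; apply: ler_sum => j _.
by rewrite mulrC ler_wpM2r.
Qed.

(** Affine forms without constant term are small near 0; this is how all radii
    of convergence are chosen. *)
Lemma small_lmaj (x : C) (gam : 'rV[C]_d) : 0 < x -> exists2 r, 0 < r &
  forall z, (forall j, `|z 0 j| <= r) -> lmaj gam z < x.
Proof.
move=> x0; have G0 : 0 < 1 + \sum_j `|gam 0 j| by rewrite ltr_wpDr ?sumr_ge0.
exists (x / (1 + \sum_j `|gam 0 j|)); first by rewrite divr_gt0.
move=> z /lmaj_le h; rewrite (le_lt_trans (h gam)) // mulrAC ltr_pdivrMr //.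
by rewrite ltr_pM2l // ltrDr ltr01.
Qed.

Lemma conv_dom_near0 g : g (lshift d 0) (lshift d 0) != 0 -> exists2 r, 0 < r &
  forall z, (forall j, `|z 0 j| <= r) -> conv_dom g z.
Proof. by rewrite -normr_gt0 => /small_lmaj; exact. Qed.

(** The coefficients of [(1 - z_1 - ... - z_d)^(- sg)]; their inverses are the
    squared norms of the monomials in the representation space. *)
Definition nb_coef (sg : nat) m : C := poch sg%:R (mabs m) / (mfact m)%:R.

Lemma poch_rec (b : C) k : poch b k.+1 = b * poch (b + 1) k.
Proof.
rewrite /poch big_ord_recl addr0; congr (_ * _); apply: eq_bigr => i _.
by rewrite -natr1 [i%:R + 1]addrC addrA.
Qed.

Lemma poch_last (b : C) k : poch b k.+1 = poch b k * (b + k%:R).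
Proof. by rewrite /poch big_ord_recr. Qed.

Lemma mfact_minc m j : mfact (minc m j) = ((m j).+1 * mfact m)%N.
Proof.
rewrite /mfact (bigD1 j) //= [in RHS](bigD1 j) //= ffunE eqxx addn1 factS mulnA.
by congr (_ * _)%N; apply: eq_bigr => i /negPf ij; rewrite ffunE ij addn0.
Qed.

Lemma mfact_gt0 m : (0 < mfact m)%N.
Proof. by rewrite prodn_gt0 // => i; exact: fact_gt0. Qed.

Lemma mfact_neq0 m : (mfact m)%:R != 0 :> C.
Proof. by rewrite pnatr_eq0 -lt0n mfact_gt0. Qed.

(** Multiplication by [1 - z_1 - ... - z_d] lowers [sg] by one, so the
    expansion follows by repeated division, without the multinomial
    theorem. *)
Lemma nb_coef_rec sg : lin_coef 1 (const_mx (-1)) (nb_coef sg.+1) =1 nb_coef sg.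
Proof.
move=> m; rewrite /lin_coef mul1r.
have -> : \sum_j (const_mx (-1) : 'rV[C]_d) 0 j * cshift j (nb_coef sg.+1) m
   = - ((mabs m)%:R * poch sg.+1%:R (mabs m).-1 / (mfact m)%:R).
  rewrite [X in X%:R * poch _ _](_ : _ = (\sum_j m j)%N) // natr_sum !mulr_suml -sumrN; apply: eq_bigr => j _.
  rewrite mxE mulN1r; congr (- _); rewrite /cshift; case: posnP => [->|mj].
    by rewrite !mul0r.
  have [m' mE] : exists m', m = minc m' j by exists (mdec m j); rewrite mdecK.
  rewrite /nb_coef mE mincK mabs_minc mfact_minc /= ffunE eqxx addn1.
  set k := m' j; have k0 : k.+1%:R != 0 :> C by rewrite pnatr_eq0.
  rewrite natrM invfM [k.+1%:R * _]mulrC -!mulrA; congr (_ * _).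
  by rewrite mulrA (mulfV k0) mul1r.
rewrite /nb_coef; case: (mabs m) => [|k] /=.
  by rewrite !mul0r subr0 /poch !big_ord0.
have E : sg.+1%:R + k%:R - k.+1%:R = sg%:R :> C.
  by rewrite -[sg.+1%:R]natr1 -[k.+1%:R]natr1; ring.
rewrite -mulrBl; congr (_ / _); rewrite poch_last [RHS]poch_rec natr1.
by rewrite [k.+1%:R * _]mulrC -mulrBr E mulrC.
Qed.

Lemma asum_nb sg z : \sum_j `|z 0 j| < 1 ->
  asum (pterm (nb_coef sg) z) ((1 - \sum_j `|z 0 j|) ^- sg) ((1 - \sum_j z 0 j) ^- sg).
Proof.
move=> z1; elim: sg => [|sg IH].
  rewrite !expr0 !invr1; have := asum_delta0 z.
  rewrite (_ : pterm _ _ = pterm (nb_coef 0) z) //; apply/funext => m.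
  rewrite /pterm /nb_coef /delta_coef; case: eqP => [->|/eqP m0].
    by rewrite /mabs /mfact !big1 => [|i _|i _]; rewrite ?ffunE // /poch big_ord0 divr1.
  case E : (mabs m) => [|k]; first by rewrite (mabs0_eq E) eqxx in m0.
  by rewrite poch_rec !mul0r.
have LE : lmaj (const_mx (-1)) z = \sum_j `|z 0 j|.
  by apply: eq_bigr => j _; rewrite mxE normrN1 mul1r.
have lE : lform 1 (const_mx (-1)) z = 1 - \sum_j z 0 j.
  rewrite /lform -sumrN; congr (_ + _); apply: eq_bigr => j _.
  by rewrite mxE mulN1r.
have L1 : lmaj (const_mx (-1)) z < `|1 : C| by rewrite LE normr1.
have := asum_div L1 (nb_coef_rec sg) IH.
by rewrite LE lE normr1 !exprSr !invfM.
Qed.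

End MatrixCoef.

(** * Composition of matrix coefficients *)

Section Representation.
Context {R : realType} {d : nat}.
Local Notation C := (R[i]).
Implicit Types (a B s r : C) (c q : mindex d -> C) (z u v gam : 'rV[C]_d) (m n k : mindex d) (i j : 'I_d).
Implicit Types (g : 'M[C]_(1 + d)) (w : 'rV[C]_(1 + d)) (sg : nat).

Lemma lower_bound2 (x y : C) : 0 < x -> 0 < y -> exists2 r, 0 < r & r <= x /\ r <= y.
Proof.
move=> x0 y0; have : x >=< y by apply: real_comparable; exact: gtr0_real.
by case/comparable_leP => [xy|/ltW yx]; [exists x|exists y].
Qed.

(** A sum of power series may be computed coefficientwise under an absolute
    bound.  The bound at a point with nonzero coordinates makes the sums
    of coefficients converge, Fubini identifies the resulting power
    series, and uniqueness of coefficients concludes. *)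
Lemma exchange_coef (K : choiceType) (a : K -> mindex d -> C)
    (f : K -> 'rV[C]_d -> C) (F : 'rV[C]_d -> C) q r : 0 < r ->
  (forall z, (forall j, `|z 0 j| <= r) -> exists b B,
    [/\ forall k : K, asum (pterm (a k) z) (b k) (f k z), bsum b B & has_sum (f^~ z) (F z)]) ->
  (forall z, (forall j, `|z 0 j| <= r) -> has_sum (pterm q z) (F z)) ->
  forall m, has_sum (fun k : K => a k m) (q m).
Proof.
move=> r0 ha hq.
have /choice[S hS] m : exists S, has_sum (fun k : K => a k m) S.
  have [|b [B [hb bB _]]] := ha (const_mx r).
    by move=> j; rewrite mxE gtr0_norm.
  have z0 : mpow (const_mx r : 'rV[C]_d) m != 0.
    by apply/prodf_neq0 => i _; rewrite mxE expf_neq0 // gt_eqF.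
  apply: (@bsum_has_sum _ _ _ (`|(mpow (const_mx r : 'rV[C]_d) m)^-1| * B)) => A.
  have := bsum_swap [fset m]%fset (fun k : K => (hb k).1) bB A.
  under eq_bigr do rewrite big_seq_fset1.
  move=> h; rewrite (le_trans _ (ler_wpM2l _ h)) // mulr_sumr ler_sum // => k _.
  by rewrite -normrM /pterm mulrCA (mulVf z0) mulr1.
suff -> : q = S by [].
apply/funext; apply: (coef_unique r0 hq) => z /ha [b [B [hb bB hF]]].
apply: (has_sum_fubini (fun k : K => (hb k).1) bB (fun k : K => (hb k).2) _ hF) => m.
by rewrite /pterm mulrC; apply: (eq_has_sum _ (has_sumZ _ (hS m))) => k; exact: mulrC.
Qed.

Definition projv w : 'rV[C]_d := \row_i (w 0 (rshift 1 i) / w 0 (lshift d 0)).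

Lemma homF_proj sg n w : w 0 (lshift d 0) != 0 ->
  homF sg n w = w 0 (lshift d 0) ^- sg * mpow (projv w) n.
Proof.
move=> w0; rewrite /homF exprD invfM -mulrA; congr (_ * _).
rewrite /mpow /mabs -prodrXr -prodfV -big_split; apply: eq_bigr => i _.
by rewrite mxE expr_div_n mulrC.
Qed.

Lemma affine_proj w : w 0 (lshift d 0) != 0 -> w 0 (lshift d 0) *: affine (projv w) = w.
Proof.
move=> w0; apply/rowP => k; rewrite mxE; case: (split_ordP k) => l ->.
  by rewrite ord1 affine0 mulr1.
by rewrite affineS mxE mulrC divfK.
Qed.

Lemma homF_scale sg n a w : a != 0 -> homF sg n (a *: w) = a ^- sg * homF sg n w.
Proof.
move=> a0; have an0 : a ^+ mabs n != 0 by rewrite expf_neq0.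
have -> : homF sg n (a *: w) =
    (a ^+ (sg + mabs n) * w 0 (lshift d 0) ^+ (sg + mabs n))^-1 *
    (a ^+ mabs n * \prod_i w 0 (rshift 1 i) ^+ n i).
  rewrite /homF mxE exprMn; congr (_ * _).
  by rewrite /mabs -prodrXr -big_split; apply: eq_bigr => i _; rewrite mxE exprMn.
rewrite /homF [a ^+ (sg + _)]exprD !invfM -!mulrA; congr (_ * _).
by rewrite (mulrCA _ (a ^+ _)) (mulKf an0).
Qed.

(** Its entries majorize those of [affine z *m g], from below for the
    denominator and from above for the numerators, so that [matmaj] is the
    value of [homF] at this vector. *)
Definition majv g z : 'rV[C]_(1 + d) := row_mx
  (const_mx (`|g (lshift d 0) (lshift d 0)| - lmaj (lowcol g (lshift d 0)) z))
  (\row_i (`|g (lshift d 0) (rshift 1 i)| + lmaj (lowcol g (rshift 1 i)) z)).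

Lemma majv0 g z : majv g z 0 (lshift d 0) =
  `|g (lshift d 0) (lshift d 0)| - lmaj (lowcol g (lshift d 0)) z.
Proof. by rewrite row_mxEl mxE. Qed.

Lemma majvS g z i : majv g z 0 (rshift 1 i) =
  `|g (lshift d 0) (rshift 1 i)| + lmaj (lowcol g (rshift 1 i)) z.
Proof. by rewrite row_mxEr mxE. Qed.

Lemma matmajE sg g n z : matmaj sg g n z = homF sg n (majv g z).
Proof. by rewrite /matmaj /homF majv0; under [in RHS]eq_bigr do rewrite majvS. Qed.

Lemma majv0_gt0 g z : conv_dom g z -> 0 < majv g z 0 (lshift d 0).
Proof. by rewrite majv0 subr_gt0. Qed.

Lemma majv0_le g z : majv g z 0 (lshift d 0) <= `|(affine z *m g) 0 (lshift d 0)|.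
Proof. by rewrite majv0 affine_mul lmaj_lform. Qed.

Lemma majvS_ge g z i : `|(affine z *m g) 0 (rshift 1 i)| <= majv g z 0 (rshift 1 i).
Proof.
rewrite majvS affine_mul (le_trans (ler_normD _ _)) // lerD2l.
by rewrite (le_trans (ler_norm_sum _ _ _)) // ler_sum // => j _; rewrite normrM.
Qed.

Lemma majvS_ge0 g z i : 0 <= majv g z 0 (rshift 1 i).
Proof. exact: le_trans (majvS_ge g z i). Qed.

Lemma affine_mul0_neq0 g z : conv_dom g z -> (affine z *m g) 0 (lshift d 0) != 0.
Proof. by move=> /majv0_gt0 h; rewrite -normr_gt0 (lt_le_trans h) // majv0_le. Qed.

Lemma projv_le g z i : conv_dom g z ->
  `|projv (affine z *m g) 0 i| <= projv (majv g z) 0 i.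
Proof.
move=> gz; have m0 := majv0_gt0 gz; rewrite [projv (_ *m _) _ _]mxE [projv (majv _ _) _ _]mxE normrM normfV.
apply: ler_pM; rewrite ?invr_ge0 ?majvS_ge //.
by rewrite lef_pV2 ?posrE ?majv0_le // normr_gt0 affine_mul0_neq0.
Qed.

Lemma projv_majv_ge0 g z i : conv_dom g z -> 0 <= projv (majv g z) 0 i.
Proof. by move=> gz; exact: le_trans (projv_le i gz). Qed.

(** Expanding [homF n] at the point [affine z *m g1] in powers of its affine
    coordinates expresses [homF n (affine z *m (g1 *m g2))] through the
    functions [homF k (affine z *m g1)].  The hypothesis says that at [z =
    0] this expansion takes place in the domain of absolute convergence of
    the majorants; it stays so for small [z]. *)
Lemma matcoef_mul sg g1 g2 n m : g1 (lshift d 0) (lshift d 0) != 0 ->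
  \sum_i `|g2 (rshift 1 i) (lshift d 0)| * `|g1 (lshift d 0) (rshift 1 i)|
    < `|g2 (lshift d 0) (lshift d 0)| * `|g1 (lshift d 0) (lshift d 0)| ->
  has_sum (fun k => matcoef sg g2 n k * matcoef sg g1 k m) (matcoef sg (g1 *m g2) n m).
Proof.
move=> g10 gap.
have g120 : (g1 *m g2) (lshift d 0) (lshift d 0) != 0.
  rewrite mxE big_split_ord big_ord1 -normr_gt0.
  rewrite (lt_le_trans _ (lerB_normD _ _)) // subr_gt0 normrM mulrC.
  rewrite (le_lt_trans _ gap) // (le_trans (ler_norm_sum _ _ _)) // ler_sum // => i _.
  by rewrite normrM mulrC.
(* The deviation from the strict inequality [gap] at [z = 0] is the affine form
   [lmaj Gam z], which is small near 0. *)
pose Gam : 'rV[C]_d := \row_j (\sum_i `|g2 (rshift 1 i) (lshift d 0)| * `|lowcol g1 (rshift 1 i) 0 j|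
   + `|g2 (lshift d 0) (lshift d 0)| * `|lowcol g1 (lshift d 0) 0 j|).
have [r1 r10 h1] := conv_dom_near0 g10.
have [r2 r20 h2] := conv_dom_near0 g120.
have := gap; rewrite -subr_gt0 => /(small_lmaj Gam) [r3 r30 h3].
have [r12 r120 [r121 r122]] := lower_bound2 r10 r20.
have [r r0 [rr12 rr3]] := lower_bound2 r120 r30.
refine (@exchange_coef _ (fun k m => matcoef sg g2 n k * matcoef sg g1 k m)
  (fun k z => matcoef sg g2 n k * homF sg k (affine z *m g1))
  (fun z => homF sg n (affine z *m (g1 *m g2))) _ _ r0 _ _ m) => z zr; last first.
  case: (@asum_matcoef _ _ sg (g1 *m g2) n z _) => // ; apply: h2 => j.
  by rewrite (le_trans (zr j)) // (le_trans rr12).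
have d1 : conv_dom g1 z by apply: h1 => j; rewrite (le_trans (zr j)) // (le_trans rr12).
have m0 := majv0_gt0 d1.
have zlin i : projv (majv g1 z) 0 i = majv g1 z 0 (rshift 1 i) / majv g1 z 0 (lshift d 0).
  by rewrite mxE.
have d2 : conv_dom g2 (projv (majv g1 z)).
  rewrite /conv_dom /lmaj.
  under eq_bigr => j _ do rewrite [X in _ * X]ger0_norm ?projv_majv_ge0 // zlin mulrA [lowcol _ _ _ _]mxE.
  rewrite -mulr_suml ltr_pdivrMr // majv0 mulrBr.
  under eq_bigr => j _ do rewrite majvS mulrDr.
  rewrite big_split /= -ltrBrDl addrAC ltrBrDr.
  have := h3 z _; rewrite (_ : lmaj Gam z = \sum_j `|g2 (rshift 1 j) (lshift d 0)| * lmaj (lowcol g1 (rshift 1 j)) z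
      + `|g2 (lshift d 0) (lshift d 0)| * lmaj (lowcol g1 (lshift d 0)) z).
    by apply => j; rewrite (le_trans (zr j)).
  rewrite /lmaj mulr_sumr; under [in RHS]eq_bigr do rewrite mulr_sumr.
  rewrite exchange_big -big_split; apply: eq_bigr => j _; rewrite [Gam _ _]mxE ger0_norm; last first.
    by rewrite addr_ge0 ?mulr_ge0 ?sumr_ge0 // => i _; rewrite mulr_ge0.
  rewrite mulrDl mulr_suml mulrA; congr (_ + _); apply: eq_bigr => i _.
  by rewrite mulrA.
have d2' : conv_dom g2 (projv (affine z *m g1)).
  apply: le_lt_trans d2; apply: ler_sum => i _; rewrite ler_wpM2l //.
  by rewrite [leRHS]ger0_norm ?projv_le ?projv_majv_ge0.
have a0 := affine_mul0_neq0 d1.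
have [b2 s2] := asum_matcoef sg n d2'.
have [b2' _] := asum_matcoef sg n d2.
exists (fun k => `|matcoef sg g2 n k| * matmaj sg g1 k z).
exists (`|majv g1 z 0 (lshift d 0) ^- sg| * matmaj sg g2 n (projv (majv g1 z))); split.
- move=> k; have := asumZ (matcoef sg g2 n k) (asum_matcoef sg k d1).
  case=> bb ss; split.
    by apply: bsum_le bb => l; rewrite /pterm mulrA.
  by apply: eq_has_sum ss => l; rewrite /pterm mulrA.
- apply: bsum_le (bsumZ (majv g1 z 0 (lshift d 0) ^- sg) b2') => k.
  rewrite matmajE homF_proj ?gt_eqF // /pterm !normrM normr_id [leLHS]mulrCA.
  exact: lexx.
- have -> : affine z *m (g1 *m g2) = (affine z *m g1) 0 (lshift d 0) *:
      (affine (projv (affine z *m g1)) *m g2).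
    by rewrite mulmxA -{1}(affine_proj a0) -scalemxAl.
  rewrite (homF_scale _ _ _ a0).
  apply: (eq_has_sum _ (has_sumZ _ s2)) => k.
  by rewrite homF_proj // /pterm mulrCA.
Qed.

End Representation.

(** * Transposition *)

Section Duality.
Context {R : realType} {d : nat}.
Local Notation C := (R[i]).
Implicit Types (a B s r : C) (z u v gam : 'rV[C]_d) (m n k : mindex d) (i j : 'I_d).
Implicit Types (g : 'M[C]_(1 + d)) (w : 'rV[C]_(1 + d)) (sg : nat).

(** The bilinear version of the hermitian form preserved by the group; [pairJ
    w w' ^- sg] is the bilinear version of the reproducing kernel of the
    representation space. *)
Definition pairJ w w' : C :=
  w 0 (lshift d 0) * w' 0 (lshift d 0) - \sum_i w 0 (rshift 1 i) * w' 0 (rshift 1 i).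

Lemma mxJ0k (k : 'I_(1 + d)) : (mxJ : 'M[C]_(1 + d)) (lshift d 0) k = (lshift d 0 == k)%:R.
Proof.
case: (split_ordP k) => l ->; first by rewrite ord1 block_mxEul mxE !eqxx.
by rewrite block_mxEur mxE eq_lrshift.
Qed.

Lemma mxJSk i (k : 'I_(1 + d)) : (mxJ : 'M[C]_(1 + d)) (rshift 1 i) k = - (rshift 1 i == k)%:R.
Proof.
case: (split_ordP k) => l ->; first by rewrite block_mxEdl mxE eq_rlshift oppr0.
by rewrite block_mxEdr !mxE (inj_eq (@rshift_inj _ _)).
Qed.

Lemma mulmxJ0 p (A : 'M[C]_(p, 1 + d)) (e : 'I_p) :
  (A *m mxJ) e (lshift d 0) = A e (lshift d 0).
Proof.
rewrite mxE big_split_ord big_ord1 /= mxJ0k eqxx mulr1 big1 ?addr0 // => i _.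
by rewrite mxJSk eq_rlshift oppr0 mulr0.
Qed.

Lemma mulmxJS p (A : 'M[C]_(p, 1 + d)) (e : 'I_p) i :
  (A *m mxJ) e (rshift 1 i) = - A e (rshift 1 i).
Proof.
rewrite mxE big_split_ord big_ord1 /= mxJ0k eq_lrshift mulr0 add0r (bigD1 i) //=.
rewrite mxJSk eqxx mulrN1 big1 ?addr0 // => j ji.
by rewrite mxJSk (inj_eq (@rshift_inj _ _)) (negPf ji) oppr0 mulr0.
Qed.

Lemma pairJE w w' : pairJ w w' = (w *m mxJ *m w'^T) 0 0.
Proof.
rewrite mxE big_split_ord big_ord1 /= mulmxJ0 mxE; congr (_ + _).
by rewrite -sumrN; apply: eq_bigr => i _; rewrite mulmxJS mxE mulNr.
Qed.

Lemma tr_mxJ : (mxJ : 'M[C]_(1 + d))^T = mxJ.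
Proof. by rewrite tr_block_mx !linear0 linearN /= !tr_scalar_mx. Qed.

Lemma mxJK : (mxJ : 'M[C]_(1 + d)) *m mxJ = 1%:M.
Proof.
rewrite mulmx_block !mulmx0 !mul0mx mulmx1 mulmxN mulNmx mulmx1 opprK !addr0 add0r.
by rewrite -scalar_mx_block.
Qed.

(** The adjoint of [g] for [pairJ], see [pairJ_dual]. *)
Definition dualmx g : 'M[C]_(1 + d) := mxJ *m g^T *m mxJ.

Lemma pairJ_dual g w w' : pairJ (w *m g) w' = pairJ (w' *m dualmx g) w.
Proof.
rewrite !pairJE /dualmx !mulmxA -[_ *m mxJ *m mxJ]mulmxA mxJK mulmx1.
transitivity ((w *m g *m mxJ *m w'^T)^T 0 0); first by rewrite [RHS]mxE.
by rewrite !trmx_mul trmxK tr_mxJ !mulmxA.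
Qed.

Lemma mxJ_mul0 p (A : 'M[C]_(1 + d, p)) (e : 'I_p) : (mxJ *m A) (lshift d 0) e = A (lshift d 0) e.
Proof. by rewrite -[mxJ *m A]trmxK trmx_mul tr_mxJ mxE mulmxJ0 mxE. Qed.

Lemma mxJ_mulS p (A : 'M[C]_(1 + d, p)) (e : 'I_p) i :
  (mxJ *m A) (rshift 1 i) e = - A (rshift 1 i) e.
Proof. by rewrite -[mxJ *m A]trmxK trmx_mul tr_mxJ mxE mulmxJS mxE. Qed.

Lemma dualmx00 g : dualmx g (lshift d 0) (lshift d 0) = g (lshift d 0) (lshift d 0).
Proof. by rewrite mulmxJ0 mxJ_mul0 mxE. Qed.

Lemma dualmx0S g i : dualmx g (lshift d 0) (rshift 1 i) = - g (rshift 1 i) (lshift d 0).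
Proof. by rewrite mulmxJS mxJ_mul0 mxE. Qed.

Lemma dualmxS0 g i : dualmx g (rshift 1 i) (lshift d 0) = - g (lshift d 0) (rshift 1 i).
Proof. by rewrite mulmxJ0 mxJ_mulS mxE. Qed.

Lemma dualmxSS g i j : dualmx g (rshift 1 i) (rshift 1 j) = g (rshift 1 j) (rshift 1 i).
Proof. by rewrite mulmxJS mxJ_mulS mxE opprK. Qed.

Lemma mpow_mul z u n : mpow (\row_i (z 0 i * u 0 i)) n = mpow z n * mpow u n.
Proof. by rewrite /mpow -big_split; apply: eq_bigr => i _; rewrite mxE exprMn. Qed.

(** Expansion of the reproducing kernel along the basis [homF]. *)
Lemma asum_kernel sg w u : w 0 (lshift d 0) != 0 ->
  \sum_i `|w 0 (rshift 1 i)| * `|u 0 i| < `|w 0 (lshift d 0)| -> exists B,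
  asum (fun n => nb_coef sg n * homF sg n w * mpow u n) B (pairJ w (affine u) ^- sg).
Proof.
move=> w0 wu; pose x := \row_i (projv w 0 i * u 0 i).
have xw i : x 0 i = w 0 (rshift 1 i) * u 0 i / w 0 (lshift d 0).
  by rewrite !mxE mulrAC.
have x1 : \sum_j `|x 0 j| < 1.
  under eq_bigr do rewrite xw normf_div normrM.
  by rewrite -mulr_suml ltr_pdivrMr ?normr_gt0 // mul1r.
have [hb hs] := asumZ (w 0 (lshift d 0) ^- sg) (asum_nb sg x1).
have E : (fun n => w 0 (lshift d 0) ^- sg * pterm (nb_coef sg) x n)
       = (fun n => nb_coef sg n * homF sg n w * mpow u n).
  by apply/funext => n; rewrite homF_proj // /pterm mpow_mul mulrCA !mulrA.
rewrite E in hb hs; eexists; split; first exact: hb.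
suff <- : w 0 (lshift d 0) ^- sg * (1 - \sum_j x 0 j) ^- sg = pairJ w (affine u) ^- sg.
  exact: hs.
rewrite -invfM -exprMn mulrBr mulr1 /pairJ affine0 mulr1.
congr ((_ - _) ^- _); rewrite mulr_sumr; apply: eq_bigr => i _.
by rewrite xw affineS mulrC divfK.
Qed.

Lemma small_pairing g : g (lshift d 0) (lshift d 0) != 0 -> exists2 r, 0 < r &
  forall z u, (forall j, `|z 0 j| <= r) -> (forall j, `|u 0 j| <= r) ->
    conv_dom g z /\
    \sum_i majv g z 0 (rshift 1 i) * `|u 0 i| < majv g z 0 (lshift d 0).
Proof.
rewrite -normr_gt0; set x := `|_| => x0; have x2 : 0 < x / 2 by rewrite divr_gt0.
have [r1 r10 h1] := small_lmaj (lowcol g (lshift d 0)) x2.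
(* [M] bounds the numerators of [majv g z] for all [z] in the polydisc of
   radius [r1]. *)
pose M : 'rV[C]_d := \row_i (`|g (lshift d 0) (rshift 1 i)|
  + r1 * \sum_j `|lowcol g (rshift 1 i) 0 j|).
have [r2 r20 h2] := small_lmaj M x2.
have [r r0 [rr1 rr2]] := lower_bound2 r10 r20.
exists r => // z u zr ur.
have z1 j : `|z 0 j| <= r1 by exact: le_trans rr1.
have u2 j : `|u 0 j| <= r2 by exact: le_trans rr2.
have hz := h1 _ z1; split.
  by apply: lt_trans hz _; rewrite -/x [x in ltRHS]splitr ltrDl.
apply: (@lt_trans _ _ (x / 2)); last first.
  by rewrite majv0 -/x ltrBrDr [ltRHS]splitr ltrD2l.
apply: le_lt_trans (h2 _ u2); apply: ler_sum => i _; rewrite ler_wpM2r //.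
rewrite majvS [M _ _]mxE [leRHS]ger0_norm ?addr_ge0 ?mulr_ge0 ?sumr_ge0 ?(ltW r10) //.
by rewrite lerD2l lmaj_le.
Qed.

(** Moving [g] across the pairing in [pairJ (affine z *m g) (affine u) ^- sg]
    gives two expansions of one function of [z] and [u]; the identity
    compares the coefficients of [z^m u^n].  This is the duality of the
    Meixner polynomials and also the adjunction relation behind their
    orthogonality. *)
Lemma matcoef_dual sg g n m : g (lshift d 0) (lshift d 0) != 0 ->
  nb_coef sg n * matcoef sg g n m = nb_coef sg m * matcoef sg (dualmx g) m n.
Proof.
move=> g0; have g0' : dualmx g (lshift d 0) (lshift d 0) != 0 by rewrite dualmx00.
have [r1 r10 h1] := small_pairing g0.
have [r2 r20 h2] := small_pairing g0'.
have [r r0 [rr1 rr2]] := lower_bound2 r10 r20.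
have le1 z : (forall j, `|z 0 j| <= r) -> forall j, `|z 0 j| <= r1.
  by move=> h j; exact: le_trans rr1.
have le2 z : (forall j, `|z 0 j| <= r) -> forall j, `|z 0 j| <= r2.
  by move=> h j; exact: le_trans rr2.
have pairing g' z u : conv_dom g' z ->
    \sum_i majv g' z 0 (rshift 1 i) * `|u 0 i| < majv g' z 0 (lshift d 0) ->
    \sum_i `|(affine z *m g') 0 (rshift 1 i)| * `|u 0 i| < `|(affine z *m g') 0 (lshift d 0)|.
  move=> dz hz; apply: lt_le_trans (majv0_le g' z); apply: le_lt_trans hz.
  by apply: ler_sum => i _; rewrite ler_wpM2r // majvS_ge.
have step u : (forall j, `|u 0 j| <= r) ->
    has_sum (pterm (fun n => nb_coef sg n * matcoef sg g n m) u)
            (nb_coef sg m * homF sg m (affine u *m dualmx g)).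
  move=> ur.
  have := @exchange_coef R d _ (fun n m => nb_coef sg n * mpow u n * matcoef sg g n m)
    (fun n z => nb_coef sg n * mpow u n * homF sg n (affine z *m g))
    (fun z => pairJ (affine z *m g) (affine u) ^- sg)
    (fun m => nb_coef sg m * homF sg m (affine u *m dualmx g)) _ r0 _ _ m.
  move=> h; apply: (eq_has_sum _ (h _ _)) => [k|z zr|z zr] {h}.
  - by rewrite /pterm mulrAC.
  - have [dz hz] := h1 _ _ (le1 _ zr) (le1 _ ur).
    have m0 := majv0_gt0 dz.
    have [|B [hB _]] := @asum_kernel sg (majv g z) (\row_i `|u 0 i|) (lt0r_neq0 m0).
      rewrite gtr0_norm //; under eq_bigr => i _ do rewrite [(\row_l `|u 0 l|) _ _]mxE normr_id ger0_norm ?majvS_ge0 //.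
      exact: hz.
    have [B' [_ hs]] := @asum_kernel sg _ u (affine_mul0_neq0 dz) (pairing _ _ _ dz hz).
    exists (fun n => `|nb_coef sg n * mpow u n| * matmaj sg g n z), B; split.
    + move=> k; case: (asumZ (nb_coef sg k * mpow u k) (asum_matcoef sg k dz)) => bb ss.
      split; first by apply: bsum_le bb => l; rewrite /pterm mulrA.
      by apply: eq_has_sum ss => l; rewrite /pterm mulrA.
    + apply: bsum_le hB => k; rewrite matmajE !normrM !normr_id.
      rewrite mulrAC ler_wpM2l ?mulr_ge0 // !normr_mpow.
      by apply: ler_prod => i _; rewrite mxE normr_id lexx exprn_ge0.
    + by apply: (eq_has_sum _ hs) => k; rewrite mulrAC.
  - have [du hu] := h2 _ _ (le2 _ ur) (le2 _ zr).
    have [B [_ hs]] := @asum_kernel sg _ z (affine_mul0_neq0 du) (pairing _ _ _ du hu).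
    by rewrite pairJ_dual; exact: hs.
move: n; apply: (coef_unique r0 step) => u ur.
have [du _] := h2 _ _ (le2 _ ur) (le2 _ ur).
have [_ hs] := asumZ (nb_coef sg m) (asum_matcoef sg m du).
by apply: (eq_has_sum _ hs) => k; rewrite /pterm mulrA.
Qed.

Lemma matcoef_conj sg g n m : g (lshift d 0) (lshift d 0) != 0 ->
  matcoef sg (map_mx Num.conj g) n m = (matcoef sg g n m)^*.
Proof.
move=> g0; have g0' : (map_mx Num.conj g) (lshift d 0) (lshift d 0) != 0.
  by rewrite mxE conjC_eq0.
have [r1 r10 h1] := conv_dom_near0 g0.
have [r2 r20 h2] := conv_dom_near0 g0'.
have [r r0 [rr1 rr2]] := lower_bound2 r10 r20.
move: m; apply: (coef_unique r0 (f := fun z => homF sg n (affine z *m map_mx Num.conj g))) => z zr.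
  have dz : conv_dom (map_mx Num.conj g) z by apply: h2 => j; exact: le_trans rr2.
  by case: (asum_matcoef sg n dz).
have dz : conv_dom g (vconj z).
  by apply: h1 => j; rewrite mxE norm_conjC; exact: le_trans rr1.
case: (asum_matcoef sg n dz) => _ /has_sum_conj hs.
have -> : homF sg n (affine z *m map_mx Num.conj g) = (homF sg n (affine (vconj z) *m g))^*.
  have aE (k : 'I_(1 + d)) : (affine z *m map_mx Num.conj g) 0 k = ((affine (vconj z) *m g) 0 k)^*.
    rewrite !affine_mul /lform rmorphD rmorph_sum mxE; congr (_ + _).
    by apply: eq_bigr => j _; rewrite rmorphM !mxE /= conjCK.
  rewrite /homF rmorphM fmorphV rmorphXn rmorph_prod /= aE; congr (_ * _).
  by apply: eq_bigr => i _; rewrite rmorphXn /= aE.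
apply: (eq_has_sum _ hs) => k; rewrite /pterm rmorphM; congr (_ * _).
by rewrite /mpow rmorph_prod; apply: eq_bigr => i _; rewrite rmorphXn mxE /= conjCK.
Qed.

Lemma matcoef1 sg n m : matcoef sg (1%:M : 'M[C]_(1 + d)) n m = (m == n)%:R.
Proof.
have g0 : (1%:M : 'M[C]_(1 + d)) (lshift d 0) (lshift d 0) != 0 by rewrite mxE eqxx oner_neq0.
have [r r0 h1] := conv_dom_near0 g0.
move: m; apply: (coef_unique r0 (f := fun z => homF sg n (affine z *m 1%:M))) => z zr.
  by case: (asum_matcoef sg n (h1 z zr)).
rewrite mulmx1 /homF affine0 expr1n invr1 mul1r; under eq_bigr do rewrite affineS.
by case: (asum_delta n z).
Qed.

End Duality.

(** * Meixner polynomials as matrix coefficients *)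

Section IntegerPowers.
Context {R : realType}.
Local Notation C := (R[i]).

Lemma cexpD (x y : C) : cexp (x + y) = cexp x * cexp y.
Proof.
case: x y => [a b] [a' b']; rewrite /cexp /= expRD cosD sinD.
by apply/eqP; rewrite eq_complex /=; apply/andP; split; apply/eqP; ring.
Qed.

Lemma cexp0 : cexp (0 : C) = 1.
Proof. by rewrite /cexp /= expR0 cos0 sin0 mulr1 mulr0. Qed.

Lemma cexpMn (n : nat) (w : C) : cexp (n%:R * w) = cexp w ^+ n.
Proof.
elim: n => [|n IH]; first by rewrite mul0r cexp0 expr0.
by rewrite -natr1 mulrDl mul1r cexpD IH exprSr.
Qed.

Lemma cexpN (w : C) : cexp (- w) = (cexp w)^-1.
Proof.
have h : cexp w * cexp (- w) = 1 by rewrite -cexpD subrr cexp0.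
have w0 : cexp w != 0 by apply: contra_eq_neq h => ->; rewrite mul0r eq_sym oner_neq0.
by apply: (mulfI w0); rewrite h (mulfV w0).
Qed.

(** The principal argument is given by [acos], so this reduces to [cos (acos
    x) = x] and to the formula for [sin (acos x)]. *)
Lemma cexp_ln (z : C) : z != 0 -> cexp (cln z) = z.
Proof.
move=> z0; rewrite /cexp /cln /carg /=.
set r := complex.Re `|z|.
have rE : r%:C%C = `|z| by apply: RRe_real; exact: normr_real.
have r0 : 0 < r by rewrite -ltcR rE normr_gt0.
have r2 : complex.Re z ^+ 2 + complex.Im z ^+ 2 = r ^+ 2.
  by apply: complexI; rewrite add_Re2_Im2 rmorphXn /= rE.
rewrite (lnK _) ?posrE //.
have u1 : -1 <= complex.Re z / r <= 1.
  rewrite -ler_norml normrM normfV (gtr0_norm r0) ler_pdivrMr // mul1r.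
  by rewrite -lecR rE Re_norm_le.
have u2 : complex.Re z / r \in `[-1, 1] by rewrite in_itv.
have s : r * Num.sqrt (1 - (complex.Re z / r) ^+ 2) = `|complex.Im z|.
  have r0' := gt_eqF r0.
  rewrite -{1}(gtr0_norm r0) -sqrtr_sqr -sqrtrM ?sqr_ge0 // -sqrtr_sqr.
  congr Num.sqrt; rewrite mulrBr mulr1 -exprMn mulrCA mulfV ?r0' // mulr1.
  by rewrite -r2 addrAC subrr add0r.
case: ifPn => [y0|].
  rewrite (acosK u2) sin_acos // s ger0_norm // mulrCA mulfV ?gt_eqF // mulr1.
  by case: (z).
rewrite -ltNge => y0; rewrite cosN sinN (acosK u2) sin_acos // mulrN s ltr0_norm // opprK.
rewrite mulrCA mulfV ?gt_eqF // mulr1.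
by case: (z).
Qed.

Lemma cpow_nat (z : C) n : z != 0 -> cpow z n%:R = z ^+ n.
Proof. by move=> z0; rewrite /cpow cexpMn (cexp_ln z0). Qed.

Lemma cpow_natN (z : C) n : z != 0 -> cpow z (- n%:R) = z ^- n.
Proof. by move=> z0; rewrite /cpow mulNr cexpN cexpMn (cexp_ln z0). Qed.

End IntegerPowers.

Section MeixnerCoef.
Context {R : realType} {d : nat}.
Local Notation C := (R[i]).
Implicit Types (r : C) (z t : 'rV[C]_d) (m n : mindex d) (i j : 'I_d).
Implicit Types (g : 'M[C]_(1 + d)) (U : 'M[C]_d) (sg : nat).

(** The matrix for which [homF n (affine t *m meixner_mx U)] is the generating
    function of the Meixner polynomials; it need not be pseudo-unitary. *)
Definition meixner_mx U : 'M[C]_(1 + d) :=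
  block_mx 1%:M (const_mx 1) (const_mx (-1)) (- U^T).

Lemma meixner_mx00 U : meixner_mx U (lshift d 0) (lshift d 0) = 1.
Proof. by rewrite block_mxEul mxE eqxx. Qed.

Lemma meixner_mx0S U i : meixner_mx U (lshift d 0) (rshift 1 i) = 1.
Proof. by rewrite block_mxEur mxE. Qed.

Lemma meixner_mxS0 U i : meixner_mx U (rshift 1 i) (lshift d 0) = -1.
Proof. by rewrite block_mxEdl mxE. Qed.

Lemma meixner_mxSS U i j : meixner_mx U (rshift 1 j) (rshift 1 i) = - U i j.
Proof. by rewrite block_mxEdr !mxE. Qed.

Lemma affine_meixner0 U t : (affine t *m meixner_mx U) 0 (lshift d 0) = 1 - \sum_j t 0 j.
Proof.
rewrite affine_mul meixner_mx00 /lform -sumrN; congr (_ + _).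
by apply: eq_bigr => j _; rewrite mxE meixner_mxS0 mulN1r.
Qed.

Lemma affine_meixnerS U t i :
  (affine t *m meixner_mx U) 0 (rshift 1 i) = 1 - \sum_j U i j * t 0 j.
Proof.
rewrite affine_mul meixner_mx0S /lform -sumrN; congr (_ + _).
by apply: eq_bigr => j _; rewrite mxE meixner_mxSS mulNr.
Qed.

Lemma enorm_ge t i : `|t 0 i| <= enorm t.
Proof.
rewrite -[leLHS]sqrCK // /enorm ler_sqrtC ?qualifE /= ?exprn_ge0 ?sumr_ge0 //.
  by rewrite (bigD1 i) //= lerDl sumr_ge0 // => j _; rewrite exprn_ge0.
Qed.

Lemma enorm_le t : enorm t <= \sum_i `|t 0 i|.
Proof.
have s0 : 0 <= \sum_i `|t 0 i| by rewrite sumr_ge0.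
rewrite -[leRHS]sqrCK // /enorm ler_sqrtC ?qualifE /= ?exprn_ge0 ?sumr_ge0 //.
rewrite expr2 mulr_suml; apply: ler_sum => i _; rewrite expr2 ler_wpM2l //.
by rewrite (bigD1 i) //= lerDl sumr_ge0.
Qed.

Lemma vsum_mvec n : vsum (mvec n) = (mabs n)%:R :> C.
Proof. by rewrite /vsum /mabs natr_sum; apply: eq_bigr => i _; rewrite mxE. Qed.

Lemma genfun_homF sg U n : exists2 r : C, 0 < r & forall t, enorm t < r ->
  conv_dom (meixner_mx U) t /\
  meixner_genfun U sg%:R (mvec n) t = homF sg n (affine t *m meixner_mx U).
Proof.
have g0 : meixner_mx U (lshift d 0) (lshift d 0) != 0.
  by rewrite meixner_mx00 oner_neq0.
have [r1 r10 h1] := conv_dom_near0 g0.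
pose G : 'rV[C]_d := \row_j \sum_i `|U i j|.
have [r2 r20 h2] := small_lmaj G (@ltr01 C).
have [r r0 [rr1 rr2]] := lower_bound2 r10 r20.
exists r => // t tr.
have tj j : `|t 0 j| <= r by apply: ltW; apply: le_lt_trans tr; exact: enorm_ge.
have dt : conv_dom (meixner_mx U) t.
  by apply: h1 => j; exact: le_trans rr1.
split => //; have w0 := affine_mul0_neq0 dt.
rewrite /meixner_genfun /homF -opprD vsum_mvec -natrD -(affine_meixner0 U) (cpow_natN _ w0).
congr (_ * _); apply: eq_bigr => i _; rewrite [mvec _ _ _]mxE affine_meixnerS cpow_nat //.
rewrite subr_eq0 eq_sym; apply: contraTneq (ltr01 : 0 < (1 : C)) => e1.
have : `|\sum_j U i j * t 0 j| < 1.
  apply: le_lt_trans (h2 t (fun j => le_trans (tj j) rr2)).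
  rewrite (le_trans (ler_norm_sum _ _ _)) // ler_sum // => j _.
  rewrite normrM ler_wpM2r // [G _ _]mxE [leRHS]ger0_norm ?sumr_ge0 //.
  by rewrite (bigD1 i) //= lerDl sumr_ge0.
by rewrite e1 normr1 ltxx.
Qed.

Lemma poch_nat_neq0 sg k : (0 < sg)%N -> poch (sg%:R : C) k != 0.
Proof.
move=> s0; apply/prodf_neq0 => i _; rewrite -natrD pnatr_eq0 -lt0n.
by rewrite addn_gt0 s0.
Qed.

Lemma nb_coef_neq0 sg m : (0 < sg)%N -> nb_coef sg m != 0 :> C.
Proof.
by move=> s0; rewrite mulf_neq0 ?poch_nat_neq0 // invr_eq0 mfact_neq0.
Qed.

(** The generating function near 0 is a quotient of products of affine forms,
    since the exponents are integers; its expansion has [matcoef] for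
    coefficients, and these are the only possible ones. *)
Theorem meixnerE sg U m n : (0 < sg)%N ->
  meixner U sg%:R m (mvec n) = matcoef sg (meixner_mx U) n m / nb_coef sg m.
Proof.
move=> s0; pose M0 m : C := matcoef sg (meixner_mx U) n m / nb_coef sg m.
have nM0 k : nb_coef sg k * M0 k = matcoef sg (meixner_mx U) n k.
  by rewrite /M0 mulrC divfK // nb_coef_neq0.
have [r r0 hr] := genfun_homF sg U n.
suff E : (fun k => meixner U sg%:R k (mvec n)) = M0 by exact: (congr1 (@^~ m) E).
apply: (@xget_unique _ (fun=> 0) (meixner_expansion U sg%:R (mvec n)) M0).
  exists r => // t /hr [dt ->].
  have [_ hs] := asum_matcoef sg n dt.
  by apply: (eq_has_sum _ hs) => k; rewrite /pterm -nM0.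
move=> M [r' r'0 hM]; apply/funext => k.
have [r1 r10 [r1r r1r']] := lower_bound2 r0 r'0.
have d0 : 0 < d.+1%:R :> C by rewrite ltr0n.
(* Uniqueness of coefficients is used on polydiscs, while the expansion is
   given on a Euclidean ball. *)
have small t : (forall j, `|t 0 j| <= r1 / d.+1%:R) -> enorm t < r1.
  move=> ht; apply: le_lt_trans (enorm_le t) _.
  apply: (@le_lt_trans _ _ (\sum_(j < d) r1 / d.+1%:R)).
    by apply: ler_sum => j _; exact: ht.
  rewrite sumr_const card_ord -[ltLHS]mulr_natr -mulrA gtr_pMr // mulrC.
  by rewrite ltr_pdivrMr // mul1r ltr_nat.
apply: (mulfI (nb_coef_neq0 k s0)); move: k.
apply: (coef_unique (r := r1 / d.+1%:R) (f := meixner_genfun U sg%:R (mvec n))).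
- by rewrite divr_gt0.
- by move=> t /small ht; apply: hM; exact: lt_le_trans r1r'.
- move=> t /small ht; have [|dt ->] := hr t; first exact: lt_le_trans r1r.
  have [_ hs] := asum_matcoef sg n dt.
  by apply: (eq_has_sum _ hs) => k; rewrite /pterm nM0.
Qed.

Lemma dual_meixner_mx U : dualmx (meixner_mx U) = meixner_mx U^T.
Proof.
apply/matrixP => k l; case: (split_ordP k) => k' ->; case: (split_ordP l) => l' ->.
- by rewrite !ord1 dualmx00 !meixner_mx00.
- by rewrite !ord1 dualmx0S meixner_mxS0 meixner_mx0S opprK.
- by rewrite !ord1 dualmxS0 meixner_mxS0 meixner_mx0S.
- by rewrite dualmxSS !meixner_mxSS mxE.
Qed.

(** [dualmx] exchanges the matrices attached to [U] and to its transpose. *)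
Theorem meixner_duality sg U m n : (0 < sg)%N ->
  meixner U sg%:R m (mvec n) = meixner U^T sg%:R n (mvec m).
Proof.
move=> s0; rewrite !meixnerE // -dual_meixner_mx.
have g0 : meixner_mx U (lshift d 0) (lshift d 0) != 0.
  by rewrite meixner_mx00 oner_neq0.
have nm := nb_coef_neq0 m s0; have nn := nb_coef_neq0 n s0.
apply: (mulfI nn); rewrite mulrA (matcoef_dual sg n m g0) [RHS]mulrC divfK //.
by rewrite mulrAC (mulfV nm) mul1r.
Qed.

Lemma mpow_opp z m : mpow (- z) m = (-1) ^+ mabs m * mpow z m.
Proof. by rewrite -scaleN1r mpow_scale. Qed.

Lemma ablkE g : ablk g = g (lshift d 0) (lshift d 0).
Proof. by rewrite /ablk !mxE. Qed.

Lemma bblkE g i : bblk g 0 i = g (lshift d 0) (rshift 1 i).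
Proof. by rewrite /bblk !mxE; congr (g _ _); apply/val_inj. Qed.

Lemma cblkE g i : cblk g 0 i = g (rshift 1 i) (lshift d 0).
Proof. by rewrite /cblk !mxE; congr (g _ _); apply/val_inj. Qed.

Lemma affine_nondeg0 g z : nondeg g -> (affine z *m g) 0 (lshift d 0)
    = ablk g * (1 + \sum_j ptvec g 0 j * z 0 j).
Proof.
case=> a0 _; rewrite affine_mul mulrDr mulr1 /lform -ablkE mulr_sumr.
congr (_ + _); apply: eq_bigr => j _; rewrite [ptvec _ _ _]mxE [lowcol _ _ _ _]mxE -cblkE.
by rewrite mulrA [ablk g * _]mulrC divfK.
Qed.

Lemma affine_nondegS g z i : nondeg g -> (affine z *m g) 0 (rshift 1 i)
    = bblk g 0 i * (1 + \sum_j Umx g i j * ptvec g 0 j * z 0 j).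
Proof.
case=> a0 bc0; have [b0 _] := bc0 i.
rewrite affine_mul mulrDr mulr1 /lform -bblkE mulr_sumr; congr (_ + _).
apply: eq_bigr => j _; have [_ c0] := bc0 j.
rewrite [ptvec _ _ _]mxE [lowcol _ _ _ _]mxE [Umx _ _ _]mxE.
have -> : Dblk g j i = g (rshift 1 j) (rshift 1 i) by rewrite /Dblk !mxE.
by field; rewrite a0 b0 c0.
Qed.

(** The factors that do not depend on [z] are the diagonal factors relating
    [g] to its matrix [Umx g]. *)
Lemma homF_nondeg sg g n z : nondeg g -> homF sg n (affine z *m g)
  = ablk g ^- sg * mpow (pvec g) n *
    ((1 + \sum_j ptvec g 0 j * z 0 j) ^- (sg + mabs n)
     * \prod_i (1 + \sum_j Umx g i j * ptvec g 0 j * z 0 j) ^+ n i).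
Proof.
move=> gnd; rewrite /homF affine_nondeg0 // exprMn invfM.
have -> : \prod_i (affine z *m g) 0 (rshift 1 i) ^+ n i = \prod_i bblk g 0 i ^+ n i
    * \prod_i (1 + \sum_j Umx g i j * ptvec g 0 j * z 0 j) ^+ n i.
  rewrite -big_split; apply: eq_bigr => i _; rewrite affine_nondegS // exprMn //.
have -> : mpow (pvec g) n = ablk g ^- mabs n * \prod_i bblk g 0 i ^+ n i.
  rewrite /mpow /mabs -prodrXr -prodfV -big_split; apply: eq_bigr => i _.
  by rewrite mxE expr_div_n mulrC.
rewrite [ablk g ^+ (_ + _)]exprD invfM.
by ring.
Qed.

(** Up to diagonal factors, which only rescale the variables [z] and the
    basis, [g] is the matrix [meixner_mx (Umx g)]. *)
Theorem matcoef_meixner sg g m n : (0 < sg)%N -> nondeg g ->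
  matcoef sg g n m = ablk g ^- sg * mpow (pvec g) n *
    ((-1) ^+ mabs m * mpow (ptvec g) m * nb_coef sg m * meixner (Umx g) sg%:R m (mvec n)).
Proof.
move=> s0 gnd; rewrite meixnerE //.
have g0 : g (lshift d 0) (lshift d 0) != 0 by rewrite -ablkE; case: gnd.
have U0 : meixner_mx (Umx g) (lshift d 0) (lshift d 0) != 0.
  by rewrite meixner_mx00 oner_neq0.
have [r1 r10 h1] := conv_dom_near0 g0.
have [r2 r20 h2] := conv_dom_near0 U0.
have [rt rt0 ht] := small_lmaj (ptvec g) r20.
have [r12 r120 [r121 r122]] := lower_bound2 r10 rt0.
pose sc z : 'rV[C]_d := \row_j ((- ptvec g) 0 j * z 0 j).
have scE z j : sc z 0 j = - (ptvec g 0 j * z 0 j) by rewrite !mxE mulNr.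
move: m; apply: (coef_unique r120 (f := fun z => homF sg n (affine z *m g))) => z zr.
  have dz : conv_dom g z by apply: h1 => j; exact: le_trans r121.
  by case: (asum_matcoef sg n dz).
have dsc : conv_dom (meixner_mx (Umx g)) (sc z).
  apply: h2 => j; have hz := ltW (ht z (fun j => le_trans (zr j) r122)).
  rewrite (le_trans _ hz) // scE normrN normrM /lmaj (bigD1 j) //= lerDl.
  by apply: sumr_ge0 => i _; rewrite mulr_ge0.
have -> : homF sg n (affine z *m g) = ablk g ^- sg * mpow (pvec g) n *
    homF sg n (affine (sc z) *m meixner_mx (Umx g)).
  rewrite homF_nondeg //; congr (_ * _); rewrite /homF affine_meixner0.
  congr (_ ^- _ * _).
    by rewrite -sumrN; congr (_ + _); apply: eq_bigr => j _; rewrite scE opprK.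
  apply: eq_bigr => i _; rewrite affine_meixnerS -sumrN; congr ((_ + _) ^+ _).
  by apply: eq_bigr => j _; rewrite scE mulrN opprK mulrA.
have [_ hs] := asumZ (ablk g ^- sg * mpow (pvec g) n) (asum_matcoef sg n dsc).
apply: (eq_has_sum _ hs) => k; rewrite /pterm -[RHS]mulrA; congr (_ * _).
have nk := nb_coef_neq0 k s0; rewrite mpow_mul mpow_opp mulrA; congr (_ * _).
by rewrite mulrC -[RHS]mulrA (mulrCA (nb_coef sg k)) (mulfV nk) mulr1.
Qed.

End MeixnerCoef.

(** * Pseudo-unitary matrices *)

Section PseudoUnitary.
Context {R : realType} {d : nat}.
Local Notation C := (R[i]).
Implicit Types (m n k : mindex d) (i j : 'I_d) (g h : 'M[C]_(1 + d)) (sg : nat).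

(** The inverse of a pseudo-unitary matrix, see [SU1_mulVg]. *)
Definition adjJ g : 'M[C]_(1 + d) := dualmx (map_mx Num.conj g).

Lemma SU1_mulVg g : SU1 g -> adjJ g *m g = 1%:M.
Proof.
case=> _ gJ; rewrite /adjJ /dualmx map_trmx.
by rewrite -!mulmxA [X in mxJ *m X]mulmxA gJ mxJK.
Qed.

Lemma SU1_mulgV g : SU1 g -> g *m adjJ g = 1%:M.
Proof. by move=> /SU1_mulVg /mulmx1C. Qed.

Lemma adjJ00 g : adjJ g (lshift d 0) (lshift d 0) = (ablk g)^*.
Proof. by rewrite dualmx00 mxE ablkE. Qed.

Lemma adjJ0S g i : adjJ g (lshift d 0) (rshift 1 i) = - (cblk g 0 i)^*.
Proof. by rewrite dualmx0S mxE cblkE. Qed.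

Lemma adjJS0 g i : adjJ g (rshift 1 i) (lshift d 0) = - (bblk g 0 i)^*.
Proof. by rewrite dualmxS0 mxE bblkE. Qed.

Lemma SU1_sum_c g : SU1 g -> \sum_i `|cblk g 0 i| ^+ 2 = `|ablk g| ^+ 2 - 1.
Proof.
move=> /SU1_mulVg /matrixP /(_ (lshift d 0) (lshift d 0)).
rewrite mxE [RHS]mxE eqxx mulr1n big_split_ord big_ord1 /= adjJ00 -ablkE mulrC -normCK.
move=> <-; rewrite opprD addrA subrr add0r -sumrN; apply: eq_bigr => i _.
by rewrite adjJ0S -cblkE mulNr opprK normCK mulrC.
Qed.

Lemma SU1_sum_b g : SU1 g -> \sum_i `|bblk g 0 i| ^+ 2 = `|ablk g| ^+ 2 - 1.
Proof.
move=> /SU1_mulgV /matrixP /(_ (lshift d 0) (lshift d 0)).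
rewrite mxE [RHS]mxE eqxx mulr1n big_split_ord big_ord1 /= adjJ00 -ablkE -normCK.
move=> <-; rewrite opprD addrA subrr add0r -sumrN; apply: eq_bigr => i _.
by rewrite adjJS0 -bblkE mulrN opprK normCK.
Qed.

Lemma SU1_norm_a_ge1 g : SU1 g -> 1 <= `|ablk g| ^+ 2.
Proof.
move=> /SU1_sum_c e; rewrite -subr_ge0 -e.
by apply: sumr_ge0 => i _; rewrite exprn_ge0.
Qed.

Lemma SU1_a_neq0 g : SU1 g -> ablk g != 0.
Proof.
move=> /SU1_norm_a_ge1; apply: contraTneq => ->.
by rewrite normr0 expr0n /= ler10.
Qed.

(** The Cauchy-Schwarz inequality with one strict bound, deduced termwise from
    [2 x y al be <= (be x)^2 + (al y)^2]. *)
Lemma sum_mul_lt (x y : 'I_d -> C) (al be : C) : 0 < al -> 0 < be ->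
  (forall i, 0 <= x i) -> (forall i, 0 <= y i) ->
  \sum_i x i ^+ 2 < al ^+ 2 -> \sum_i y i ^+ 2 <= be ^+ 2 ->
  \sum_i x i * y i < al * be.
Proof.
move=> a0 b0 x0 y0 hx hy.
have ab0 : 0 < al * be by rewrite mulr_gt0.
(* Multiplying by [2 al be] makes both sides comparable to sums of squares. *)
rewrite -(ltr_pM2l (mulr_gt0 (@ltr0Sn C 1) ab0)).
apply: (@le_lt_trans _ _ (\sum_i (be ^+ 2 * x i ^+ 2 + al ^+ 2 * y i ^+ 2))).
  rewrite mulr_sumr; apply: ler_sum => i _; rewrite -subr_ge0.
  have -> : be ^+ 2 * x i ^+ 2 + al ^+ 2 * y i ^+ 2 - 2 * (al * be) * (x i * y i)
     = (be * x i - al * y i) ^+ 2 by ring.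
  by rewrite real_exprn_even_ge0 // rpredB // ger0_real // mulr_ge0 // ltW.
rewrite big_split /= -!mulr_sumr.
have -> : 2 * (al * be) * (al * be) = be ^+ 2 * al ^+ 2 + al ^+ 2 * be ^+ 2 by ring.
by rewrite ltr_leD ?ltr_pM2l ?ler_pM2l ?exprn_gt0.
Qed.

(** The first rows and columns of pseudo-unitary matrices satisfy the
    convergence condition of [matcoef_mul] because |a|^2 exceeds |b|^2 and
    |c|^2 by one. *)
Lemma SU1_gap g1 g2 : SU1 g1 -> SU1 g2 ->
  \sum_i `|g2 (rshift 1 i) (lshift d 0)| * `|g1 (lshift d 0) (rshift 1 i)|
    < `|g2 (lshift d 0) (lshift d 0)| * `|g1 (lshift d 0) (lshift d 0)|.
Proof.
move=> h1 h2; rewrite -!ablkE; apply: sum_mul_lt => //.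
- by rewrite normr_gt0 SU1_a_neq0.
- by rewrite normr_gt0 SU1_a_neq0.
- under eq_bigr do rewrite -cblkE.
  by rewrite (SU1_sum_c h2) ltrBlDr ltrDl.
- under eq_bigr do rewrite -bblkE.
  by rewrite (SU1_sum_b h1) lerBlDr lerDl.
Qed.

(** Unitarity of the representation: the norms of the basis vectors are given
    by [nb_coef]. *)
Lemma matcoef_adjJ sg g m n : SU1 g ->
  nb_coef sg m * matcoef sg (adjJ g) m n = nb_coef sg n * (matcoef sg g n m)^*.
Proof.
move=> /SU1_a_neq0 a0; have g0 : g (lshift d 0) (lshift d 0) != 0 by rewrite -ablkE.
rewrite -(matcoef_conj sg n m g0) [RHS]matcoef_dual //.
by rewrite mxE conjC_eq0.
Qed.

Lemma matcoef_mulgV sg g m m' : SU1 g ->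
  has_sum (fun n => matcoef sg (adjJ g) m' n * matcoef sg g n m) (m == m')%:R.
Proof.
move=> gSU; rewrite -(matcoef1 sg) -(SU1_mulgV gSU); apply: matcoef_mul.
  by rewrite -ablkE SU1_a_neq0.
rewrite -(ablkE g) adjJ00 norm_conjC -expr2.
under eq_bigr do rewrite adjJS0 normrN norm_conjC -(bblkE g) -expr2.
by rewrite (SU1_sum_b gSU) ltrBlDr ltrDl.
Qed.

Lemma matcoef_mulVg sg g n n' : SU1 g ->
  has_sum (fun m => matcoef sg g n m * matcoef sg (adjJ g) m n') (n' == n)%:R.
Proof.
move=> gSU; rewrite -(matcoef1 sg) -(SU1_mulVg gSU); apply: matcoef_mul.
  by rewrite adjJ00 conjC_eq0 SU1_a_neq0.
rewrite -(ablkE g) adjJ00 norm_conjC -expr2.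
under eq_bigr do rewrite adjJ0S normrN norm_conjC -(cblkE g) -expr2.
by rewrite (SU1_sum_c gSU) ltrBlDr ltrDl.
Qed.

Lemma mpowNE (x : 'rV[C]_d) n : mpowN x n = (mpow x n)^-1.
Proof. by rewrite /mpowN /mpow prodfV. Qed.

Lemma mpow_conj (x : 'rV[C]_d) n : mpow (vconj x) n = (mpow x n)^*.
Proof.
by rewrite /mpow rmorph_prod; apply: eq_bigr => i _; rewrite rmorphXn mxE.
Qed.

Lemma mpow_neq0 (x : 'rV[C]_d) n : (forall i, x 0 i != 0) -> mpow x n != 0.
Proof. by move=> x0; apply/prodf_neq0 => i _; rewrite expf_neq0. Qed.

Lemma pvec_neq0 g i : nondeg g -> pvec g 0 i != 0.
Proof. by case=> a0 /(_ i) [b0 _]; rewrite mxE mulf_neq0 ?invr_eq0. Qed.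

Lemma ptvec_neq0 g i : nondeg g -> ptvec g 0 i != 0.
Proof. by case=> a0 /(_ i) [_ c0]; rewrite mxE mulf_neq0 ?invr_eq0. Qed.

Lemma conj_nb_coef sg m : (nb_coef sg m : C)^* = nb_coef sg m.
Proof.
rewrite /nb_coef rmorphM fmorphV rmorph_nat /poch rmorph_prod; congr (_ / _).
by apply: eq_bigr => i _; rewrite -natrD rmorph_nat.
Qed.

End PseudoUnitary.

(** * Orthogonality and the sum identity *)

Section Orthogonality.
Context {R : realType} {d : nat}.
Local Notation C := (R[i]).
Implicit Types (m n k : mindex d) (i j : 'I_d) (g : 'M[C]_(1 + d)) (sg : nat).

Lemma nb_coefE sg m : nb_coef sg m = poch sg%:R (mabs m) / (mfact m)%:R :> C.
Proof. by []. Qed.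

Lemma poch_nb sg m : poch sg%:R (mabs m) = nb_coef sg m * (mfact m)%:R :> C.
Proof. by rewrite nb_coefE divfK // mfact_neq0. Qed.

Lemma sign_sqr (k : nat) : (-1 : C) ^+ k * (-1) ^+ k = 1.
Proof. by rewrite -exprMn mulrNN mulr1 expr1n. Qed.

Lemma norm_exprVn (a : C) sg : (`|a| ^- 2) ^+ sg = (a ^+ sg * a^* ^+ sg)^-1.
Proof. by rewrite normCK exprVn exprMn. Qed.

Lemma meixner_matcoef sg g n k : (0 < sg)%N -> nondeg g ->
  meixner (Umx g) sg%:R k (mvec n) = ablk g ^+ sg * (-1) ^+ mabs k
    / mpow (ptvec g) k / nb_coef sg k / mpow (pvec g) n * matcoef sg g n k.
Proof.
move=> s0 gnd; have [a0 _] := gnd; rewrite (matcoef_meixner k n s0 gnd).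
have pt0 : mpow (ptvec g) k != 0 by apply: mpow_neq0 => i; exact: ptvec_neq0.
have p0 : mpow (pvec g) n != 0 by apply: mpow_neq0 => i; exact: pvec_neq0.
have nb0 := @nb_coef_neq0 R d sg k s0.
have as0 : ablk g ^+ sg != 0 by rewrite expf_neq0.
rewrite -[LHS]mul1r -[X in X * _ = _](sign_sqr (mabs k)); set e := (-1) ^+ _.
by field; rewrite as0 pt0 p0 nb0.
Qed.

Theorem orthogonality_n sg g m m' : (0 < sg)%N -> SU1 g -> nondeg g ->
  has_sum (fun n : mindex d =>
         poch sg%:R (mabs n) / (mfact n)%:R * mpow (pvec g) n * mpow (vconj (pvec g)) n
         * meixner (Umx g) sg%:R m (mvec n) * (meixner (Umx g) sg%:R m' (mvec n))^*)
   ((m == m')%:R * ((mfact m)%:R * mpowN (ptvec g) m * mpowN (vconj (ptvec g)) m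
                        / (poch sg%:R (mabs m) * (`|ablk g| ^- 2) ^+ sg))).
Proof.
move=> s0 gSU gnd; have a0 := SU1_a_neq0 gSU.
(* [kap k] is the ratio of [mpow (pvec g) n * M_k(n)] to [matcoef sg g n k]. *)
pose kap k := ablk g ^+ sg * (-1) ^+ mabs k / mpow (ptvec g) k / nb_coef sg k.
have pt0 k : mpow (ptvec g) k != 0 by apply: mpow_neq0 => i; exact: ptvec_neq0.
have p0 k : mpow (pvec g) k != 0 by apply: mpow_neq0 => i; exact: pvec_neq0.
have nb0 k := @nb_coef_neq0 R d sg k s0.
have as0 : ablk g ^+ sg != 0 by rewrite expf_neq0.
have as0' : (ablk g)^* ^+ sg != 0 by rewrite expf_neq0 // conjC_eq0.
have := has_sumZ (kap m * (kap m')^* * nb_coef sg m') (@matcoef_mulgV R d sg g m m' gSU).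
set S := (X in has_sum _ X); set S' := (X in _ -> has_sum _ X) => hs.
have <- : S = S'.
  rewrite /S /S' {hs S S'}; have [<-|_] := eqVneq m m'; last by rewrite mulr0 mul0r.
  rewrite mulr1 mul1r !mpowNE mpow_conj poch_nb /kap norm_exprVn.
  rewrite !rmorphM !fmorphV rmorphXn rmorph_sign /= conj_nb_coef.
  have cpt0 : (mpow (ptvec g) m)^* != 0 by rewrite conjC_eq0.
  rewrite -[RHS]mul1r -[X in _ = X * _](sign_sqr (mabs m)); set e := (-1) ^+ _.
  by field; rewrite as0 as0' pt0 cpt0 nb0 mfact_neq0.
apply: (eq_has_sum _ hs) => n.
rewrite !(meixner_matcoef n _ s0 gnd) -nb_coefE mpow_conj.
have cp0 : (mpow (pvec g) n)^* != 0 by rewrite conjC_eq0.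
transitivity (kap m * (kap m')^* * (nb_coef sg n * (matcoef sg g n m')^*) * matcoef sg g n m).
  by rewrite -(matcoef_adjJ sg m' n gSU); ring.
rewrite -/(kap m) -/(kap m'); move: (kap m) (kap m') => u v.
rewrite !rmorphM !fmorphV /=.
by field; rewrite p0 cp0.
Qed.

Theorem orthogonality_m sg g n n' : (0 < sg)%N -> SU1 g -> nondeg g ->
  has_sum (fun m : mindex d =>
         poch sg%:R (mabs m) / (mfact m)%:R * mpow (ptvec g) m * mpow (vconj (ptvec g)) m
         * meixner (Umx g) sg%:R m (mvec n) * (meixner (Umx g) sg%:R m (mvec n'))^*)
   ((n == n')%:R * ((mfact n)%:R * mpowN (pvec g) n * mpowN (vconj (pvec g)) n
                        / (poch sg%:R (mabs n) * (`|ablk g| ^- 2) ^+ sg))).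
Proof.
move=> s0 gSU gnd; have a0 := SU1_a_neq0 gSU.
(* Here the signs and the powers of p~ cancel between the two factors, and only
   the powers of p remain. *)
pose kap k := ablk g ^+ sg / mpow (pvec g) k.
have pt0 k : mpow (ptvec g) k != 0 by apply: mpow_neq0 => i; exact: ptvec_neq0.
have p0 k : mpow (pvec g) k != 0 by apply: mpow_neq0 => i; exact: pvec_neq0.
have nb0 k := @nb_coef_neq0 R d sg k s0.
have as0 : ablk g ^+ sg != 0 by rewrite expf_neq0.
have as0' : (ablk g)^* ^+ sg != 0 by rewrite expf_neq0 // conjC_eq0.
have := has_sumZ (kap n * (kap n')^* / nb_coef sg n') (@matcoef_mulVg R d sg g n n' gSU).
set S := (X in has_sum _ X); set S' := (X in _ -> has_sum _ X) => hs.
have <- : S = S'.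
  rewrite /S /S' {hs S S'} [n' == n]eq_sym.
  have [<-|_] := eqVneq n n'; last by rewrite mulr0 mul0r.
  rewrite mulr1 mul1r !mpowNE mpow_conj poch_nb /kap norm_exprVn.
  rewrite !rmorphM !fmorphV rmorphXn /=.
  have cp0 : (mpow (pvec g) n)^* != 0 by rewrite conjC_eq0.
  by field; rewrite as0 as0' p0 cp0 nb0 mfact_neq0.
apply: (eq_has_sum _ hs) => m.
rewrite !(meixner_matcoef _ m s0 gnd) -nb_coefE mpow_conj.
have cpt0 : (mpow (ptvec g) m)^* != 0 by rewrite conjC_eq0.
have cp0 : (mpow (pvec g) n')^* != 0 by rewrite conjC_eq0.
have adj : matcoef sg (adjJ g) m n' = nb_coef sg n' * (matcoef sg g n' m)^* / nb_coef sg m.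
  by rewrite -(matcoef_adjJ sg m n' gSU) mulrAC (mulfV (nb0 m)) mul1r.
rewrite adj /kap !rmorphM !fmorphV rmorphXn rmorph_sign /= conj_nb_coef.
rewrite -[LHS]mul1r -[X in X * _ = _](sign_sqr (mabs m)); set e := (-1) ^+ _.
by field; rewrite pt0 cpt0 p0 cp0 !nb0.
Qed.

Theorem sum_identity sg g1 g2 m n : (0 < sg)%N -> SU1 g1 -> SU1 g2 ->
  nondeg g1 -> nondeg g2 -> nondeg (g1 *m g2) ->
  has_sum (fun k : mindex d =>
           (-1) ^+ mabs k * mpow (pvec g1) k * mpow (ptvec g2) k
           * (poch sg%:R (mabs k) / (mfact k)%:R)
           * meixner (Umx g1) sg%:R m (mvec k) * meixner (Umx g2) sg%:R k (mvec n))
         ((ablk g1 * ablk g2 / ablk (g1 *m g2)) ^+ sg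
          * mpow (ptvec (g1 *m g2)) m * mpowN (ptvec g1) m
          * mpow (pvec (g1 *m g2)) n * mpowN (pvec g2) n
          * meixner (Umx (g1 *m g2)) sg%:R m (mvec n)).
Proof.
move=> s0 SU_1 SU_2 nd1 nd2 nd12.
have pt0 g k : nondeg g -> mpow (ptvec g) k != 0.
  by move=> gnd; apply: mpow_neq0 => i; exact: ptvec_neq0.
have p0 g k : nondeg g -> mpow (pvec g) k != 0.
  by move=> gnd; apply: mpow_neq0 => i; exact: pvec_neq0.
have nb0 k := @nb_coef_neq0 R d sg k s0.
have as0 g : nondeg g -> ablk g ^+ sg != 0 by case=> a0 _; rewrite expf_neq0.
have g10 : g1 (lshift d 0) (lshift d 0) != 0 by rewrite -ablkE; case: nd1.
have hm := matcoef_mul (sg := sg) (n := n) (m := m) g10 (SU1_gap SU_1 SU_2).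
have := has_sumZ (ablk g1 ^+ sg * ablk g2 ^+ sg * (-1) ^+ mabs m
   / mpow (ptvec g1) m / mpow (pvec g2) n / nb_coef sg m) hm.
set S := (X in has_sum _ X); set S' := (X in _ -> has_sum _ X) => hs.
have <- : S = S'.
  rewrite /S /S' (meixner_matcoef n m s0 nd12) !mpowNE expr_div_n exprMn.
  by field; rewrite !pt0 ?p0 ?as0 ?nb0.
apply: (eq_has_sum _ hs) => k.
rewrite (meixner_matcoef k m s0 nd1) (meixner_matcoef n k s0 nd2) -nb_coefE.
rewrite -[LHS]mul1r -[X in X * _ = _](sign_sqr (mabs k)); set e := (-1) ^+ mabs k.
by field; rewrite !pt0 ?p0 ?nb0.
Qed.

End Orthogonality.

(** * Lebesgue measure on tuples *)

Section TupleMeasure.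
Context {R : realType}.
Local Notation Rm := (measurableTypeR R).
Local Open Scope classical_set_scope.

Definition cube n (r : R) : set (n.-tuple Rm) := [set x | forall i, `|tnth x i| <= r].

Lemma measurable_tcons n : measurable_fun [set: Rm * n.-tuple Rm] (@tcons R n).
Proof. exact: measurable_cons. Qed.

Lemma measurable_cube n r : measurable (@cube n r).
Proof.
rewrite (_ : cube r = \bigcap_(i in [set: 'I_n]) ((fun x : n.-tuple Rm => tnth x i) @^-1` `[(- r), r])).
  apply: fin_bigcap_measurable; first exact: finite_finset.
  move=> i _; rewrite -[X in measurable X]setTI; apply: measurable_tnth => //.
by apply/seteqP; split => x /= h i; [move=> _|have := h i I];
  rewrite /= ?in_itv /= -ler_norml.
Qed.

Lemma tnth_tcons0 n (t : R) (x : n.-tuple R) : tnth (@tcons R n (t, x)) ord0 = t.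
Proof. by []. Qed.

Lemma tnth_tconsS n (t : R) (x : n.-tuple R) (i : 'I_n) :
  tnth (@tcons R n (t, x)) (lift ord0 i) = tnth x i.
Proof. by rewrite !(tnth_nth 0) /=. Qed.

Lemma tcons_cube n r : @tcons R n @^-1` (@cube n.+1 r) = `[(- r), r] `*` @cube n r.
Proof.
apply/seteqP; split => -[t x] /=.
  move=> h; split; first by rewrite in_itv /= -ler_norml; exact: (h ord0).
  by move=> i; have := h (lift ord0 i); rewrite tnth_tconsS.
rewrite in_itv /= -ler_norml => -[ht hx] i.
by case: (unliftP ord0 i) => [j ->|->]; rewrite ?tnth_tconsS.
Qed.

Lemma lebesgueRn_cube n (r : R) : 0 < r ->
  lebesgueRn n (@cube n r) = ((r + r) ^+ n)%:E.
Proof.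
move=> r0; elim: n => [|n IH].
  by rewrite expr0 /= diracE mem_set // => -[].
rewrite [LHS](_ : _ = (lebesgue_measure \x lebesgueRn n)%E (@tcons R n @^-1` (@cube n.+1 r))) //.
rewrite tcons_cube.
transitivity (lebesgue_measure (`[(- r)%R, r] : set R) * lebesgueRn n (@cube n r))%E.
  by apply: product_measure1E => //; exact: measurable_cube.
rewrite IH lebesgue_measure_itv /= lte_fin ifT ?gtrN //.
by rewrite opprK -EFinM exprS.
Qed.

Lemma bounded_support_integrable d (T : measurableType d) (m : {measure set T -> \bar R})
    (B : set T) (F : T -> R) (M : R) : measurable B -> (m B < +oo)%E ->
  measurable_fun setT F -> (forall x, `|F x| <= M) -> (forall x, ~ B x -> F x = 0) ->
  m.-integrable setT (EFin \o F).
Proof.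
move=> mB Boo mF FM F0.
have -> : EFin \o F = (EFin \o F) \_ B.
  apply/funext => x; rewrite patchE; case: ifPn => // /negP.
  by rewrite inE => /F0 /= ->.
apply/(integrable_mkcond _ mB).
apply: measurable_bounded_integrable => //.
  exact: measurable_funTS.
exists M; split; first exact: num_real.
by move=> y My x _ /=; exact: le_trans (FM x) (ltW My).
Qed.

(** A class of integrable functions that is stable under taking slices, unlike
    integrability itself. *)
Definition cube_supported n (F : n.-tuple Rm -> R) :=
  [/\ measurable_fun setT F, exists M, forall x, `|F x| <= M
    & forall x, ~ cube 1 x -> F x = 0].

Lemma cube_supported_integrable2 n (F : n.+1.-tuple Rm -> R) : cube_supported F ->
  (lebesgue_measure \x lebesgueRn n)%E.-integrable setT (EFin \o (F \o @tcons R n)).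
Proof.
move=> [mF [M FM] F0].
apply: (@bounded_support_integrable _ _ _ (@tcons R n @^-1` (@cube n.+1 1)) _ M).
- by rewrite -[X in measurable X]setTI; apply: measurable_tcons => //; exact: measurable_cube.
- have := @lebesgueRn_cube n.+1 1 ltr01 => E.
  by rewrite [ltLHS](_ : _ = ((1 + 1 : R) ^+ n.+1)%:E) ?ltry.
- by apply: measurableT_comp => //; exact: measurable_tcons.
- by move=> x; exact: FM.
- by move=> x; exact: F0.
Qed.

Lemma cube_supported_slice n (F : n.+1.-tuple Rm -> R) (t : R) : cube_supported F ->
  cube_supported (fun x : n.-tuple Rm => F (tcons (t, x))).
Proof.
move=> [mF [M FM] F0]; split.
- apply: (measurableT_comp mF).
  apply: (@measurable_cons _ _ _ _ (cst t) n id).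
    exact: measurable_cst.
  exact: measurable_id.
- by exists M.
- move=> x hx; apply: F0 => h; apply: hx => i.
  by have := h (lift ord0 i); rewrite tnth_tconsS.
Qed.

Lemma integral_lebesgueRnS n (F : n.+1.-tuple Rm -> R) : cube_supported F ->
  (\int[lebesgueRn n.+1]_x (F x)%:E
   = \int[lebesgue_measure \x lebesgueRn n]_p (F (@tcons R n p))%:E)%E.
Proof.
move=> hF; have [mF _ _] := hF.
have := @integral_pushforward _ _ _ _ R (@tcons R n) (@measurable_tcons n)
  (lebesgue_measure \x lebesgueRn n)%E setT (EFin \o F).
rewrite preimage_setT => <- //.
- exact/measurable_EFinP.
- exact: cube_supported_integrable2.
Qed.

Definition tset n (x : n.-tuple R) (i : 'I_n) (t : R) : n.-tuple R :=
  [tuple if j == i then t else tnth x j | j < n].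

Lemma tnth_tset n (x : n.-tuple R) i t j :
  tnth (tset x i t) j = if j == i then t else tnth x j.
Proof. by rewrite tnth_mktuple. Qed.

(** A function whose integral along the i-th coordinate vanishes everywhere
    has integral 0: integrate along that coordinate first.  The induction
    peels off the coordinates before the i-th one. *)
Theorem integral_coord0 n (F : n.-tuple Rm -> R) (i : 'I_n) : cube_supported F ->
  (forall x : n.-tuple R, \int[lebesgue_measure]_(t in [set: Rm]) (F (tset x i t))%:E = 0)%E ->
  (\int[lebesgueRn n]_x (F x)%:E = 0)%E.
Proof.
elim: n F i => [|n IH] F i hF h0; first by case: i h0.
rewrite integral_lebesgueRnS //; have hi := cube_supported_integrable2 hF.
(* The two orders of integration: the first coordinate last, or first. *)
case: (unliftP ord0 i) => [j ij|i0].
  rewrite -(integral12_prod_meas1 hi) /fubini_F; apply: integral0_eq => t _ /=.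
  apply: (IH _ j); first exact: cube_supported_slice.
  move=> x; rewrite -[RHS](h0 (tcons (t, x))); apply: eq_integral => u _.
  congr ((F _)%:E); apply: eq_from_tnth => k; rewrite tnth_tset ij.
  case: (unliftP ord0 k) => [l ->|->]; last by rewrite !tnth_tcons0.
  by rewrite !tnth_tconsS tnth_tset (inj_eq (@lift_inj _ _)).
rewrite -(integral21_prod_meas1 hi) /fubini_G; apply: integral0_eq => x _ /=.
rewrite -[RHS](h0 (tcons (0, x))); apply: eq_integral => u _.
congr ((F _)%:E); apply: eq_from_tnth => k; rewrite tnth_tset i0.
case: (unliftP ord0 k) => [l ->|->]; last by rewrite eqxx tnth_tcons0.
by rewrite !tnth_tconsS eq_sym (negPf (neq_lift _ _)).
Qed.

(** The fundamental theorem of calculus on the interval where [t ^+ 2 < A],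
    which is empty unless [0 < A]. *)
Lemma integral_deriv0 (q : {poly R}) (A : R) :
  (0 < A -> q.[Num.sqrt A] = q.[- Num.sqrt A]) ->
  (\int[lebesgue_measure]_(t in [set: Rm]) (if t ^+ 2 < A then q^`().[t] else 0)%:E = 0)%E.
Proof.
move=> q0; have [A0|A0] := leP A 0.
  apply: integral0_eq => t _; rewrite ifF //.
  by apply/negbTE; rewrite -leNgt (le_trans A0) // sqr_ge0.
have sA : 0 < Num.sqrt A by rewrite sqrtr_gt0.
have tE (t : R) : (t ^+ 2 < A) = (- Num.sqrt A < t < Num.sqrt A).
  by rewrite -ltr_norml -[in LHS](sqr_sqrtr (ltW A0)) -[t ^+ 2]real_normK ?num_real // ltr_pXn2r // nnegrE ltW.
transitivity (\int[lebesgue_measure]_(t in `](- Num.sqrt A)%R, (Num.sqrt A)%R[) (q^`().[t])%:E)%E.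
  rewrite [RHS]integral_mkcond; apply: eq_integral => t _.
  by rewrite patchE tE mem_setE in_itv /=; case: ifP.
rewrite integral_itv_bndo_bndc; last first.
  apply: measurable_funTS; apply/measurable_EFinP.
  by apply: continuous_measurable_fun; exact: continuous_horner.
rewrite integral_itv_obnd_cbnd; last first.
  apply: measurable_funTS; apply/measurable_EFinP.
  by apply: continuous_measurable_fun; exact: continuous_horner.
rewrite (@continuous_FTC2 _ (horner q^`()) (horner q)).
- by rewrite q0 // subee.
- by rewrite gtrN.
- by apply: continuous_subspaceT => x; exact: continuous_horner.
- split; first by move=> x _; exact: ex_derive.
  + by apply: cvg_at_right_filter; exact: continuous_horner.
  + by apply: cvg_at_left_filter; exact: continuous_horner.
- by move=> x _; rewrite derive1E derive_val.
Qed.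

End TupleMeasure.

(** * Complex integrals over the ball *)

Section ComplexIntegral.
Context {R : realType} {d : nat}.
Local Notation C := (R[i]).
Local Notation Rm := (measurableTypeR R).
Local Notation T := ((d + d).-tuple Rm).
Local Notation mu := (@lebesgueRn R (d + d)).
Local Notation B := (@cball R d).
Implicit Types (f g : T -> C) (w : T).
Local Open Scope classical_set_scope.

Definition nsq w : R := \sum_i tnth w i ^+ 2.

Lemma norm2_complex (x y : R) : `|Complex x y : C| ^+ 2 = (x ^+ 2 + y ^+ 2)%:C%C.
Proof. by rewrite -add_Re2_Im2. Qed.

Lemma enorm_cvec w : enorm (cvec w) ^+ 2 = (nsq w)%:C%C.
Proof.
rewrite sqrtCK /nsq big_split_ord /= -big_split rmorph_sum /=.
by apply: eq_bigr => i _; rewrite mxE norm2_complex.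
Qed.

Lemma enorm_ge0 n (z : 'rV[C]_n) : 0 <= enorm z.
Proof. by rewrite sqrtC_ge0 sumr_ge0 // => i _; rewrite exprn_ge0. Qed.

Lemma cballE w : B w <-> nsq w < 1.
Proof.
suff -> : (nsq w < 1) = (enorm (cvec w) < 1) by [].
rewrite -ltcR -enorm_cvec -[ltRHS](expr1n C 2).
by rewrite ltr_pXn2r // ?nnegrE ?enorm_ge0.
Qed.

Lemma measurable_nsq : measurable_fun [set: T] nsq.
Proof.
apply: measurable_sum => i; apply: measurable_funX; exact: measurable_tnth.
Qed.

Lemma cball_preimage : B = nsq @^-1` `]-oo, 1[.
Proof.
by apply/seteqP; split => w /=; rewrite in_itv /=; [move/cballE|move=> h; apply/cballE].
Qed.

Lemma measurable_cball : measurable B.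
Proof.
rewrite cball_preimage -[X in measurable X]setTI; apply: measurable_nsq => //.
Qed.

Lemma sqr_tnth_le_nsq w i : tnth w i ^+ 2 <= nsq w.
Proof. by rewrite /nsq (bigD1 i) //= lerDl sumr_ge0 // => j _; rewrite sqr_ge0. Qed.

Lemma cball_sub_cube : B `<=` @cube R (d + d) 1.
Proof.
move=> w /cballE w1 i; rewrite -(@ler_pXn2r _ 2) ?nnegrE //.
rewrite expr1n real_normK ?num_real // (le_trans (sqr_tnth_le_nsq w i)) //.
exact: ltW.
Qed.

Lemma mu_cball_lty : (mu B < +oo)%E.
Proof.
have E := @lebesgueRn_cube R (d + d) 1 ltr01.
apply: (@le_lt_trans _ _ (mu (@cube R (d + d) 1))); last by rewrite E ltry.
apply: le_measure; rewrite ?inE; [exact: measurable_cball|exact: measurable_cube|].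
exact: cball_sub_cube.
Qed.

Lemma mu_cball_gt0 : (0 < mu B)%E.
Proof.
(* The cube of half-side [e] lies in the ball, as the sum of 2 d squares [e ^+
   2] is at most [2 d e < 1]. *)
pose e : R := ((d + d).+1%:R)^-1.
have e0 : 0 < e by rewrite invr_gt0 ltr0n.
have E := @lebesgueRn_cube R (d + d) e e0.
apply: (@lt_le_trans _ _ (mu (@cube R (d + d) e))).
  by rewrite E lte_fin exprn_gt0 // addr_gt0.
apply: le_measure; rewrite ?inE; [exact: measurable_cube|exact: measurable_cball|].
move=> w hw; apply/cballE.
have n0 : 0 < (d + d).+1%:R :> R by rewrite ltr0n.
apply: (@le_lt_trans _ _ (\sum_(i < d + d) e)).
  apply: ler_sum => i _; rewrite -real_normK ?num_real //.
  have := hw i => hi; apply: (@le_trans _ _ (e ^+ 2)).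
    by rewrite ler_pXn2r // nnegrE ltW.
  rewrite expr2 ler_piMl ?(ltW e0) // invf_le1 // ler1n.
  by [].
rewrite sumr_const card_ord -[ltLHS]mulr_natr mulrC /e ltr_pdivrMr // mul1r.
by rewrite ltr_nat.
Qed.

Definition vol : R := fine (mu B).

Lemma vol_gt0 : 0 < vol.
Proof. by rewrite fine_gt0 // mu_cball_gt0 mu_cball_lty. Qed.

(** Bounded functions are enough here, and they are stable under products. *)
Definition bmeas f := [/\ measurable_fun B (fun w => complex.Re (f w)),
  measurable_fun B (fun w => complex.Im (f w))
  & exists M : C, forall w, B w -> `|f w| <= M].

Lemma bmeas_integrable f : bmeas f ->
  mu.-integrable B (EFin \o (fun w => complex.Re (f w))) /\
  mu.-integrable B (EFin \o (fun w => complex.Im (f w))).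
Proof.
move=> [mr mi [M fM]].
have fM' w : B w -> `|complex.Re (f w)| <= complex.Re M /\ `|complex.Im (f w)| <= complex.Re M.
  move=> /fM h; have rM : M \is Num.real.
    by apply: ger0_real; exact: le_trans h.
  by rewrite -!lecR (RRe_real rM) !(le_trans _ h) ?Re_norm_le ?Im_norm_le.
split; apply: measurable_bounded_integrable => //.
- exact: measurable_cball.
- exact: mu_cball_lty.
- exists (complex.Re M); split; first exact: num_real.
  by move=> y My w Bw /=; rewrite (le_trans (fM' w Bw).1) // ltW.
- exact: measurable_cball.
- exact: mu_cball_lty.
- exists (complex.Re M); split; first exact: num_real.
  by move=> y My w Bw /=; rewrite (le_trans (fM' w Bw).2) // ltW.
Qed.

Lemma bmeas_cst (c : C) : bmeas (fun=> c).
Proof. by split; [exact: measurable_cst|exact: measurable_cst|exists `|c|]. Qed.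

Lemma ReD (x y : C) : complex.Re (x + y) = complex.Re x + complex.Re y.
Proof. by case: x y => [? ?] [? ?]. Qed.
Lemma ImD (x y : C) : complex.Im (x + y) = complex.Im x + complex.Im y.
Proof. by case: x y => [? ?] [? ?]. Qed.
Lemma ReM (x y : C) : complex.Re (x * y) =
  complex.Re x * complex.Re y - complex.Im x * complex.Im y.
Proof. by case: x y => [? ?] [? ?]. Qed.
Lemma ImM (x y : C) : complex.Im (x * y) =
  complex.Re x * complex.Im y + complex.Im x * complex.Re y.
Proof. by case: x y => [? ?] [? ?]. Qed.

Lemma bmeasD f g : bmeas f -> bmeas g -> bmeas (fun w => f w + g w).
Proof.
move=> [fr fi [M fM]] [gr gi [N gN]]; split.
- by under eq_fun do rewrite ReD; exact: measurable_funD.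
- by under eq_fun do rewrite ImD; exact: measurable_funD.
- exists (M + N) => w Bw; rewrite (le_trans (ler_normD _ _)) //.
  by rewrite lerD ?fM ?gN.
Qed.

Lemma bmeasM f g : bmeas f -> bmeas g -> bmeas (fun w => f w * g w).
Proof.
move=> [fr fi [M fM]] [gr gi [N gN]]; split.
- by under eq_fun do rewrite ReM; apply: measurable_funB; exact: measurable_funM.
- by under eq_fun do rewrite ImM; apply: measurable_funD; exact: measurable_funM.
- by exists (M * N) => w Bw; rewrite normrM ler_pM ?fM ?gN.
Qed.

Lemma bmeas_sum (J : Type) (r : seq J) (F : J -> T -> C) :
  (forall j, bmeas (F j)) -> bmeas (fun w => \sum_(j <- r) F j w).
Proof.
move=> h; elim: r => [|j r IH].
  rewrite (_ : (fun w => _) = fun=> 0); first exact: bmeas_cst.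
  by apply/funext => w; rewrite big_nil.
rewrite (_ : (fun w => _) = fun w => F j w + \sum_(j <- r) F j w); first exact: bmeasD.
by apply/funext => w; rewrite big_cons.
Qed.

Lemma bmeas_prod (J : Type) (r : seq J) (F : J -> T -> C) :
  (forall j, bmeas (F j)) -> bmeas (fun w => \prod_(j <- r) F j w).
Proof.
move=> h; elim: r => [|j r IH].
  rewrite (_ : (fun w => _) = fun=> 1); first exact: bmeas_cst.
  by apply/funext => w; rewrite big_nil.
rewrite (_ : (fun w => _) = fun w => F j w * \prod_(j <- r) F j w); first exact: bmeasM.
by apply/funext => w; rewrite big_cons.
Qed.

Lemma bmeasX f n : bmeas f -> bmeas (fun w => f w ^+ n).
Proof.
move=> h; elim: n => [|n IH]; first exact: bmeas_cst.
rewrite (_ : (fun w => _) = fun w => f w * f w ^+ n); first exact: bmeasM.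
by apply/funext => w; rewrite exprS.
Qed.

Lemma bmeas_conj f : bmeas f -> bmeas (fun w => (f w)^*).
Proof.
move=> [fr fi [M fM]]; split.
- rewrite (_ : (fun w => _) = fun w => complex.Re (f w)) //.
  by apply/funext => w; case: (f w).
- rewrite (_ : (fun w => _) = fun w => - complex.Im (f w)).
    exact: measurableT_comp.
  by apply/funext => w; case: (f w).
- by exists M => w Bw; rewrite norm_conjC fM.
Qed.

Lemma bmeas_real (h : T -> R) : measurable_fun [set: T] h ->
  (exists M, forall w, B w -> `|h w| <= M) -> bmeas (fun w => (h w)%:C%C).
Proof.
move=> mh [M hM]; split.
- exact: measurable_funTS.
- exact: measurable_cst.
- by exists M%:C%C => w Bw; rewrite normc_real lecR hM.
Qed.

Lemma bmeas_tnth i : bmeas (fun w => (tnth w i : R)%:C%C).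
Proof.
apply: bmeas_real; first exact: measurable_tnth.
by exists 1 => w /cball_sub_cube /(_ i).
Qed.

Lemma bmeas_cvec j : bmeas (fun w => cvec w 0 j).
Proof.
rewrite (_ : (fun w => _) = fun w : T =>
   (tnth w (lshift d j) : R)%:C%C + 'i%C * (tnth w (rshift d j) : R)%:C%C).
  apply: bmeasD; first exact: bmeas_tnth.
  by apply: bmeasM; [exact: bmeas_cst|exact: bmeas_tnth].
by apply/funext => w; rewrite mxE [LHS]complexE.
Qed.

Lemma bmeas_nsq : bmeas (fun w => (nsq w)%:C%C).
Proof.
apply: bmeas_real; first exact: measurable_nsq.
exists 1 => w /cballE w1; rewrite ger0_norm; first exact: ltW.
by rewrite sumr_ge0 // => i _; rewrite sqr_ge0.
Qed.

Definition cint f : C := Complex (\int[mu]_(w in B) complex.Re (f w))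
                                 (\int[mu]_(w in B) complex.Im (f w)).

Lemma eq_cint f g : (forall w, B w -> f w = g w) -> cint f = cint g.
Proof.
move=> fg; rewrite /cint; congr Complex; apply: eq_Rintegral => w;
by rewrite inE => /fg ->.
Qed.

Lemma cintD f g : bmeas f -> bmeas g -> cint (fun w => f w + g w) = cint f + cint g.
Proof.
move=> /bmeas_integrable[fr fi] /bmeas_integrable[gr gi]; rewrite /cint.
have mB := measurable_cball.
under eq_Rintegral do rewrite ReD.
under [X in Complex _ X]eq_Rintegral do rewrite ImD.
by rewrite !RintegralD.
Qed.

Lemma cintZ (c : C) f : bmeas f -> cint (fun w => c * f w) = c * cint f.
Proof.
move=> /bmeas_integrable[fr fi]; rewrite /cint.
have mB := measurable_cball.
have iZ (a : R) (h : T -> R) : mu.-integrable B (EFin \o h) ->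
    mu.-integrable B (EFin \o (fun w => a * h w)).
  by move=> ih; have := integrableZl mB a ih.
under eq_Rintegral do rewrite ReM.
under [X in Complex _ X]eq_Rintegral do rewrite ImM.
rewrite RintegralB ?RintegralD ?RintegralZl //; try exact: iZ.
by case: c.
Qed.

Lemma cint0 : cint (fun=> 0) = 0.
Proof. by rewrite /cint /= !Rintegral_cst ?mul0r //; exact: measurable_cball. Qed.

Lemma cint_sum (J : Type) (r : seq J) (F : J -> T -> C) : (forall j, bmeas (F j)) ->
  cint (fun w => \sum_(j <- r) F j w) = \sum_(j <- r) cint (F j).
Proof.
move=> h; elim: r => [|j r IH].
  by rewrite big_nil -[RHS]cint0; apply: eq_cint => w _; rewrite big_nil.
rewrite big_cons -IH -cintD //; last exact: bmeas_sum.
by apply: eq_cint => w _; rewrite big_cons.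
Qed.

Lemma cint_conj f : bmeas f -> cint (fun w => (f w)^*) = (cint f)^*.
Proof.
move=> /bmeas_integrable[fr fi]; rewrite /cint.
have mB := measurable_cball.
have -> : (Complex (\int[mu]_(w in B) complex.Re (f w)) (\int[mu]_(w in B) complex.Im (f w)) : C)^* = Complex (\int[mu]_(w in B) complex.Re (f w)) (- \int[mu]_(w in B) complex.Im (f w)) by [].
congr Complex; first by apply: eq_Rintegral => w _; case: (f w).
rewrite -mulN1r -RintegralZl //; apply: eq_Rintegral => w _.
by rewrite mulN1r; case: (f w).
Qed.

End ComplexIntegral.

(** * Moments of the ball *)

Section BallMonomials.
Context {R : realType} {d : nat}.
Local Notation C := (R[i]).
Local Notation Rm := (measurableTypeR R).
Local Notation T := ((d + d).-tuple Rm).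
Local Notation mu := (@lebesgueRn R (d + d)).
Local Notation B := (@cball R d).
Implicit Types (w x : T) (k m : mindex d) (j l : 'I_d) (i : 'I_(d + d)) (s : nat).
Local Open Scope classical_set_scope.

Definition mono s k m w : C :=
  mpow (cvec w) k * (mpow (cvec w) m)^* * (1 - (nsq w)%:C%C) ^+ s.

Lemma bmeas_mpow k : bmeas (fun w => mpow (cvec w) k).
Proof. by apply: bmeas_prod => j; apply: bmeasX; exact: bmeas_cvec. Qed.

Lemma bmeas_mono s k m : bmeas (mono s k m).
Proof.
apply: bmeasM; first apply: bmeasM.
- exact: bmeas_mpow.
- by apply: bmeas_conj; exact: bmeas_mpow.
apply: bmeasX; apply: bmeasD; first exact: bmeas_cst.
rewrite (_ : (fun w => _) = fun w : T => -1 * (nsq w)%:C%C :> C).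
  by apply: bmeasM; [exact: bmeas_cst|exact: bmeas_nsq].
by apply/funext => w; rewrite mulN1r.
Qed.

(** The derivative of [mono s.+1 k m] along the real coordinate [i], which
    moves the j-th complex coordinate in the direction [al], so that [al]
    is 1 or 'i. *)
Definition dmono s k m j (al : C) i w : C :=
  (k j)%:R * al * mono s.+1 (mdec k j) m w + (m j)%:R * al^* * mono s.+1 k (mdec m j) w
  - 2 * s.+1%:R * (tnth w i : R)%:C%C * mono s k m w.

Lemma bmeas_dmono s k m j al i : bmeas (dmono s k m j al i).
Proof.
apply: bmeasD; first apply: bmeasD.
- by apply: bmeasM; [exact: bmeas_cst|exact: bmeas_mono].
- by apply: bmeasM; [exact: bmeas_cst|exact: bmeas_mono].
rewrite (_ : (fun w => _) = fun w : T => (- (2 * s.+1%:R)) * ((tnth w i : R)%:C%C * mono s k m w)).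
  apply: bmeasM; first exact: bmeas_cst.
  by apply: bmeasM; [exact: bmeas_tnth|exact: bmeas_mono].
by apply/funext => w; rewrite mulNr !mulrA.
Qed.

(** To be used with the real and the imaginary part for [u]: it turns a
    complex polynomial in a real variable into a real one. *)
Definition part_poly (u : C -> R) (Q : {poly C}) : {poly R} := \poly_(l < size Q) u Q`_l.

Section Part.
Variable u : C -> R.
Hypotheses (uD : forall x y : C, u (x + y) = u x + u y) (uZ : forall (x : C) (r : R), u (x * r%:C%C) = u x * r).

Let u0 : u 0 = 0.
Proof. by have := uZ 0 0; rewrite mul0r mulr0. Qed.

Lemma part_poly_coef Q n : (part_poly u Q)`_n = u Q`_n.
Proof. by rewrite coef_poly; case: ltnP => // h; rewrite nth_default. Qed.

Lemma part_poly_horner Q (t : R) : (part_poly u Q).[t] = u Q.[t%:C%C].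
Proof.
rewrite horner_poly horner_coef (big_morph u uD u0); apply: eq_bigr => n _.
by rewrite -uZ rmorphXn.
Qed.

Lemma part_poly_deriv Q : deriv (part_poly u Q) = part_poly u (deriv Q).
Proof.
apply/polyP => n; rewrite coef_deriv !part_poly_coef coef_deriv.
move: (n.+1) (Q`_n.+1) => p x; elim: p => [|p IH]; first by rewrite !mulr0n.
by rewrite !mulrS uD IH.
Qed.

Hypotheses (uM : forall (f : T -> C), bmeas f -> measurable_fun B (fun w => u (f w)))
  (ule : forall x : C, `|u x|%:C%C <= `|x|).

(** Along the line through a point in the direction of the i-th coordinate,
    [dmono] is the derivative of a polynomial divisible by [A - X^2],
    where the line meets the ball in [t ^+ 2 < A]. *)
Lemma integral_dmono_part s k m j al i (be : T -> C) :
  (forall w t l, cvec (tset w i t) 0 l = if l == j then al * t%:C%C + be w else cvec w 0 l) ->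
  \int[mu]_(w in B) u (dmono s k m j al i w) = 0.
Proof.
move=> hz; have hb := bmeas_dmono s k m j al i.
rewrite /Rintegral integral_mkcond.
pose F w := if nsq w < 1 then u (dmono s k m j al i w) else 0.
have FE : F = (fun w => u (dmono s k m j al i w)) \_ B.
  apply/funext => w; rewrite patchE /F; case: ifPn => h.
    by rewrite ifT // inE; apply/cballE.
  by rewrite ifF //; apply/negbTE; apply: contra h; rewrite inE => /cballE.
rewrite (_ : (_ \_ B) = EFin \o F); last first.
  by rewrite FE; apply/funext => w; rewrite /= !patchE; case: ifP.
suff -> : (\int[mu]_x (EFin \o F) x = 0)%E by [].
apply: (@integral_coord0 _ _ F i).
  split.
  - by rewrite FE; apply/(measurable_restrictT _ _).1; [exact: measurable_cball|exact: uM].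
  - have [_ _ [M hM]] := hb; exists `|complex.Re M| => w; rewrite /F; case: ifPn => h.
      have Bw : B w by apply/cballE.
      have rM : M \is Num.real by apply: ger0_real; exact: le_trans (hM w Bw).
      rewrite -lecR (le_trans (ule _)) // (le_trans (hM w Bw)) //.
      by rewrite -[leLHS](RRe_real rM) lecR ler_norm.
    by rewrite normr0.
  - move=> w hw; rewrite /F ifF //; apply/negbTE/negP => h; apply: hw.
    by apply: cball_sub_cube; apply/cballE.
move=> w.
(* [A] collects the coordinates that stay fixed; it is kept abstract so that it
   does not interfere with the computation of the derivative. *)
have [A nsqE] : exists A : R, forall t, nsq (tset w i t) = 1 - (A - t ^+ 2).
  exists (1 - \sum_(l < d + d | l != i) tnth w l ^+ 2) => t.
  rewrite /nsq (bigD1 i) //= tnth_tset eqxx opprB addrCA subKr; congr (_ + _).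
  by apply: eq_bigr => l li; rewrite tnth_tset (negPf li).
pose c p : C := \prod_(l | l != j) cvec w 0 l ^+ (p : mindex d) l.
have powE t p : mpow (cvec (tset w i t)) p = c p * (al * t%:C%C + be w) ^+ p j.
  rewrite /mpow (bigD1 j) //= hz eqxx mulrC; congr (_ * _).
  by apply: eq_bigr => l lj; rewrite hz (negPf lj).
have cdec p : c (mdec p j) = c p.
  by apply: eq_bigr => l lj; rewrite ffunE (negPf lj) subn0.
pose P1 : {poly C} := al *: 'X + (be w)%:P.
pose P2 : {poly C} := al^* *: 'X + (be w)^*%:P.
pose P3 : {poly C} := (A%:C%C)%:P - 'X^2.
pose Q : {poly C} := (c k * (c m)^*)%:P * (P1 ^+ k j * P2 ^+ m j * P3 ^+ s.+1).
(* On the real line the factor [P2] takes the conjugate values of [P1]. *)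
have conjt (t : R) : (t%:C%C : C)^* = t%:C%C by apply: conjc_real.
have QE t : nsq (tset w i t) < 1 -> dmono s k m j al i (tset w i t) = (deriv Q).[t%:C%C].
  move=> _; rewrite /dmono /mono nsqE !powE !cdec.
  have -> : 1 - (1 - (A - t ^+ 2))%:C%C = A%:C%C - t%:C%C ^+ 2 :> C.
    by rewrite !rmorphB rmorph1 rmorphXn /= subKr.
  rewrite tnth_tset eqxx !rmorphM !rmorphXn !rmorphD !rmorphM /= !conjt.
  rewrite /Q !(derivM, derivC, derivD, derivN, deriv_exp, derivZ, derivX, derivXn) !hornerE /=.
  rewrite !(hornerMn, hornerE) /= !ffunE eqxx !subn1.
  ring.
have key := @integral_deriv0 R (part_poly u Q) A _.
rewrite -[RHS]key; last first.
  move=> A0; rewrite !part_poly_horner; congr u.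
  have Q0 (t : R) : t ^+ 2 = A -> Q.[t%:C%C] = 0.
    move=> tA; rewrite /Q /P3 !hornerE /= -tA rmorphXn /= subrr exprS mul0r !mulr0.
    by [].
  by rewrite !Q0 ?sqrrN ?sqr_sqrtr // ltW.
apply: eq_integral => t _; rewrite /F nsqE gtrDl oppr_lt0 subr_gt0; case: ifPn => h //.
rewrite part_poly_deriv part_poly_horner QE // nsqE gtrDl oppr_lt0 subr_gt0 //.
Qed.
End Part.

End BallMonomials.

Section BallMoments.
Context {R : realType} {d : nat}.
Local Notation C := (R[i]).
Local Notation Rm := (measurableTypeR R).
Local Notation T := ((d + d).-tuple Rm).
Local Notation mu := (@lebesgueRn R (d + d)).
Local Notation B := (@cball R d).
Implicit Types (w x : T) (k m : mindex d) (j l : 'I_d) (i : 'I_(d + d)) (s : nat).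

Lemma cint_dmono s k m j al i (be : T -> C) :
  (forall w t l, cvec (tset w i t) 0 l = if l == j then al * t%:C%C + be w else cvec w 0 l) ->
  cint (dmono s k m j al i) = 0.
Proof.
move=> hz; rewrite /cint.
rewrite (@integral_dmono_part _ _ (@complex.Re R)  _ _ _ _ s k m j al i be hz).
- rewrite (@integral_dmono_part _ _ (@complex.Im R)  _ _ _ _ s k m j al i be hz) //.
  + exact: ImD.
  + by move=> x r; rewrite ImM /= mulr0 add0r.
  + by move=> f [].
  + exact: Im_norm_le.
- exact: ReD.
- by move=> x r; rewrite ReM /= mulr0 subr0.
- by move=> f [].
- exact: Re_norm_le.
Qed.

Lemma cvecE w j : cvec w 0 j = (tnth w (lshift d j) : R)%:C%C + 'i%C * (tnth w (rshift d j) : R)%:C%C.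
Proof. by rewrite mxE [LHS]complexE. Qed.

Lemma cint_dmono_x s k m j : cint (dmono s k m j (1 : C) (@lshift d d j)) = 0.
Proof.
apply: (@cint_dmono _ _ _ _ _ _ (fun w => 'i%C * (tnth w (rshift d j) : R)%:C%C)) => w t l.
rewrite !cvecE !tnth_tset eq_lshift eq_rlshift mul1r.
by case: eqP => // ->.
Qed.

Lemma cint_dmono_y s k m j : cint (dmono s k m j ('i%C : C) (@rshift d d j)) = 0.
Proof.
apply: (@cint_dmono _ _ _ _ _ _ (fun w => (tnth w (lshift d j) : R)%:C%C)) => w t l.
rewrite !cvecE !tnth_tset eq_rshift eq_lrshift.
by case: eqP => [->|//]; rewrite addrC.
Qed.

Lemma vol_complex_neq0 : (@vol R d)%:C%C != 0 :> C.
Proof. by rewrite fmorph_eq0 gt_eqF // vol_gt0. Qed.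

Definition moment s k m : C := cint (@mono R d s k m).

(** Integration by parts on the ball for twice the operator d/dzbar_j, the sum
    of the derivative along the real part and 'i times the derivative
    along the imaginary part of [z_j]: it kills [z_j], sends [zbar_j] to 2
    and [1 - |z|^2] to [- 2 z_j]. *)
Lemma moment_step s k m j :
  s.+1%:R * moment s (minc k j) m = (m j)%:R * moment s.+1 k (mdec m j).
Proof.
have hx := bmeas_dmono s k m j (1 : C) (@lshift d d j).
have hy := bmeas_dmono s k m j ('i%C : C) (@rshift d d j).
have bm s' k' m' := @bmeas_mono R d s' k' m'.
have bZ (c : C) f : bmeas f -> bmeas (fun w : T => c * f w).
  by move=> hf; apply: bmeasM => //; exact: bmeas_cst.
have e : cint (fun w : T => dmono s k m j 1 (lshift d j) w + 'i%C * dmono s k m j 'i%C (rshift d j) w) = 0.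
  rewrite cintD // ?cintZ ?cint_dmono_x ?cint_dmono_y ?mulr0 ?addr0 //.
  exact: bZ.
have E w : dmono s k m j 1 (lshift d j) w + 'i%C * dmono s k m j 'i%C (rshift d j) w
  = 2 * (m j)%:R * mono s.+1 k (mdec m j) w + (- 2 * s.+1%:R) * mono s (minc k j) m w.
  rewrite /dmono.
  have -> : mono s (minc k j) m w = cvec w 0 j * mono s k m w.
    by rewrite /mono mpow_minc !mulrA.
  rewrite cvecE.
  have ii : 'i%C * 'i%C = -1 :> C by rewrite -expr2 sqr_i.
  have ic : ('i%C : C)^* = - 'i%C by apply/eqP; rewrite eq_complex /= oppr0 !eqxx.
  rewrite rmorph1 ic.
  move: (mono s.+1 (mdec k j) m w) (mono s.+1 k (mdec m j) w) (mono s k m w) => M1 M2 M3.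
  move: ('i%C : C) ii => I ii.
  (* The terms that lower [k] cancel because the square of 'i is -1. *)
  transitivity ((k j)%:R * M1 * (1 + I * I) + (m j)%:R * M2 * (1 - I * I)
    - 2 * s.+1%:R * ((tnth w (lshift d j) : R)%:C%C + I * (tnth w (rshift d j) : R)%:C%C) * M3).
    by ring.
  by rewrite ii; ring.
have := e; under eq_fun do rewrite E.
rewrite cintD ?cintZ //; [|exact: bZ|exact: bZ].
rewrite mulNr mulNr => /eqP; rewrite subr_eq0 -!mulrA => /eqP/mulfI h.
by apply/esym/h; rewrite pnatr_eq0.
Qed.

Lemma moment_conj s k m : moment s m k = (moment s k m)^*.
Proof.
rewrite /moment -cint_conj; last exact: bmeas_mono.
apply: eq_cint => w _; rewrite /mono !rmorphM rmorphXn rmorphB rmorph1 /= conjCK.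
rewrite (_ : ((nsq w)%:C%C)^* = (nsq w)%:C%C :> C); last exact: conjc_real.
by rewrite [mpow _ m * _]mulrC.
Qed.

Lemma moment_step_conj s k m j :
  s.+1%:R * moment s k (minc m j) = (k j)%:R * moment s.+1 (mdec k j) m.
Proof.
have := congr1 (@Num.conj C) (moment_step s m k j).
by rewrite !rmorphM !rmorph_nat /= -!moment_conj.
Qed.

Lemma mindex_case m : m = [ffun=> 0%N] \/ exists m' j, m = minc m' j.
Proof.
have [/forallP m0|] := boolP [forall j, m j == 0%N].
  by left; apply/ffunP => j; rewrite ffunE; exact/eqP.
rewrite negb_forall => /existsP[j mj]; right; exists (mdec m j), j.
by rewrite mdecK // lt0n.
Qed.

Lemma succ_neq0 s : s.+1%:R != 0 :> C.
Proof. by rewrite pnatr_eq0. Qed.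

(** By [moment_step] and its conjugate, both exponents may be lowered together
    until one of them is 0 and the other is not. *)
Lemma moment_offdiag s k m : k != m -> moment s k m = 0.
Proof.
move: {2}(mabs k) (erefl (mabs k)) => N; elim: N s k m => [|N IH] s k m kN km.
  have k0 := mabs0_eq kN; have [m0|[m' [j mE]]] := mindex_case m.
    by rewrite k0 m0 eqxx in km.
  apply: (mulfI (succ_neq0 s)); rewrite mE moment_step_conj k0 ffunE.
  by rewrite mul0r mulr0.
have [k0|[k' [j kE]]] := mindex_case k.
  by move: kN; rewrite k0 /mabs big1 // => l _; rewrite ffunE.
apply: (mulfI (succ_neq0 s)); rewrite mulr0 kE moment_step.
have [mj|mj] := posnP (m j); first by rewrite mj mul0r.
rewrite IH ?mulr0 //.
  by apply/eqP; rewrite -eqSS -(mabs_minc _ j) -kE kN.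
by apply: contra_neq km => k'E; rewrite kE k'E mdecK.
Qed.

(** Expanding one factor [1 - |z|^2] gives moments with exponents [s] of 1 and
    of the [z_j zbar_j], which [moment_step] brings back to exponent
    [s.+1]. *)
Lemma moment0_rec s :
  (s + d).+1%:R * moment s.+1 [ffun=> 0%N] [ffun=> 0%N] = s.+1%:R * moment s [ffun=> 0%N] [ffun=> 0%N].
Proof.
set z0 : mindex d := [ffun=> 0%N].
have e j : s.+1%:R * moment s (minc z0 j) (minc z0 j) = moment s.+1 z0 z0.
  by rewrite moment_step mincK !ffunE eqxx add0n mul1r.
have E w : mono s.+1 z0 z0 w = mono s z0 z0 w + \sum_j (-1) * mono s (minc z0 j) (minc z0 j) w.
  rewrite /mono mpow0 rmorph1 !mul1r exprSr mulrBr mulr1; congr (_ + _).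
  rewrite -mulr_sumr mulN1r -enorm_cvec sqrtCK mulr_sumr; congr (- _).
  apply: eq_bigr => j _; rewrite mpow_minc mpow0 mulr1 normCK mulrC.
  by [].
have bm s' k' m' := @bmeas_mono R d s' k' m'.
have bZ (c : C) f : bmeas f -> bmeas (fun w : T => c * f w).
  by move=> hf; apply: bmeasM => //; exact: bmeas_cst.
have M : moment s.+1 z0 z0 = moment s z0 z0 - \sum_j moment s (minc z0 j) (minc z0 j).
  have -> : moment s.+1 z0 z0 = cint (fun w : T => mono s z0 z0 w
      + \sum_j (-1) * mono s (minc z0 j) (minc z0 j) w).
    by apply: eq_cint => w _; exact: E.
  rewrite cintD //; last by apply: bmeas_sum => j; exact: bZ.
  rewrite cint_sum; last by move=> j; exact: bZ.
  congr (_ + _); rewrite -sumrN; apply: eq_bigr => j _.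
  by rewrite cintZ // mulN1r.
have : s.+1%:R * moment s.+1 z0 z0 = s.+1%:R * moment s z0 z0 - d%:R * moment s.+1 z0 z0.
  rewrite {1}M mulrBr; congr (_ - _); rewrite mulr_sumr.
  under eq_bigr do rewrite e.
  by rewrite sumr_const card_ord mulr_natl.
move/eqP; rewrite eq_sym subr_eq -mulrDl -natrD => /eqP ->.
by rewrite addSn.
Qed.

Lemma moment0 s : moment s [ffun=> 0%N] [ffun=> 0%N]
  = (s`! * d`!)%:R / (s + d)`!%:R * (@vol R d)%:C%C.
Proof.
elim: s => [|s IH].
  rewrite fact0 mul1n add0n divff ?mul1r; last by rewrite pnatr_eq0 -lt0n fact_gt0.
  rewrite /moment /cint /vol.
  have E w : mono 0 [ffun=> 0%N] [ffun=> 0%N] w = 1 :> C by rewrite /mono !mpow0 rmorph1 expr0 !mulr1.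
  under eq_Rintegral do rewrite E.
  under [X in Complex _ X]eq_Rintegral do rewrite E.
  have mB := @measurable_cball R d.
  by rewrite /= !Rintegral_cst // mul1r mul0r.
apply: (mulfI (succ_neq0 (s + d))); rewrite moment0_rec IH.
have f0 : (s + d)`!%:R != 0 :> C by rewrite pnatr_eq0 -lt0n fact_gt0.
have A0 := succ_neq0 (s + d); rewrite addSn !factS !natrM.
move: f0 A0; move: ((s + d)`!%:R : C) ((s + d).+1%:R : C) => F A f0 A0.
by field; rewrite f0 A0.
Qed.

Lemma moment_diag s m : moment s m m
  = (mfact m * s`! * d`!)%:R / (s + mabs m + d)`!%:R * (@vol R d)%:C%C.
Proof.
move: {2}(mabs m) (erefl (mabs m)) => N; elim: N s m => [|N IH] s m mN.
  by rewrite (mabs0_eq mN) moment0 /mfact /mabs !big1 ?mul1n ?addn0 // => j _; rewrite ffunE.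
have [m0|[m' [j mE]]] := mindex_case m.
  by move: mN; rewrite m0 /mabs big1 // => l _; rewrite ffunE.
have mN' : mabs m' = N by apply/eqP; rewrite -eqSS -(mabs_minc _ j) -mE mN.
apply: (mulfI (succ_neq0 s)); rewrite {1}mE moment_step mE mincK IH //.
rewrite mabs_minc mfact_minc ffunE eqxx addn1 addSnnS factS !natrM.
by field; rewrite pnatr_eq0 -lt0n fact_gt0.
Qed.

(** In the normalized weighted measure on the ball the monomials have the
    norms of the representation space, so that this space is the weighted
    Bergman space. *)
Lemma moment_nb s m :
  poch s.+1%:R d / d`!%:R * (moment s m m / (@vol R d)%:C%C) * nb_coef (s + d).+1 m = 1.
Proof.
have pochE p n : poch (p.+1%:R : C) n = (p + n)`!%:R / p`!%:R.
  elim: n => [|n IHn].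
    by rewrite /poch big_ord0 addn0 divff // pnatr_eq0 -lt0n fact_gt0.
  by rewrite poch_last IHn addnS factS natrM -natrD addSn mulrAC; congr (_ / _); exact: mulrC.
have v0 := vol_complex_neq0.
have f0 n : n`!%:R != 0 :> C by rewrite pnatr_eq0 -lt0n fact_gt0.
rewrite moment_diag nb_coefE !pochE [(s + mabs m + d)%N]addnAC !natrM.
by field; rewrite !f0 v0 mfact_neq0.
Qed.

End BallMoments.

(** * Integral representation *)

Section TermwiseIntegration.
Context {R : realType} {d : nat}.
Local Notation C := (R[i]).
Local Notation Rm := (measurableTypeR R).
Local Notation T := ((d + d).-tuple Rm).
Local Notation mu := (@lebesgueRn R (d + d)).
Local Notation B := (@cball R d).
Implicit Types (w : T) (f : T -> C).
Local Open Scope classical_set_scope.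

Lemma exhausting_fsets (I : countType) : exists A_ : nat -> {fset I},
  forall E : {fset I}, exists N, forall n, (N <= n)%N -> (E `<=` A_ n)%fset.
Proof.
exists (fun n => [fset i in pmap (@choice.unpickle I) (iota 0 n)]%fset) => E.
exists (\max_(i <- E) choice.pickle i).+1 => n nE; apply/fsubsetP => i iE.
rewrite !inE mem_pmap; apply/mapP; exists (choice.pickle i); last by rewrite choice.pickleK.
rewrite mem_iota /= add0n; apply: leq_trans nE.
by rewrite ltnS; exact: (@leq_bigmax_seq _ (enum_fset E) xpredT (@choice.pickle I)).
Qed.

Lemma Rintegral_limit (h_ : nat -> T -> R) (h : T -> R) (M c : R) :
  (forall n, measurable_fun B (h_ n)) ->
  (forall n w, B w -> `|h_ n w| <= M) ->
  (forall w, B w -> h_ ^~ w @ \oo --> h w) ->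
  (exists N, forall n, (N <= n)%N -> \int[mu]_(w in B) h_ n w = c) ->
  measurable_fun B h /\ \int[mu]_(w in B) h w = c.
Proof.
move=> mh hM hh [N hN]; have mB := @measurable_cball R d.
have mh' : measurable_fun B h by apply: measurable_fun_cvg hh.
split => //.
have iM : mu.-integrable B (EFin \o cst M).
  apply: measurable_bounded_integrable => //; first exact: mu_cball_lty.
  by exists `|M|; split; [exact: num_real|move=> y My w _; exact: ltW].
have := @dominated_convergence _ T R mu B mB (fun n w => (h_ n w)%:E) (EFin \o h) (EFin \o cst M).
case.
- by move=> n; apply/measurable_EFinP.
- exact/measurable_EFinP.
- by apply: aeW => w Bw; apply/cvg_EFin; [exact: nearW|exact: hh].
- exact: iM.
- by apply: aeW => w n Bw /=; rewrite lee_fin hM.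
move=> ih _ hc.
have fin : (\int[mu]_(w in B) (h w)%:E \is a fin_num)%E.
  exact: integrable_fin_num.
rewrite /Rintegral; apply: (@EFin_inj R); rewrite fineK //.
have /cvg_lim <- // := hc; apply/cvg_lim => //.
apply: cvg_near_cst; exists N => // n /= Nn.
rewrite -(hN n Nn) /Rintegral fineK //; apply: integrable_fin_num => //.
apply: measurable_bounded_integrable => //; first exact: mu_cball_lty.
by exists M; split; [exact: num_real|move=> y My w Bw /=; exact: le_trans (hM n w Bw) (ltW My)].
Qed.

(** Dominated convergence along an exhausting sequence of finite sets of
    indices, in the case where only one term has a nonzero integral, so
    that these integrals are eventually constant. *)
Lemma cint_has_sum (I : countType) (F : I -> T -> C) f (M : C) k0 :
  (forall k, bmeas (F k)) -> (forall w, B w -> bsum (F^~ w) M) ->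
  (forall w, B w -> has_sum (F^~ w) (f w)) ->
  (forall k, k != k0 -> cint (F k) = 0) ->
  bmeas f /\ cint f = cint (F k0).
Proof.
move=> mF FM Ff F0; have [A_ hA] := exhausting_fsets I.
pose h_ n w := \sum_(k <- A_ n) F k w.
have mh n : bmeas (h_ n) by apply: bmeas_sum.
have hM n w : B w -> `|h_ n w| <= M.
  by move=> Bw; rewrite (le_trans (ler_norm_sum _ _ _)) // FM.
have hc : exists N, forall n, (N <= n)%N -> cint (h_ n) = cint (F k0).
  have [N hN] := hA [fset k0]%fset; exists N => n /hN; rewrite fsub1set => k0A.
  rewrite cint_sum // (big_fsetD1 _ k0A) /= big_seq big1 ?addr0 // => k.
  by rewrite !inE => /andP[/F0].
have conv w : B w -> forall e : C, 0 < e -> exists N, forall n, (N <= n)%N -> `|f w - h_ n w| < e.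
  move=> Bw e e0; have /has_sumP/(_ e e0)[E hE] := Ff w Bw.
  by have [N hN] := hA E; exists N => n /hN; exact: hE.
have part (u : C -> R) : (forall x : C, (`|u x|%:C)%C <= `|x|) ->
    (forall x y : C, u (x - y) = u x - u y) ->
    (forall n, measurable_fun B (fun w => u (h_ n w))) ->
    (exists N, forall n, (N <= n)%N -> \int[mu]_(w in B) u (h_ n w)
       = \int[mu]_(w in B) u (F k0 w)) ->
    measurable_fun B (fun w => u (f w)) /\
    \int[mu]_(w in B) u (f w) = \int[mu]_(w in B) u (F k0 w).
  move=> ule uB mu_ hN.
  have M0 w : B w -> M \is Num.real.
    by move=> Bw; apply: ger0_real; exact: bsum_ge0 (FM w Bw).
  apply: (@Rintegral_limit (fun n w => u (h_ n w)) (fun w => u (f w)) (complex.Re M)) => //.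
    by move=> n w Bw; rewrite -lecR (le_trans (ule _)) // (RRe_real (M0 w Bw)) hM.
  move=> w Bw; apply/cvgrPdist_lt => e e0.
  have e0' : 0 < e%:C%C :> C by rewrite -[0]/((0 : R)%:C%C) ltcR.
  have [N hN'] := conv w Bw _ e0'; exists N => // n /= /hN' h.
  by rewrite -uB -ltcR (le_lt_trans (ule _)).
have [N hN] := hc.
have [rf rc] : measurable_fun B (fun w => complex.Re (f w)) /\
    \int[mu]_(w in B) complex.Re (f w) = \int[mu]_(w in B) complex.Re (F k0 w).
  apply: part; [exact: Re_norm_le|by move=> x y; exact: raddfB|by move=> n; case: (mh n)|].
  by exists N => n /hN [].
have [jf jc] : measurable_fun B (fun w => complex.Im (f w)) /\
    \int[mu]_(w in B) complex.Im (f w) = \int[mu]_(w in B) complex.Im (F k0 w).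
  apply: part; [exact: Im_norm_le|by move=> x y; exact: raddfB|by move=> n; case: (mh n)|].
  by exists N => n /hN [].
split; last by rewrite /cint rc jc.
by split => //; exists M => w Bw; exact: bsum_has_sum_le (FM w Bw) (Ff w Bw).
Qed.

End TermwiseIntegration.

Section IntegralRepresentation.
Context {R : realType} {d : nat}.
Local Notation C := (R[i]).
Local Notation Rm := (measurableTypeR R).
Local Notation T := ((d + d).-tuple Rm).
Local Notation B := (@cball R d).
Implicit Types (w : T) (z : 'rV[C]_d) (m n k : mindex d) (j : 'I_d) (g : 'M[C]_(1 + d)) (sg s : nat).

(** On the closed ball the denominator is bounded away from 0 with a uniform
    gap, by [2 |a| |c_j| |z_j| <= |c_j|^2 + |a|^2 |z_j|^2]. *)
Lemma SU1_majv0 g z : SU1 g -> \sum_j `|z 0 j| ^+ 2 <= 1 ->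
  (2 * `|ablk g|)^-1 <= majv g z 0 (lshift d 0).
Proof.
move=> gSU z1; have a0 : 0 < `|ablk g| by rewrite normr_gt0 SU1_a_neq0.
have aa0 : 0 < 2 * `|ablk g| by rewrite mulr_gt0.
rewrite -(ler_pM2l aa0) mulfV ?gt_eqF // majv0 -ablkE mulrBr.
rewrite lerBrDr -lerBrDl /lmaj mulr_sumr.
apply: (@le_trans _ _ (\sum_j (`|cblk g 0 j| ^+ 2 + `|ablk g| ^+ 2 * `|z 0 j| ^+ 2))).
  apply: ler_sum => j _; rewrite [lowcol _ _ _ _]mxE -cblkE -subr_ge0.
  have -> : `|cblk g 0 j| ^+ 2 + `|ablk g| ^+ 2 * `|z 0 j| ^+ 2
    - 2 * `|ablk g| * (`|cblk g 0 j| * `|z 0 j|) = (`|cblk g 0 j| - `|ablk g| * `|z 0 j|) ^+ 2.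
    by ring.
  by rewrite real_exprn_even_ge0 // rpredB // ger0_real // mulr_ge0.
rewrite big_split /= -mulr_sumr (SU1_sum_c gSU).
have -> : 2 * `|ablk g| * `|ablk g| - 1 = (`|ablk g| ^+ 2 - 1) + `|ablk g| ^+ 2 * 1 by ring.
by rewrite lerD2l ler_wpM2l // exprn_ge0.
Qed.

Lemma SU1_conv_dom g z : SU1 g -> \sum_j `|z 0 j| ^+ 2 <= 1 -> conv_dom g z.
Proof.
move=> gSU z1; rewrite /conv_dom -subr_gt0 -majv0.
apply: lt_le_trans (SU1_majv0 gSU z1); rewrite invr_gt0 mulr_gt0 //.
by rewrite normr_gt0 SU1_a_neq0.
Qed.

Lemma SU1_matmaj_bounded sg g n : SU1 g -> exists K : C, forall z,
  \sum_j `|z 0 j| ^+ 2 <= 1 -> matmaj sg g n z <= K.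
Proof.
move=> gSU; have a0 : 0 < `|ablk g| by rewrite normr_gt0 SU1_a_neq0.
exists ((2 * `|ablk g|) ^+ (sg + mabs n) * \prod_i (`|g (lshift d 0) (rshift 1 i)|
   + 1 * \sum_j `|lowcol g (rshift 1 i) 0 j|) ^+ n i) => z z1.
have zj j : `|z 0 j| <= 1.
  rewrite -(@ler_pXn2r _ 2) ?nnegrE // expr1n (le_trans _ z1) //.
  by rewrite (bigD1 j) //= lerDl sumr_ge0 // => l _; rewrite exprn_ge0.
have dz := SU1_conv_dom gSU z1; have m0 := majv0_gt0 dz.
rewrite matmajE /homF ler_pM //.
- by rewrite invr_ge0 exprn_ge0 // ltW.
- by rewrite prodr_ge0 // => i _; rewrite exprn_ge0 // majvS_ge0.
- rewrite -exprVn lerXn2r ?nnegrE ?invr_ge0 ?(ltW m0) ?mulr_ge0 //.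
  rewrite -[leRHS]invrK lef_pV2 ?posrE ?invr_gt0 ?mulr_gt0 //.
  exact: SU1_majv0.
apply: ler_prod => i _; rewrite exprn_ge0 ?majvS_ge0 //=.
rewrite lerXn2r ?nnegrE ?majvS_ge0 //.
  by rewrite addr_ge0 // mul1r sumr_ge0.
by rewrite majvS lerD2l lmaj_le.
Qed.

(** The integrand is, up to a constant, the image of [z^n] under [g] paired
    with [z^m].  Its expansion in powers of [z] is dominated uniformly on
    the ball, and by orthogonality of the monomials only the term of index
    [m] survives. *)
Theorem integral_representation s g m n : SU1 g -> nondeg g ->
  let sg := (s + d).+1 in
  exists2 I : C,
    has_ball_integral (fun z : 'rV[C]_d =>
      (1 + \sum_i ptvec g 0 i * z 0 i) ^- (sg + mabs n)
      * (\prod_i (1 + \sum_j Umx g i j * ptvec g 0 j * z 0 j) ^+ n i)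
      * mpow (vconj z) m * (1 - enorm z ^+ 2) ^+ s) I
  & (-1) ^+ mabs m * mpow (ptvec g) m * meixner (Umx g) sg%:R m (mvec n)
    = poch s.+1%:R d / (d`!)%:R * I.
Proof.
move=> gSU gnd sg; set f := (X in has_ball_integral X).
have a0 := SU1_a_neq0 gSU.
have p0 : mpow (pvec g) n != 0 by apply: mpow_neq0 => i; exact: pvec_neq0.
(* The constant relating the integrand to [homF], see [homF_nondeg]. *)
pose C0 : C := ablk g ^+ sg / mpow (pvec g) n.
have as0 : ablk g ^+ sg != 0 by rewrite expf_neq0.
have [K hK] := SU1_matmaj_bounded sg n gSU.
pose F k w : C := C0 * matcoef sg g n k * mono s k m w.
have z1 w : B w -> \sum_j `|cvec w 0 j| ^+ 2 <= 1.
  move=> /cballE w1; rewrite -[leLHS]sqrtCK -/(enorm (cvec w)) enorm_cvec.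
  by rewrite -(rmorph1 (real_complex R)) lecR ltW.
have monoE k w : mono s k m w = mpow (cvec w) k * ((mpow (cvec w) m)^* * (1 - (nsq w)%:C%C) ^+ s).
  by rewrite /mono mulrA.
have wt1 w : B w -> `|(mpow (cvec w) m)^* * (1 - (nsq w)%:C%C) ^+ s| <= 1.
  move=> Bw; rewrite normrM norm_conjC normr_mpow mulr_ile1 ?normr_ge0 //.
  - by rewrite prodr_ge0 // => i _; rewrite exprn_ge0.
  - rewrite prodr_ile1 // => i _; rewrite exprn_ge0 //= exprn_ile1 //.
    rewrite -(@ler_pXn2r _ 2) ?nnegrE // expr1n (le_trans _ (z1 w Bw)) //.
    by rewrite (bigD1 i) //= lerDl sumr_ge0 // => l _; rewrite exprn_ge0.
  - rewrite normrX exprn_ile1 // -(rmorph1 (real_complex R)) -rmorphB normc_real lecR.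
    move: Bw => /cballE w1; have n0 : 0 <= nsq w by rewrite sumr_ge0 // => i _; rewrite sqr_ge0.
    by rewrite ger0_norm ?subr_ge0 ?(ltW w1) // gerBl.
have [mf If] : bmeas (fun w => f (cvec w)) /\ cint (fun w => f (cvec w)) = cint (F m).
  apply: (@cint_has_sum R d {ffun 'I_d -> nat} F _ (`|C0| * K)).
  - by move=> k; apply: bmeasM; [exact: bmeas_cst|exact: bmeas_mono].
  - move=> w Bw; have dz := SU1_conv_dom gSU (z1 w Bw).
    have [hb _] := asum_matcoef sg n dz.
    have hb' := bsumZ C0 (bsumW (hK _ (z1 w Bw)) hb).
    apply: (bsum_le _ hb') => k.
    rewrite /F monoE /pterm mulrA -(mulrA C0) normrM ler_piMr //.
    exact: wt1.
  - move=> w Bw; have dz := SU1_conv_dom gSU (z1 w Bw).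
    have [_ hs] := asumZ (C0 * ((mpow (cvec w) m)^* * (1 - (nsq w)%:C%C) ^+ s)) (asum_matcoef sg n dz).
    have -> : f (cvec w) = C0 * ((mpow (cvec w) m)^* * (1 - (nsq w)%:C%C) ^+ s)
        * homF sg n (affine (cvec w) *m g).
      rewrite homF_nondeg // /f enorm_cvec mpow_conj /C0.
      move: (_ ^- (sg + mabs n)) (\prod_i _) (mpow (cvec w) m)^* ((1 - _) ^+ s) => X1 X2 X3 X4.
      by field; rewrite as0 p0.
    apply: (eq_has_sum _ hs) => k; rewrite /F monoE /pterm.
    by ring.
  - move=> k km; rewrite cintZ; last exact: bmeas_mono.
    by rewrite -/(moment s k m) moment_offdiag // mulr0.
exists (cint (fun w => f (cvec w)) / (@vol R d)%:C%C).
  have [ir ii] := bmeas_integrable mf; split => //.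
  rewrite /ball_mean /cint -/(@vol R d) -fmorphV.
  by apply/eqP; rewrite eq_complex ReM ImM /= !mulr0 subr0 add0r !eqxx.
rewrite If cintZ; last exact: bmeas_mono.
rewrite -/(moment s m m) (matcoef_meixner m n _ gnd) //.
have hn := moment_nb s m; rewrite -/sg in hn.
rewrite -[LHS]mulr1 -[X in _ * X = _]hn /C0.
by field; rewrite vol_complex_neq0 as0 p0 pnatr_eq0 -lt0n fact_gt0.
Qed.

End IntegralRepresentation.

Theorem theorem3p2 (R : realType) (d sigma : nat) (hd : (1 <= d)%N)
    (hsigma : (d + 1 <= sigma)%N)
    (g : 'M[R[i]]_(1 + d)) (gSU : SU1 g) (gnd : nondeg g) :
  let s : R[i] := sigma%:R in
  let p := pvec g in
  let pt := ptvec g in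
  let U := Umx g in
  let p0sq : R[i] := `|ablk g| ^- 2 in
  let M V (m n : mindex d) := meixner V s m (mvec n) in
  (forall m m' : mindex d,
     has_sum (fun n : mindex d =>
         poch s (mabs n) / (mfact n)%:R * mpow p n * mpow (vconj p) n
         * M U m n * (M U m' n)^*)
       ((m == m')%:R * ((mfact m)%:R * mpowN pt m * mpowN (vconj pt) m
                        / (poch s (mabs m) * p0sq ^+ sigma))))
  /\
  (forall n n' : mindex d,
     has_sum (fun m : mindex d =>
         poch s (mabs m) / (mfact m)%:R * mpow pt m * mpow (vconj pt) m
         * M U m n * (M U m n')^*)
       ((n == n')%:R * ((mfact n)%:R * mpowN p n * mpowN (vconj p) n
                        / (poch s (mabs n) * p0sq ^+ sigma))))
  /\
  (forall m n : mindex d,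
     exists2 I : R[i],
       has_ball_integral (fun z : 'rV[R[i]]_d =>
           (1 + \sum_i pt 0 i * z 0 i) ^- (sigma + mabs n)
           * (\prod_i (1 + \sum_j U i j * pt 0 j * z 0 j) ^+ n i)
           * mpow (vconj z) m
           * (1 - enorm z ^+ 2) ^+ (sigma - d - 1)) I
       & (-1) ^+ mabs m * mpow pt m * M U m n
         = poch (s - d%:R) d / (d`!)%:R * I)
  /\
  (forall m n : mindex d, M U m n = M U^T n m)
  /\
  (forall g1 g2 : 'M[R[i]]_(1 + d), SU1 g1 -> SU1 g2 ->
     nondeg g1 -> nondeg g2 -> nondeg (g1 *m g2) ->
     forall m n : mindex d,
       has_sum (fun k : mindex d =>
           (-1) ^+ mabs k * mpow (pvec g1) k * mpow (ptvec g2) k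
           * (poch s (mabs k) / (mfact k)%:R)
           * M (Umx g1) m k * M (Umx g2) k n)
         ((ablk g1 * ablk g2 / ablk (g1 *m g2)) ^+ sigma
          * mpow (ptvec (g1 *m g2)) m * mpowN (ptvec g1) m
          * mpow (pvec (g1 *m g2)) n * mpowN (pvec g2) n
          * M (Umx (g1 *m g2)) m n)).
Proof.
move=> s p pt U p0sq M.
have s0 : (0 < sigma)%N by apply: leq_trans hsigma; rewrite addn1.
split; [|split; [|split; [|split]]].
- by move=> m m'; exact: orthogonality_n.
- by move=> n n'; exact: orthogonality_m.
- move=> m n; pose q := (sigma - d - 1)%N.
  have sE : sigma = (q + d).+1 by rewrite /q; lia.
  have [I hI eI] := integral_representation q m n gSU gnd.
  rewrite -sE in hI eI; exists I; first exact: hI.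
  rewrite [LHS]eI; congr (poch _ _ / _ * _).
  by rewrite /s {1}sE -addSn natrD addrK.
- by move=> m n; exact: meixner_duality.
- by move=> g1 g2 h1 h2 n1 n2 n12 m n; exact: sum_identity.
Qed.
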